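(* For every $n\geqslant2$ consider the identity map $\mathrm{id}:(\overline{\mathcal T}_n)_{A_\infty}\to(\overline{\mathcal T}_n)_{\Omega BAs}$ from the compactified moduli space of stable metric ribbon trees with its $A_\infty$-cell decomposition to the same space with its (finer) $\Omega BAs$-cell decomposition. Under the functor $C^{cell}_{-*}$ these maps are sent to the morphism of operads $A_\infty\to\Omega BAs$ acting on generating operations as $$m_n\longmapsto\sum_{t\in BRT_n}(t,\omega_{can}),$$ where $\omega_{can}$ denotes the canonical orientation of the binary ribbon tree $t$.
   Context: Operads are non-symmetric; $C^{cell}_{-*}$ denotes cellular chains with opposite (i.e. cohomological) grading, a strong monoidal functor from CW-complexes to dg-$\mathbb Z$-modules. Trees. A ribbon tree is a planar rooted tree with one outgoing external edge and $n$ incoming external edges ordered from left to right; it is stable (resp. binary) if all vertices are at least trivalent (resp. trivalent). $SRT_n$, $BRT_n$: sets of stable, binary ribbon trees with $n$ incoming edges; $e(t)$: number of internal edges. A broken stable ribbon tree is a stable ribbon tree some of whose internal edges are declared broken; the others are its finite internal edges. An orientation $e_1\wedge\cdots\wedge e_i$ is an ordering of the finite internal edges up to even permutation. Moduli spaces. For $t\in SRT_n$, $\mathcal T_n(t)\simeq\,]0,+\infty[^{e(t)}$ is the set of metric trees of type $t$ (a length for each internal edge), and $\mathcal T_n=\bigcup_t\mathcal T_n(t)$, length $0$ meaning collapse of the edge. Allowing lengths $+\infty$ (the edge breaks) gives the compactification $\overline{\mathcal T}_n$, in which the closure of $\mathcal T_n(t)$ is the cube $[0,+\infty]^{e(t)}$.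 The $\Omega BAs$-cell decomposition has one cell for each broken stable ribbon tree $t_{br}$ (parametrized by the lengths of its finite internal edges). In the $A_\infty$-cell decomposition $\mathcal T_n$ is the unique top-dimensional cell, and the lower cells are products of $\mathcal T_k$'s, grouped according to the edges of infinite length. Grafting maps $\circ_i:\overline{\mathcal T}_k\times\overline{\mathcal T}_h\to\overline{\mathcal T}_{h+k-1}$ (grafting with an edge of infinite length) are cellular for both decompositions. $\Omega BAs$. $\Omega BAs=\{C^{cell}_{-*}((\overline{\mathcal T}_n)_{\Omega BAs})\}$ is spanned by pairs $(t_{br},\omega)$ with $(t_{br},-\omega)=-(t_{br},\omega)$, where $(t_{br},e_1\wedge\cdots\wedge e_i)$ is the cell of $t_{br}$ oriented through its parametrization by $(l_{e_1},\dots,l_{e_i})$; the partial compositions are $(t_{br},\omega)\circ_k(t_{br}',\omega')=(t_{br}\circ_kt'_{br},\omega\wedge\omega')$. $A_\infty$. $A_\infty$ is the quasi-free operad generated by $m_n$ of degree $2-n$, $n\geqslant2$, with $\partial m_n=-\sum_{i_1+i_2+i_3=n,\,2\leqslant i_2\leqslant n-1}(-1)^{i_1+i_2i_3}m_{i_1+1+i_3}(\mathrm{id}^{\otimes i_1}\otimes m_{i_2}\otimes\mathrm{id}^{\otimes i_3})$. It is identified with $\{C^{cell}_{-*}((\overline{\mathcal T}_n)_{A_\infty})\}$, $m_n$ being the top cell $\mathcal T_n$ with the following orientation. $(\overline{\mathcal T}_n)_{A_\infty}$ is isomorphic, as a CW-complex, to the Loday polytope $K_n\subset\mathbb R^{n-1}$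 defined by $\sum_{i=1}^{n-1}x_i=\binom n2$ and $x_{i_1+1}+\cdots+x_{i_1+i_2-1}\geqslant\binom{i_2}2$ for all $i_1+i_2+i_3=n$, $2\leqslant i_2\leqslant n-1$; the facet where the last inequality is an equality corresponds to trees with one infinite edge above which lie exactly the incoming edges $i_1+1,\dots,i_1+i_2$. $K_n$ is oriented by the basis $e_j=(1,0,\dots,0,-1,0,\dots,0)$, $1\leqslant j\leqslant n-2$ ($-1$ in position $j+1$), and $\mathcal T_n$ gets the corresponding orientation. Canonical orientations. The Tamari order on $BRT_n$ is generated by covering relations replacing somewhere in a tree a right-leaning configuration (a vertex with left input $t_1$ and right input, through an internal edge $e$, a vertex with inputs $t_2,t_3$; below it is $t_4$) by the left-leaning configuration (a vertex with left input, through an internal edge again called $e$, a vertex with inputs $t_1,t_2$, and with right input $t_3$). The maximal element is the right-leaning comb, with internal edges $e_1,\dots,e_{n-2}$ numbered from the root upwards; set $\omega_{can}=e_1\wedge\cdots\wedge e_{n-2}$ for it. Going down each covering relation, the orientation $\omega$ is replaced by $-\omega$ (edges identified as indicated); the orientation so obtained on every $t\in BRT_n$ is independent of the path and is denoted $\omega_{can}$. *)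

(* Defs.v *)
From HB Require Import structures.
From mathcomp Require Import all_boot all_order all_algebra.
From mathcomp Require Import all_classical all_reals all_analysis.
From mathcomp Require Import freeg.

Set Implicit Arguments.
Unset Strict Implicit.
Unset Printing Implicit Defensive.
Import Order.TTheory GRing.Theory Num.Theory.
Import numFieldNormedType.Exports.

Local Open Scope classical_set_scope.
Local Open Scope ring_scope.

(* Singular homology is taken in its normalized cubical model: chains are
   generated by singular cubes, and degenerate cubes are discarded. To keep the
   operations on chains total, the generators are arbitrary functions from the
   cube to the ambient space; continuity is imposed in [chain_in]. *)

Section UnitInterval.
Variable R : realType.

Definition unitI := set_type (`[0%R, 1%R]%classic : set R).
HB.instance Definition _ := Topological.on unitI.

Fact unitI_bool_subproof (b : bool) :
  (b%:R : R) \in (`[0%R, 1%R]%classic : set R).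
Proof. by apply: mem_set; rewrite /= in_itv /=; case: b; rewrite ?ler01 lexx. Qed.

Definition unitI_bool (b : bool) : unitI :=
  SigSub (unitI_bool_subproof b).

Definition cube (k : nat) := {ptws 'I_k -> unitI}.
HB.instance Definition _ k := Topological.on (cube k).

Definition face_map k (i : 'I_k.+1) (b : bool) (x : cube k) : cube k.+1 :=
  fun j => if unlift i j is Some j' then x j' else unitI_bool b.

End UnitInterval.

Section Chains.
Variable R : realType.

Definition chains (E : choiceType) (k : nat) : zmodType := {freeg (cube R k -> E) / int}.

Definition scube (E : choiceType) k (s : cube R k -> E) : chains E k :=
  << s >>.

Definition lift_chains (E : choiceType) k (V : zmodType) (f : (cube R k -> E) -> V)
    (c : chains E k) : V :=
  \sum_(s <- dom (c : {freeg (cube R k -> E) / int}))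
    f s *~ coeff s (c : {freeg (cube R k -> E) / int}).

(* The boundary of a 1-cube s is s(1) - s(0): boundaries are oriented by the
   outward normal first. *)
Definition bd_cube (E : choiceType) k (s : cube R k.+1 -> E) : chains E k :=
  \sum_(i < k.+1)
    (scube (s \o face_map i true) - scube (s \o face_map i false))
      *~ (-1) ^+ i.

Definition bd (E : choiceType) (k : nat) : chains E k -> chains E k.-1 :=
  match k with
  | 0 => fun=> 0
  | k'.+1 => lift_chains (@bd_cube E k')
  end.

Definition push_chain (E F : choiceType) (f : E -> F) k : chains E k -> chains F k :=
  lift_chains (fun s => scube (f \o s)).

Definition cross_cube (E F G : choiceType) (g : E -> F -> G) p q
    (s : cube R p -> E) (t : cube R q -> F) : cube R (p + q) -> G :=
  fun x => g (s (fun i => x (lshift q i))) (t (fun j => x (rshift p j))).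

(* The image under [g : E * F -> G] of the cross product of two chains. *)
Definition cross_chain (E F G : choiceType) (g : E -> F -> G) p q
    (c : chains E p) (d : chains F q) : chains G (p + q) :=
  lift_chains (fun s => lift_chains (fun t => scube (cross_cube g s t)) d) c.

Definition degenerate (E : choiceType) k (s : cube R k -> E) : Prop :=
  exists i : 'I_k, forall x y : cube R k,
    (forall j, j != i -> x j = y j) -> s x = s y.

(* [c] is, modulo degenerate cubes, a singular chain of the subspace [A]. *)
Definition chain_in (E : topologicalType) k (A : set E) (c : chains E k) : Prop :=
  forall s, s \in dom (c : {freeg (cube R k -> E) / int}) ->
    degenerate s \/ (continuous s /\ forall x, A (s x)).

End Chains.

Section RelativeHomology.
Variables (R : realType) (E : topologicalType) (k : nat) (A B : set E).
Local Notation C := (chains R E k).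

Lemma chain_in0 j (D : set E) : chain_in D (0 : chains R E j).
Proof. by move=> s; rewrite dom0. Qed.

Lemma chain_inB j (D : set E) (c d : chains R E j) :
  chain_in D c -> chain_in D d -> chain_in D (c - d).
Proof.
move=> hc hd s /domB; rewrite mem_cat.
by case/orP; [exact: hc | exact: hd].
Qed.

Lemma lift_chainsB (F : choiceType) j (V : zmodType) (f : (cube R j -> F) -> V)
    (c d : chains R F j) :
  lift_chains f (c - d) = lift_chains f c - lift_chains f d.
Proof.
pose S := undup (dom c ++ dom d).
have ext (e : chains R F j) : {subset dom e <= S} ->
    lift_chains f e = \sum_(s <- S) f s *~ coeff s e.
  move=> le; rewrite /lift_chains [RHS](bigID (mem (dom e))) /=.
  rewrite [X in _ + X]big1 => [|s ns]; last by rewrite coeff_outdom // mulr0z.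
  rewrite addr0 -[RHS]big_filter; apply: perm_big; apply: uniq_perm.
  - exact: uniq_dom.
  - exact/filter_uniq/undup_uniq.
  - move=> s; rewrite mem_filter; apply/idP/andP => [sd|[]//].
    by split=> //; exact: le.
rewrite (ext (c - d)) ?(ext c) ?(ext d).
- by rewrite -sumrB; apply: eq_bigr => s _; rewrite coeffB mulrzBr.
- by move=> s sd; rewrite mem_undup mem_cat sd orbT.
- by move=> s sd; rewrite mem_undup mem_cat sd.
- by move=> s /domB; rewrite mem_undup.
Qed.

Lemma bdB (F : choiceType) j (c d : chains R F j) : bd (c - d) = bd c - bd d.
Proof. by case: j c d => [c d|j c d]; [rewrite /= subr0 | exact: lift_chainsB]. Qed.

Lemma bd0 (F : choiceType) j : bd (0 : chains R F j) = 0.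
Proof. by rewrite -[X in bd X](subrr 0) bdB subrr. Qed.

Definition rel_cycle : {pred C} :=
  fun c => `[< chain_in A c /\ chain_in B (bd c) >].

Fact rel_cycle_zmod_closed : zmod_closed rel_cycle.
Proof.
split=> [|c d /asboolP[c1 c2] /asboolP[d1 d2]]; apply/asboolP.
  by rewrite bd0; split; exact: chain_in0.
by rewrite bdB; split; exact: chain_inB.
Qed.

HB.instance Definition _ := GRing.isZmodClosed.Build C rel_cycle
  rel_cycle_zmod_closed.

Record cycles := Cycle { cycle_val : C; _ : cycle_val \in rel_cycle }.
HB.instance Definition _ := [isSub for cycle_val].
HB.instance Definition _ := [Choice of cycles by <:].
HB.instance Definition _ := [SubChoice_isSubZmodule of cycles by <:].

Definition rel_boundary : {pred cycles} :=
  fun c => `[< exists2 w : chains R E k.+1,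
    chain_in A w & chain_in B (val c - (bd w : C)) >].

Fact rel_boundary_zmod_closed : zmod_closed rel_boundary.
Proof.
split=> [|c d /asboolP[v v1 v2] /asboolP[w w1 w2]]; apply/asboolP.
  by exists 0; [exact: chain_in0 | rewrite bd0 subr0 raddf0; exact: chain_in0].
exists (v - w); first exact: chain_inB.
have -> : val (c - d) - bd (v - w) =
    (val c - (bd v : C)) - (val d - (bd w : C)).
  by rewrite bdB raddfB /= !opprB addrACA [RHS]addrACA; congr (_ + _);
     rewrite addrC.
exact: chain_inB.
Qed.

HB.instance Definition _ := GRing.isZmodClosed.Build cycles rel_boundary
  rel_boundary_zmod_closed.

(* H_k(A, B), for subspaces B of A of the ambient space E. *)
Definition relH : zmodType := Quotient.quot rel_boundary.

(* The class of a chain, set to be 0 when the chain is not a relative cycle;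
   [hrep] picks a representative. Operations on homology are given by [hclass]
   of a chain-level operation on representatives. *)
Definition hclass (c : C) : relH :=
  (\pi_(Quotient.quot rel_boundary) (insubd (0 : cycles) c))%qT.

Definition hrep (x : relH) : C :=
  val (repr (x : Quotient.quot rel_boundary)).

End RelativeHomology.

Definition hmap (R : realType) (E F : topologicalType) (f : E -> F) k
    (A B : set E) (A' B' : set F) (x : relH R k A B) : relH R k A' B' :=
  hclass A' B' (push_chain f (hrep x)).

(* The open cells of a cell decomposition of a subspace of [E]. *)
Record cells (E : topologicalType) := Cells {
  cell_idx : Type;
  cell_dim : cell_idx -> nat;
  cell_set : cell_idx -> set E }.

(* The union of the cells of dimension < k, that is, the (k-1)-skeleton. *)
Definition skel (E : topologicalType) (X : cells E) (k : nat) : set E :=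
  [set x | exists2 c : cell_idx X, (cell_dim c < k)%N & cell_set c x].

Definition cellular (E F : topologicalType) (X : cells E) (Y : cells F)
    (f : E -> F) : Prop :=
  {within (\bigcup_k skel X k), continuous f} /\
  forall k x, skel X k x -> skel Y k (f x).

(* Cellular k-chains, in cohomological degree -k: H_k(X^(k), X^(k-1)). *)
Definition cell_chains (R : realType) (E : topologicalType) (X : cells E)
    (k : nat) : zmodType := relH R k (skel X k.+1) (skel X k).

Section CellularChains.
Variable R : realType.

(* The connecting map of the triple (X^(k), X^(k-1), X^(k-2)). *)
Definition cell_bd (E : topologicalType) (X : cells E) k
    (x : cell_chains R X k) : cell_chains R X k.-1 :=
  hclass _ _ (bd (hrep x)).

Definition cell_map (E F : topologicalType) (X : cells E) (Y : cells F)
    (f : E -> F) k : cell_chains R X k -> cell_chains R Y k :=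
  hmap f _ _.

Definition cell_cross (E F G : topologicalType) (X : cells E) (Y : cells F)
    (Z : cells G) (g : E -> F -> G) p q (x : cell_chains R X p)
    (y : cell_chains R Y q) : cell_chains R Z (p + q) :=
  hclass _ _ (cross_chain g (hrep x) (hrep y)).

End CellularChains.

(* Gradings are homological: index k stands for the cohomological degree -k.
   All the operads at hand are concentrated in nonpositive degrees. The inputs
   are numbered from 0 in partial compositions: [ocomp i x y] is x o_{i+1} y,
   meaningful when i is less than the arity of x. *)

Record operad_data := OperadData {
  op : nat -> nat -> zmodType;
  ounit : op 1 0;
  ocomp : forall m n p q, nat -> op m p -> op n q -> op (m + n).-1 (p + q) }.

Record dg_operad_data := DgOperadData {
  dg_op :> operad_data;
  odiff : forall n k, op dg_op n k -> op dg_op n k.-1 }.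

Arguments ounit {_}.
Arguments ocomp {_ m n p q}.
Arguments odiff {_ n k}.

(* Transport along equalities of the arity and of the degree. *)
Definition transport (O : operad_data) n k n' k' (x : op O n k) : op O n' k' :=
  match @eqP _ (n, k) (n', k') with
  | ReflectT e => ecast nk (op O nk.1 nk.2) e x
  | ReflectF _ => 0
  end.
Arguments transport {O n k n' k'}.

Definition is_operad (O : operad_data) : Prop :=
  [/\ (forall m n p q i (x x' : op O m p) (y y' : op O n q), (i < m)%N ->
        ocomp i (x - x') y = ocomp i x y - ocomp i x' y /\
        ocomp i x (y - y') = ocomp i x y - ocomp i x y'),
      (forall n k (x : op O n k), transport (ocomp 0 ounit x) = x),
      (forall n k i (x : op O n k), (i < n)%N ->
        transport (ocomp i x ounit) = x),
      (forall l m n p q r i j (x : op O l p) (y : op O m q) (z : op O n r),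
        (i < l)%N -> (j < m)%N ->
        transport (ocomp (i + j) (ocomp i x y) z) = ocomp i x (ocomp j y z)) &
      (forall l m n p q r i j (x : op O l p) (y : op O m q) (z : op O n r),
        (i < j < l)%N ->
        transport (ocomp (j + m).-1 (ocomp i x y) z) =
        ocomp i (ocomp j x z) y *~ (-1) ^+ (q * r))].

Definition is_dg_operad (O : dg_operad_data) : Prop :=
  [/\ is_operad O,
      (forall n k (x y : op O n k), odiff (x - y) = odiff x - odiff y),
      (forall n k (x : op O n k), odiff (odiff x) = 0),
      (forall n (x : op O n 0), odiff x = 0) &
      (forall m n p q i (x : op O m p) (y : op O n q), (i < m)%N ->
        odiff (ocomp i x y) =
        transport (ocomp i (odiff x) y) +
        transport (ocomp i x (odiff y)) *~ (-1) ^+ p)].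

Definition is_operad_mor (O P : operad_data)
    (f : forall n k, op O n k -> op P n k) : Prop :=
  [/\ (forall n k (x y : op O n k), f n k (x - y) = f n k x - f n k y),
      f 1 0 ounit = ounit &
      (forall m n p q i (x : op O m p) (y : op O n q), (i < m)%N ->
        f _ _ (ocomp i x y) = ocomp i (f _ _ x) (f _ _ y))].

Definition is_dg_operad_mor (O P : dg_operad_data)
    (f : forall n k, op O n k -> op P n k) : Prop :=
  is_operad_mor f /\ forall n k (x : op O n k), f _ _ (odiff x) = odiff (f _ _ x).

Definition is_dg_operad_iso (O P : dg_operad_data)
    (f : forall n k, op O n k -> op P n k) : Prop :=
  is_dg_operad_mor f /\ forall n k, bijective (f n k).

(* [O] is free, as a graded operad, on elements m_n of arity n and degree 2-n,
   n >= 2; the values m_0 and m_1 are irrelevant. *)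
Definition is_free_on (O : operad_data) (m : forall n, op O n (n - 2)) : Prop :=
  forall (P : operad_data) (p : forall n, op P n (n - 2)), is_operad P ->
    (exists2 f : forall n k, op O n k -> op P n k, is_operad_mor f &
       forall n, (2 <= n)%N -> f _ _ (m n) = p n) /\
    (forall f g : forall n k, op O n k -> op P n k,
       is_operad_mor f -> is_operad_mor g ->
       (forall n, (2 <= n)%N -> f _ _ (m n) = g _ _ (m n)) ->
       forall n k x, f n k x = g n k x).

Definition is_Ainf (A : dg_operad_data) (m : forall n, op A n (n - 2)) : Prop :=
  [/\ is_dg_operad A, is_free_on m &
      forall n, (2 <= n)%N ->
        odiff (m n) =
        - \sum_(i1 < n.+1) \sum_(i2 < n | (2 <= i2)%N && (i1 + i2 <= n)%N)
            (let i3 := (n - i1 - i2)%N in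
             transport (ocomp i1 (m (i1 + 1 + i3)%N) (m i2))
               *~ (-1) ^+ (i1 + i2 * i3))].

Inductive ribbon := Leaf | Node of seq ribbon.

HB.instance Definition _ := gen_eqMixin ribbon.
HB.instance Definition _ := gen_choiceMixin ribbon.

Fixpoint leaves (t : ribbon) : nat :=
  match t with
  | Leaf => 1
  | Node ts => sumn (map leaves ts)
  end.

Fixpoint stable (t : ribbon) : bool :=
  match t with
  | Leaf => true
  | Node ts => (1 < size ts)%N && all stable ts
  end.

Fixpoint binary (t : ribbon) : bool :=
  match t with
  | Leaf => true
  | Node ts => (size ts == 2) && all binary ts
  end.

Definition SRT n : set ribbon := [set t | stable t /\ leaves t = n].
Definition BRT n : set ribbon := [set t | binary t /\ leaves t = n].

(* The internal edge above which lie exactly the incoming edges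
   i1+1, ..., i1+i2 is encoded by (i1, i2). *)
Definition edge := (nat * nat)%type.

(* The edges at the bottom of the vertices of [t], the leftmost incoming edge
   of [t] being numbered o+1; the first one is the root edge. *)
Fixpoint vertex_edges (o : nat) (t : ribbon) : seq edge :=
  match t with
  | Leaf => [::]
  | Node ts =>
      (o, leaves t) ::
      (fix go (o : nat) (ts : seq ribbon) : seq edge :=
         match ts with
         | [::] => [::]
         | t' :: ts' => vertex_edges o t' ++ go (o + leaves t')%N ts'
         end) o ts
  end.

Definition edges (t : ribbon) : seq edge := behead (vertex_edges 0 t).

(* An orientation: a sign and an ordering of the edges. *)
Definition orientation := (bool * seq edge)%type.

(* [rotation o t t' e e']: t covers t' in the Tamari order; the internal edge e
   of the right-leaning configuration of t becomes the edge e' of the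
   left-leaning configuration of t'. All other edges are unchanged. *)
Inductive rotation : nat -> ribbon -> ribbon -> edge -> edge -> Prop :=
| rotation_root o t1 t2 t3 :
    rotation o (Node [:: t1; Node [:: t2; t3]]) (Node [:: Node [:: t1; t2]; t3])
      (o + leaves t1, leaves t2 + leaves t3)%N
      (o, leaves t1 + leaves t2)%N
| rotation_left o t t' s e e' : rotation o t t' e e' ->
    rotation o (Node [:: t; s]) (Node [:: t'; s]) e e'
| rotation_right o t t' s e e' : rotation (o + leaves s)%N t t' e e' ->
    rotation o (Node [:: s; t]) (Node [:: s; t']) e e'.

Definition right_comb (n : nat) : ribbon :=
  iter n.-1 (fun t => Node [:: Leaf; t]) Leaf.

Inductive canonical : ribbon -> orientation -> Prop :=
| canonical_comb n : (2 <= n)%N ->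
    canonical (right_comb n) (false, [seq (a, n - a)%N | a <- iota 1 (n - 2)])
| canonical_step t t' e e' (w : orientation) :
    canonical t w -> rotation 0 t t' e e' ->
    canonical t' (~~ w.1, [seq if x == e then e' else x | x <- w.2]).

(* Up to even permutation, it does not depend on the choice of a path. *)
Definition omega_can (t : ribbon) : orientation :=
  xget (false, [::]) (canonical t).

Section Moduli.
Variable R : realType.

(* A metric tree is given by the lengths of its internal edges, extended by 0
   to all other pairs. Collapsing an edge removes it and preserves the encoding
   of the others, so that trees with edges of length 0 are correctly
   identified. *)
Definition lengths := {ptws edge -> \bar R}.
HB.instance Definition _ := Topological.on lengths.

Definition Tbar (n : nat) : set lengths :=
  [set l | exists2 t, SRT n t &
     (forall e, (0 <= l e)%E) /\ (forall e, e \notin edges t -> l e = 0%E)].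

(* The cell indexed by s consists of the metric trees whose edges of infinite
   length are those of s: it is the product, over the vertices of s, of the
   open moduli spaces T_k, and its dimension is the sum of the k - 2. *)
Definition Ainf_cells (n : nat) : cells lengths :=
  @Cells lengths {s : ribbon | SRT n s}
    (fun s => n - 2 - size (edges (sval s)))%N
    (fun s => [set l | Tbar n l /\
       forall e, l e = +oo%E <-> e \in edges (sval s)]).

(* The cells are indexed by broken stable ribbon trees (t, b), where b lists
   the broken edges of t. *)
Definition OmegaBAs_cells (n : nat) : cells lengths :=
  @Cells lengths {tb : ribbon * seq edge | SRT n tb.1 /\ subseq tb.2 (edges tb.1)}
    (fun tb => size (edges (sval tb).1) - size (sval tb).2)%N
    (fun tb => [set l | forall e,
       [/\ e \in (sval tb).2 -> l e = +oo%E,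
           e \in edges (sval tb).1 -> e \notin (sval tb).2 -> (0 < l e < +oo)%E &
           e \notin edges (sval tb).1 -> l e = 0%E]]).

(* Grafting of l' (arity h) at the incoming edge i+1 of l (arity k), with a new
   internal edge (i, h) of infinite length. For k = 1 or h = 1, grafting is
   with the trivial tree and creates no internal edge. *)
Definition graft (k h i : nat) (l l' : lengths) : lengths :=
  fun e => let: (a, b) := e in
    if e == (i, h) then (if (1 < k)%N && (1 < h)%N then +oo%E else 0%E)
    else if (i <= a)%N && (a + b <= i + h)%N then l' ((a - i)%N, b)
    else if (a <= i)%N && (i + h <= a + b)%N then l (a, (b + 1 - h)%N)
    else if (a + b <= i)%N then l (a, b)
    else if (i + h <= a)%N then l ((a + 1 - h)%N, b)
    else 0%E.

(* The operad of cellular chains of the spaces Tbar n with the cell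
   decompositions [X n]. *)
Definition cell_operad (X : nat -> cells lengths) : dg_operad_data :=
  @DgOperadData
    (@OperadData
       (fun n k => cell_chains R (X n) k)
       (hclass _ _ (scube (fun=> (fun=> 0%E) : lengths)))
       (fun m n p q i x y =>
          cell_cross (X (m + n).-1) (graft m n i) x y))
    (fun n k x => cell_bd x).

Definition OmegaBAs : dg_operad_data := cell_operad OmegaBAs_cells.

(* The increasing homeomorphism x |-> x / (1 - x) from [0, 1] to [0, +oo]. *)
Definition length_of (x : unitI R) : \bar R :=
  if set_val x == 1 then +oo%E else (set_val x / (1 - set_val x))%:E.

(* The parametrization of the closed cell of a broken tree by the lengths of
   its finite internal edges, listed by w. *)
Definition cell_param (t : ribbon) k (w : seq edge) (x : cube R k) : lengths :=
  fun e => if e \in edges t then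
             (if insub (index e w) is Some i then length_of (x i) else +oo%E)
           else 0%E.

(* The generator (t_br, w) of OmegaBAs in degree -k: w is an ordering of the k
   finite internal edges of t_br; the other edges of t are broken. *)
Definition oriented_tree n k (t : ribbon) (w : orientation) : op OmegaBAs n k :=
  hclass _ _ (scube (@cell_param t k w.2)) *~ (-1) ^+ w.1.

Definition loday (n : nat) : set 'rV[R]_(n.-1) :=
  [set x | \sum_j x ord0 j = 'C(n, 2)%:R /\
     forall i1 i2, (2 <= i2 <= n.-1)%N -> (i1 + i2 <= n)%N ->
       'C(i2, 2)%:R <= \sum_(j < n.-1 | (i1 <= j < (i1 + i2).-1)%N) x ord0 j].

Definition loday_facet (n i1 i2 : nat) : set 'rV[R]_(n.-1) :=
  [set x | loday x /\
     \sum_(j < n.-1 | (i1 <= j < (i1 + i2).-1)%N) x ord0 j = 'C(i2, 2)%:R].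

Definition loday_boundary (n : nat) : set 'rV[R]_(n.-1) :=
  [set x | exists i1 i2, [/\ (2 <= i2 <= n.-1)%N, (i1 + i2 <= n)%N &
     loday_facet i1 i2 x]].

Definition loday_basis (n : nat) (j : 'I_(n - 2)) : 'rV[R]_(n.-1) :=
  \row_c (((c : nat) == 0%N)%:R - ((c : nat) == j.+1)%:R).

Definition parallelepiped d (V : normedModType R) (p : V) (v : 'I_d -> V)
    (x : cube R d) : V := p + \sum_j set_val (x j) *: v j.

(* The class c of H_d(K, dK) restricts, in H_d(K, K - q), to the class of every
   parallelepiped in K with center q and edges positively proportional to v. *)
Definition is_fundamental_class d (V : normedModType R) (K dK : set V)
    (v : 'I_d -> V) (c : relH R d K dK) : Prop :=
  forall (p : V) (eps : R), 0 < eps ->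
    (forall x : cube R d, K (parallelepiped p (fun j => eps *: v j) x)) ->
    let q := p + \sum_j (eps / 2) *: v j in
    hmap id K (K `\ q) c =
    hclass K (K `\ q) (scube (parallelepiped p (fun j => eps *: v j))).

Definition loday_class (n : nat) :
    relH R (n - 2) (@loday n) (@loday_boundary n) :=
  xget 0 (is_fundamental_class (@loday_basis n)).

(* An isomorphism of CW-complexes from K_n to the A-infinity decomposition:
   faces are intersections of facets, so that it suffices to match facets. *)
Definition is_loday_iso (n : nat) (phi : 'rV[R]_(n.-1) -> lengths) : Prop :=
  [/\ {within @loday n, continuous phi},
      (exists2 psi : lengths -> 'rV[R]_(n.-1), {within Tbar n, continuous psi} &
         (forall x, loday x -> psi (phi x) = x) /\
         (forall l, Tbar n l -> loday (psi l) /\ phi (psi l) = l)),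
      (forall x, loday x -> Tbar n (phi x)) &
      (forall i1 i2, (2 <= i2 <= n.-1)%N -> (i1 + i2 <= n)%N ->
         forall x, loday x ->
           loday_facet i1 i2 x <-> phi x (i1, i2) = +oo%E)].

(* The cell T_n, oriented through K_n. *)
Definition top_cell (n : nat) (phi : 'rV[R]_(n.-1) -> lengths) :
    op (cell_operad Ainf_cells) n (n - 2) :=
  hmap phi _ _ (loday_class n).

End Moduli.

(* Main.v *)
Require Import Defs.
From HB Require Import structures.
From mathcomp Require Import freeg.
From mathcomp Require Import all_boot all_order all_algebra.
From mathcomp Require Import all_classical all_reals all_analysis.
From mathcomp Require Import zify lra.
Import Order.TTheory GRing.Theory Num.Theory.
Import numFieldNormedType.Exports.
Local Open Scope classical_set_scope.
Local Open Scope ring_scope.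
Set Implicit Arguments.
Unset Strict Implicit.
Unset Printing Implicit Defensive.

(* The boundary of the sum c_n of the cubes of all binary trees with n leaves has
   two kinds of faces. Those on which an edge is collapsed come in pairs which
   cancel; those on which an edge becomes infinite are the products of c_k and c_h
   under grafting, with the signs of the A-infinity equation. In particular c_n
   is a relative cycle for the A-infinity decomposition.

   The degree of Loday's identification of K_n with the space of metric trees need
   not be computed for n >= 3. As A is free, m_n spans its part of arity n and
   degree 2-n, so that [c_n] = z Theta(m_n) for an integer z. By induction on n
   both [c_n] and Theta(m_n) have the boundary prescribed by the A-infinity
   equation; this boundary is not a torsion element, as a morphism from A to a
   small test operad shows, hence z = 1. Only for n = 2, where K_n is a point, is
   the orientation of K_n used.

   Permuting the edges changes the cube of a tree by a sign only up to homology.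
   The cubes are therefore replaced by homologous chains which are exactly
   alternating in the ordering of the edges. *)

(** Signs are computed on lists of edges in depth-first order, for an arbitrary function of such
    lists. Two binary trees that become equal after an edge of each is collapsed leave the same
    list, so the collapsed faces cancel without any alternation. Alternation is needed only where a
    list is really reordered: when the edges of a grafted tree are separated into those of its two
    factors, and when [omega_can] is compared with the depth-first order. Products under grafting,
    in contrast, are computed on the cubes themselves, where they are exact. Both systems of chains
    are therefore kept and joined by a homotopy, built by coning off each closed cell, a product of
    intervals, through truncation of lengths. The homotopy of a single tree does not respect the
    A-infinity skeleta, because collapsing an edge does not leave the open A-infinity cell. Only its
    signed sum over all binary trees does, again by the cancellation of collapsed faces. *)

Arguments bd : simpl never.

(** * Cubical chains *)

Section ChainAlgebra.
Variable R : realType.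
Implicit Types E F G : choiceType.

HB.instance Definition _ E k (V : zmodType) (f : (cube R k -> E) -> V) :=
  GRing.isZmodMorphism.Build (chains R E k) V (lift_chains f) (lift_chainsB f).

Lemma lift_scube E k (V : zmodType) (f : (cube R k -> E) -> V) s :
  lift_chains f (scube s) = f s.
Proof. by rewrite /lift_chains domU1 big_seq1 coeffU eqxx mulr1 mulr1z. Qed.

Lemma chain_sumE E k (c : chains R E k) :
  c = \sum_(s <- dom (c : {freeg (cube R k -> E) / int}))
        scube s *~ coeff s (c : {freeg (cube R k -> E) / int}).
Proof.
rewrite -[LHS](freeg_sumE (c : {freeg (cube R k -> E) / int})).
by apply: eq_bigr => s _; rewrite freegU_mulz intz.
Qed.

Lemma lift_chains_eq E k (V : zmodType) (f g : chains R E k -> V) :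
    zmod_morphism f -> zmod_morphism g ->
  (forall s, f (scube s) = g (scube s)) -> forall c, f c = g c.
Proof.
move=> fB gB fg c.
pose fM := GRing.isZmodMorphism.Build _ _ f fB.
pose gM := GRing.isZmodMorphism.Build _ _ g gB.
pose f' : {additive chains R E k -> V} := HB.pack f fM.
pose g' : {additive chains R E k -> V} := HB.pack g gM.
rewrite -[f]/(f' : _ -> _) -[g]/(g' : _ -> _) (chain_sumE c) !raddf_sum.
by apply: eq_bigr => s _; rewrite !raddfMz /= fg.
Qed.

Lemma eq_lift_chains E k (V : zmodType) (f g : (cube R k -> E) -> V) :
  f =1 g -> lift_chains f =1 lift_chains g.
Proof. by move=> /funext->. Qed.

Lemma bd_morph E k : zmod_morphism (@bd R E k).
Proof. exact: bdB. Qed.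
HB.instance Definition _ E k :=
  GRing.isZmodMorphism.Build (chains R E k) (chains R E k.-1) (@bd R E k)
    (@bd_morph E k).

Lemma bd_scube E k (s : cube R k.+1 -> E) : bd (scube s) = bd_cube s.
Proof. exact: lift_scube. Qed.

Lemma push_morph E F (f : E -> F) k : zmod_morphism (@push_chain R E F f k).
Proof. exact: lift_chainsB. Qed.
HB.instance Definition _ E F (f : E -> F) k :=
  GRing.isZmodMorphism.Build _ _ (@push_chain R E F f k) (@push_morph E F f k).

Lemma push_scube E F (f : E -> F) k (s : cube R k -> E) :
  push_chain f (scube s) = scube (f \o s).
Proof. exact: lift_scube. Qed.

Lemma push_id E k (c : chains R E k) : push_chain id c = c.
Proof.
apply: (lift_chains_eq (f := @push_chain R E E id k) (g := fun c => c)) => // [|s].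
  exact: push_morph.
by rewrite push_scube.
Qed.

Lemma lift_comp E k (V W : zmodType) (f : (cube R k -> E) -> V)
    (h : {additive V -> W}) c :
  h (lift_chains f c) = lift_chains (h \o f) c.
Proof.
rewrite /lift_chains raddf_sum; apply: eq_bigr => s _.
by rewrite raddfMz.
Qed.

Lemma push_bd E F (f : E -> F) k (c : chains R E k) :
  push_chain f (bd c) = bd (push_chain f c).
Proof.
case: k c => [|k] c; first by rewrite raddf0.
rewrite /bd /push_chain !lift_comp; apply: eq_lift_chains => s /=.
rewrite lift_scube /bd_cube raddf_sum; apply: eq_bigr => i _ /=.
by rewrite raddfMz raddfB /= !lift_scube.
Qed.

Lemma cross_morphl E F G (g : E -> F -> G) p q (d : chains R F q) :
  zmod_morphism (fun c : chains R E p => cross_chain g c d).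
Proof. exact: lift_chainsB. Qed.

Lemma cross_morphr E F G (g : E -> F -> G) p q (c : chains R E p) :
  zmod_morphism (@cross_chain R E F G g p q c).
Proof.
move=> d d'; rewrite /cross_chain /lift_chains -sumrB; apply: eq_bigr => s _.
by rewrite -mulrzBl; congr (_ *~ _); exact: lift_chainsB.
Qed.

Lemma cross_scube E F G (g : E -> F -> G) p q (s : cube R p -> E)
    (t : cube R q -> F) :
  cross_chain g (scube s) (scube t) = scube (cross_cube g s t).
Proof. by rewrite /cross_chain !lift_scube. Qed.

HB.instance Definition _ E F G (g : E -> F -> G) p q c :=
  GRing.isZmodMorphism.Build _ _ (@cross_chain R E F G g p q c)
    (@cross_morphr E F G g p q c).

(** The arguments are exchanged so that additivity in the first factor can be declared as a
    canonical structure. *)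
Definition crossl E F G (g : E -> F -> G) p q d c := @cross_chain R E F G g p q c d.
HB.instance Definition _ E F G (g : E -> F -> G) p q d :=
  GRing.isZmodMorphism.Build _ _ (@crossl E F G g p q d)
    (@cross_morphl E F G g p q d).
Lemma crosslE E F G (g : E -> F -> G) p q d c :
  @cross_chain R E F G g p q c d = crossl g d c.
Proof. by []. Qed.

End ChainAlgebra.

(** * Boundaries and cross products, by currying one coordinate *)

Section Uncurry.
Variable R : realType.
Implicit Types E F G : choiceType.

(** A cube is regarded as a cube of paths of one dimension less. As generators are arbitrary
    functions, the set of paths needs no topology, and identities between boundaries follow by
    induction on the dimension with a varying target. *)
Definition uncurry_cube E k (s : cube R k -> unitI R -> E) : cube R k.+1 -> E :=
  fun x => s (fun j => x (lift ord0 j)) (x ord0).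

Definition uncurry_chain E k : chains R (unitI R -> E) k -> chains R E k.+1 :=
  lift_chains (fun s => scube (uncurry_cube s)).

HB.instance Definition _ E k :=
  GRing.isZmodMorphism.Build _ _ (@uncurry_chain E k)
    (@lift_chainsB _ _ _ _ (fun s => scube (uncurry_cube s))).

Lemma uncurry_scube E k (s : cube R k -> unitI R -> E) :
  uncurry_chain (scube s) = scube (uncurry_cube s).
Proof. exact: lift_scube. Qed.

Definition cons_cube k (u : unitI R) (x : cube R k) : cube R k.+1 :=
  fun j => if unlift ord0 j is Some j' then x j' else u.

Lemma cons_cubeE k (y : cube R k.+1) :
  cons_cube (y ord0) (fun j => y (lift ord0 j)) = y.
Proof. by apply: funext => j; rewrite /cons_cube; case: unliftP => [j'|] ->. Qed.

Lemma cons_cube0 k u (x : cube R k) : cons_cube u x ord0 = u.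
Proof. by rewrite /cons_cube unlift_none. Qed.

Lemma cons_cubeS k u (x : cube R k) : (fun j => cons_cube u x (lift ord0 j)) = x.
Proof. by apply: funext => j; rewrite /cons_cube liftK. Qed.

Lemma uncurryK E k (s : cube R k.+1 -> E) :
  uncurry_cube (fun x u => s (cons_cube u x)) = s.
Proof. by apply: funext => x; rewrite /uncurry_cube cons_cubeE. Qed.

Lemma face_map0 k b (x : cube R k) : face_map ord0 b x = cons_cube (unitI_bool R b) x.
Proof. by apply: funext => j. Qed.

Lemma face_mapS k (i : 'I_k.+1) b (x : cube R k.+1) :
  face_map (lift ord0 i) b x =
  cons_cube (x ord0) (face_map i b (fun j => x (lift ord0 j))).
Proof.
apply: funext => j; rewrite /face_map /cons_cube.
case: (unliftP ord0 j) => [j' ->|->].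
  case: (unliftP i j') => [m ->|->].
    have -> : lift ord0 (lift i m) = lift (lift ord0 i) (lift ord0 m).
      by apply: val_inj; rewrite /= /bump; lia.
    by rewrite liftK.
  by rewrite unlift_none.
have -> : ord0 = lift (lift ord0 i) ord0 :> 'I_k.+2 by apply: val_inj.
rewrite liftK; congr x; exact: val_inj.
Qed.

(** The faces in the first direction are the endpoints of the paths; the others have their index
    raised by one, whence the minus sign. *)
Lemma bd_uncurry_cube E k (s : cube R k -> unitI R -> E) :
  bd (scube (uncurry_cube s)) =
  scube (fun x => s x (unitI_bool R true)) -
  scube (fun x => s x (unitI_bool R false)) -
  (if k is k'.+1 return (cube R k -> unitI R -> E) -> chains R E k
   then fun s => uncurry_chain (bd (scube s)) else fun=> 0) s.
Proof.
rewrite bd_scube /bd_cube big_ord_recl /= mulr1z.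
have f0 b : uncurry_cube s \o face_map ord0 b = (fun x => s x (unitI_bool R b)).
  by apply: funext => x; rewrite /= /uncurry_cube face_map0 cons_cube0 cons_cubeS.
rewrite !f0; congr (_ + _); case: k s {f0} => [|k] s; first by rewrite big_ord0 oppr0.
rewrite /= bd_scube /bd_cube (raddf_sum (@uncurry_chain E k)) -sumrN; apply: eq_bigr => i _ /=.
rewrite raddfMz raddfB /= !uncurry_scube /bump /= exprS mulN1r mulrNz.
by congr (- ((scube _ - scube _) *~ _)); apply: funext => x;
   rewrite /= /uncurry_cube face_mapS cons_cube0 cons_cubeS.
Qed.

Definition eval_chain E b k : chains R (unitI R -> E) k -> chains R E k :=
  @push_chain R (unitI R -> E) E (fun f => f (unitI_bool R b)) k.
HB.instance Definition _ E b k :=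
  GRing.isZmodMorphism.Build _ _ (@eval_chain E b k)
    (@push_morph R (unitI R -> E) E (fun f => f (unitI_bool R b)) k).

Lemma bd_uncurryS E k (c : chains R (unitI R -> E) k.+1) :
  bd (uncurry_chain c) =
  eval_chain true c - eval_chain false c - uncurry_chain (bd c).
Proof.
pose f : {additive chains R (unitI R -> E) k.+1 -> chains R E k.+1} :=
  (@bd R E k.+2) \o (@uncurry_chain E k.+1).
pose g : {additive chains R (unitI R -> E) k.+1 -> chains R E k.+1} :=
  (@eval_chain E true k.+1 \- @eval_chain E false k.+1) \-
  (@uncurry_chain E k \o @bd R _ k.+1).
apply: (lift_chains_eq (f := f) (g := g)) => [||s]; try exact: raddfB.
by rewrite /f /g /= uncurry_scube bd_uncurry_cube /eval_chain !push_scube.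
Qed.

Lemma bd_uncurry0 E (c : chains R (unitI R -> E) 0) :
  bd (uncurry_chain c) = eval_chain true c - eval_chain false c.
Proof.
pose f : {additive chains R (unitI R -> E) 0 -> chains R E 0} :=
  (@bd R E 1) \o (@uncurry_chain E 0).
pose g : {additive chains R (unitI R -> E) 0 -> chains R E 0} :=
  (@eval_chain E true 0 \- @eval_chain E false 0).
apply: (lift_chains_eq (f := f) (g := g)) => [||s]; try exact: raddfB.
by rewrite /f /g /= uncurry_scube bd_uncurry_cube /eval_chain !push_scube subr0.
Qed.

Definition curry_chain E k : chains R E k.+1 -> chains R (unitI R -> E) k :=
  lift_chains (fun s => scube (fun x u => s (cons_cube u x))).

Lemma curry_chainK E k (c : chains R E k.+1) : uncurry_chain (curry_chain c) = c.
Proof.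
rewrite -[RHS]push_id /curry_chain lift_comp; apply: eq_lift_chains => s /=.
by rewrite uncurry_scube uncurryK.
Qed.

(** For an uncurried chain, the endpoint terms of the first boundary have as boundary the endpoint
    terms of the second one, with the opposite sign; the rest is the induction hypothesis. *)
Lemma bd_bd E k (c : chains R E k) : bd (bd c) = 0.
Proof.
elim: k E c => [|k IHk] E c; first by rewrite raddf0.
rewrite -(curry_chainK c); case: k IHk c => [//|k] IHk c.
rewrite bd_uncurryS !raddfB /= /eval_chain -!push_bd.
set d := curry_chain c; case: k IHk c @d => [|k] IHk c d.
  rewrite bd_uncurry0 /eval_chain; apply/eqP; rewrite subr_eq0; exact/eqP.
by rewrite bd_uncurryS IHk raddf0 subr0 subrr.
Qed.

Lemma bd_dim0 E (c : chains R E 0) : bd c = 0.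
Proof. by []. Qed.

(** Degrees such as [(p + q).-1] and [p.-1 + q] agree only propositionally. They differ for [p = 0],
    where the value 0 is the right one since the boundary vanishes. *)
Definition castc E k k' (c : chains R E k) : chains R E k' :=
  match @eqP _ k k' with
  | ReflectT e => ecast k (chains R E k) e c
  | ReflectF _ => 0
  end.

Lemma castc_id E k (c : chains R E k) : castc k c = c.
Proof. by rewrite /castc; case: eqP => // e; rewrite eq_axiomK. Qed.

Lemma castcB E k k' : zmod_morphism (@castc E k k').
Proof.
by move=> c d; rewrite /castc; case: eqP => [e|_]; [case: _ / e | rewrite subr0].
Qed.
HB.instance Definition _ E k k' :=
  GRing.isZmodMorphism.Build _ _ (@castc E k k') (@castcB E k k').

Lemma castc_uncurry E k k' (c : chains R (unitI R -> E) k) :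
  uncurry_chain (castc k' c) = castc k'.+1 (uncurry_chain c).
Proof.
have [e|ne] := eqVneq k k'; first by case: _ / e; rewrite !castc_id.
have nS : k.+1 != k'.+1 by rewrite eqSS.
by rewrite /castc; case: eqP ne => // _ _; case: eqP nS => //; rewrite raddf0.
Qed.

(** A 0-cube is a point [x], and the product with it is the pushforward by [g x]. *)
Lemma cross0 E F G (g : E -> F -> G) q (c : chains R E 0) (d : chains R F q) :
  bd (cross_chain g c d) = cross_chain g c (bd d).
Proof.
pose f1 : {additive chains R E 0 -> chains R G (0 + q).-1} :=
  @bd R G (0 + q) \o @crossl R E F G g 0 q d.
apply: (lift_chains_eq (f := f1) (g := @crossl R E F G g 0 q.-1 (bd d)));
  try exact: raddfB.
move=> s; rewrite /f1 /= -!crosslE.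
have crossE k (e : chains R F k) : cross_chain g (scube s) e =
    push_chain (g (s (fun i : 'I_0 => unitI_bool R true))) e.
  rewrite /cross_chain lift_scube /push_chain; apply: eq_lift_chains => t.
  congr scube; apply: funext => x; rewrite /cross_cube /=; congr (g (s _) (t _)).
    by apply: funext => -[].
  by apply: funext => j; congr x; exact: val_inj.
by rewrite !crossE push_bd.
Qed.

Lemma cross_uncurry E F G (g : E -> F -> G) p q (c : chains R (unitI R -> E) p)
    (d : chains R F q) :
  cross_chain g (uncurry_chain c) d =
  uncurry_chain (cross_chain (fun f e u => g (f u) e) c d).
Proof.
pose g' (f : unitI R -> E) (e : F) : unitI R -> G := fun u => g (f u) e.
pose f1 : {additive chains R (unitI R -> E) p -> chains R G (p + q).+1} :=
  @crossl R E F G g p.+1 q d \o @uncurry_chain E p.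
pose f2 : {additive chains R (unitI R -> E) p -> chains R G (p + q).+1} :=
  @uncurry_chain G (p + q) \o @crossl R _ F _ g' p q d.
apply: (lift_chains_eq (f := f1) (g := f2)); try exact: raddfB.
move=> s; rewrite /f1 /f2 /= uncurry_scube -!crosslE.
pose f3 : {additive chains R F q -> chains R G (p + q).+1} :=
  @uncurry_chain G (p + q) \o @cross_chain R _ F _ g' p q (scube s).
apply: (lift_chains_eq (f := cross_chain g (scube (uncurry_cube s)))
  (g := f3)); try exact: raddfB.
move=> t; rewrite /f3 /= !cross_scube uncurry_scube; congr scube.
apply: funext => x; rewrite /cross_cube /uncurry_cube /g' /=.
congr (g (s _ _) (t _)).
- by apply: funext => j; congr x; exact: val_inj.
- by congr x; exact: val_inj.
- by apply: funext => j; congr x; exact: val_inj.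
Qed.

Lemma eval_cross E F G (g : E -> F -> G) b p q (c : chains R (unitI R -> E) p)
    (d : chains R F q) :
  eval_chain b (cross_chain (fun f e u => g (f u) e) c d) =
  cross_chain g (eval_chain b c) d.
Proof.
pose g' (f : unitI R -> E) (e : F) : unitI R -> G := fun u => g (f u) e.
pose f1 : {additive chains R (unitI R -> E) p -> chains R G (p + q)} :=
  @crossl R E F G g p q d \o @eval_chain E b p.
pose f2 : {additive chains R (unitI R -> E) p -> chains R G (p + q)} :=
  @eval_chain G b (p + q) \o @crossl R _ F _ g' p q d.
apply: (lift_chains_eq (f := f2) (g := f1)); try exact: raddfB.
move=> s; rewrite /f1 /f2 /= /eval_chain push_scube -!crosslE.
pose f3 : {additive chains R F q -> chains R G (p + q)} :=
  @eval_chain G b (p + q) \o @cross_chain R _ F _ g' p q (scube s).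
apply: (lift_chains_eq (f := f3)
  (g := cross_chain g (scube ((fun f => f (unitI_bool R b)) \o s)))); try exact: raddfB.
by move=> t; rewrite /f3 /= /eval_chain !cross_scube push_scube.
Qed.

Lemma bd_uncurry E k (c : chains R (unitI R -> E) k) :
  bd (uncurry_chain c) =
  eval_chain true c - eval_chain false c - castc k (uncurry_chain (bd c)).
Proof.
case: k c => [|k] c; last by rewrite bd_uncurryS castc_id.
by rewrite bd_uncurry0 bd_dim0 (raddf0 (@uncurry_chain E 0)) raddf0 subr0.
Qed.

Lemma crossBl E F G (g : E -> F -> G) p q (c c' : chains R E p) (d : chains R F q) :
  cross_chain g (c - c') d = cross_chain g c d - cross_chain g c' d.
Proof. exact: (cross_morphl g d). Qed.

Lemma uncurry_chainD E k (c c' : chains R (unitI R -> E) k) :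
  uncurry_chain (c + c') = uncurry_chain c + uncurry_chain c'.
Proof. exact: raddfD. Qed.

Lemma castc_castc E k1 k2 k3 (c : chains R E k1) :
  k2 = k3 -> castc k3 (castc k2 c) = castc k3 c.
Proof. by move=> e; case: _ / e; rewrite castc_id. Qed.

Lemma cross_castcl E F G (g : E -> F -> G) p p' q (c : chains R E p)
    (d : chains R F q) :
  cross_chain g (castc p' c) d = castc (p' + q) (cross_chain g c d).
Proof.
have [e|ne] := eqVneq p p'; first by case: _ / e; rewrite !castc_id.
have nD : p + q != p' + q by rewrite eqn_add2r.
rewrite /castc; case: eqP ne => // _ _; case: eqP nD => // _ _.
by rewrite crosslE raddf0.
Qed.

(** Leibniz rule, by induction on [p]: uncurrying the first coordinate of [c] commutes with the
    product, and each coordinate passed contributes one sign. *)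
Lemma bd_cross E F G (g : E -> F -> G) p q (c : chains R E p) (d : chains R F q) :
  bd (cross_chain g c d) =
  castc (p + q).-1 (cross_chain g (bd c) d) +
  castc (p + q).-1 (cross_chain g c (bd d)) *~ (-1) ^+ p.
Proof.
elim: p E G g c => [|p IHp] E G g c.
  rewrite cross0 bd_dim0 [cross_chain g 0 d]crosslE (raddf0 (crossl g d)) raddf0 add0r expr0 mulr1z.
  by rewrite castc_id.
rewrite -(curry_chainK c) cross_uncurry; move: (curry_chain c) => e.
rewrite [in RHS]bd_uncurry bd_uncurry !eval_cross IHp !crossBl exprS mulN1r mulrNz.
rewrite uncurry_chainD (raddfMz (@uncurry_chain G _)) /= !castc_uncurry -!cross_uncurry.
rewrite !raddfB raddfD raddfMz /= opprD !addrA !castc_id.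
clear IHp; congr (_ - _ - _ *~ _); rewrite -?[(fix add _ _ := _) p q]/(p + q)%N.
  (* For [p = 0] the degrees do not match and [castc] gives 0, but then [bd e] is 0 too. *)
  rewrite cross_castcl; case: p e {c} => [|p] e; last exact: castc_castc.
  rewrite bd_dim0 (raddf0 (@uncurry_chain E _)) crosslE (raddf0 (crossl g d)).
  by rewrite !raddf0.
case: q d => [|q] d; last by apply: castc_castc; rewrite -[LHS]/(p + q.+1).-1.+1 addnS.
by rewrite bd_dim0 (raddf0 (cross_chain g (uncurry_chain e))) !raddf0.
Qed.

End Uncurry.

Section PointwiseTopology.

Lemma ptws_continuous (T U : topologicalType) (I : Type) (f : T -> {ptws I -> U}) :
  (forall i, continuous (fun x => f x i)) -> continuous f.
Proof.
move=> cf x; apply/cvg_sup => i A.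
case=> /= _ [[W oW <-]] Wfx /filterS; apply; apply: (cf i x).
exact: open_nbhs_nbhs.
Qed.

Lemma ptws_eval_continuous (U : topologicalType) (I : eqType) (i : I) :
  continuous (fun f : {ptws I -> U} => f i).
Proof. exact: (@proj_continuous I (fun=> U) i). Qed.

End PointwiseTopology.

(** * Chains supported in a subspace *)

Section ChainsIn.
Variable R : realType.
Implicit Types E F G : topologicalType.

Lemma face_map_continuous k (i : 'I_k.+1) b : continuous (@face_map R k i b).
Proof.
apply: ptws_continuous => j; rewrite /face_map; case: (unlift i j) => [j'|].
  exact: ptws_eval_continuous.
exact: cst_continuous.
Qed.

Definition in_space E k (A : set E) (s : cube R k -> E) :=
  degenerate s \/ (continuous s /\ forall x, A (s x)).

Definition chain_on E k (A : set E) : {pred chains R E k} :=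
  fun c => `[< chain_in A c >].

Lemma chain_onP E k (A : set E) (c : chains R E k) :
  reflect (chain_in A c) (c \in chain_on A).
Proof. exact: asboolP. Qed.

Fact chain_on_zmod_closed E k (A : set E) : zmod_closed (@chain_on E k A).
Proof.
split=> [|c d /chain_onP c1 /chain_onP d1]; apply/chain_onP.
  exact: chain_in0.
exact: chain_inB.
Qed.
HB.instance Definition _ E k A :=
  GRing.isZmodClosed.Build (chains R E k) (@chain_on E k A)
    (@chain_on_zmod_closed E k A).

Lemma scube_on E k (A : set E) (s : cube R k -> E) :
  in_space A s -> scube s \in chain_on A.
Proof. by move=> sA; apply/chain_onP => t; rewrite domU1 inE => /eqP ->. Qed.

Lemma chain_on_ind E k (A : set E) (V : zmodType) (S : zmodClosed V)
    (f : {additive chains R E k -> V}) (c : chains R E k) :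
  (forall s, in_space A s -> f (scube s) \in S) -> c \in chain_on A -> f c \in S.
Proof.
move=> fS /chain_onP cA; rewrite (chain_sumE c) raddf_sum big_seq rpred_sum// => s sc.
by rewrite raddfMz rpredMz// fS//; exact: cA.
Qed.

Lemma chain_on_sub E k (A B : set E) (c : chains R E k) :
  A `<=` B -> c \in chain_on A -> c \in chain_on B.
Proof.
move=> AB /chain_onP cA; apply/chain_onP => s /cA [?|[? sA]]; [by left|right].
by split=> // x; exact: AB.
Qed.

Lemma degenerate_face E k (s : cube R k.+1 -> E) (i j : 'I_k.+1) b :
  (forall x y : cube R k.+1, (forall j, j != i -> x j = y j) -> s x = s y) ->
  j != i -> degenerate (s \o face_map j b).
Proof.
move=> si ji; have [i' e|e] := unliftP j i; last by rewrite e eqxx in ji.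
exists i' => x y xy /=; apply: si => m mi; rewrite /face_map.
case: unliftP => [m' em|//]; apply: xy; apply: contra_neq mi => mi'.
by rewrite em e mi'.
Qed.

(** For a degenerate cube, the two faces in the degenerate direction are equal and cancel; the
    remaining faces are still degenerate. *)
Lemma bd_on E k (A : set E) (c : chains R E k) :
  c \in chain_on A -> bd c \in chain_on A.
Proof.
case: k c => [|k] c cA; first by rewrite bd_dim0 rpred0.
apply: (chain_on_ind (f := @bd R E k.+1)) cA => s sA.
rewrite /= bd_scube /bd_cube rpred_sum// => j _; rewrite rpredMz//.
case: sA => [[i si]|[cs sA]]; last first.
  rewrite rpredB// scube_on//; right; split=> [|x]; try exact: sA;
  by move=> x; apply: continuous_comp; [exact: face_map_continuous | exact: cs].
have [->|ji] := eqVneq j i; last first.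
  by rewrite rpredB// scube_on//; left; exact: degenerate_face ji.
suff -> : s \o face_map i true = s \o face_map i false by rewrite subrr rpred0.
apply: funext => x /=; apply: si => m mi; rewrite /face_map.
by case: unliftP => // e; rewrite e eqxx in mi.
Qed.

Lemma push_on E F k (A : set E) (B : set F) (f : E -> F) (c : chains R E k) :
  {within A, continuous f} -> (forall x, A x -> B (f x)) ->
  c \in chain_on A -> push_chain f c \in chain_on B.
Proof.
move=> cf AB; apply: (chain_on_ind (f := @push_chain R E F f k)) => s sA.
rewrite /= push_scube scube_on//; case: sA => [[i si]|[cs sA]].
  by left; exists i => x y xy /=; rewrite (si x y).
right; split=> [|x]; last exact/AB/sA.
move=> x P nP; have /subspace_continuousP/(_ _ (sA x))/(_ P nP) cP := cf.
apply: (filterS (P := s @^-1` [set y | A y -> P (f y)])); last exact: (cs x _ cP).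
by move=> y; apply; exact: sA.
Qed.

Lemma cross_on E F G (A : set E) (B : set F) (C : set G) (g : E -> F -> G) p q
    (c : chains R E p) (d : chains R F q) :
  continuous (fun x : E * F => g x.1 x.2) ->
  (forall x y, A x -> B y -> C (g x y)) ->
  c \in chain_on A -> d \in chain_on B -> cross_chain g c d \in chain_on C.
Proof.
move=> cg ABC cA dB; rewrite crosslE.
apply: (chain_on_ind (f := @crossl R E F G g p q d)) cA => s sA; rewrite /= -crosslE.
apply: (chain_on_ind (f := @cross_chain R E F G g p q (scube s))) dB => t tB.
rewrite /= cross_scube scube_on//.
case: sA => [[i si]|[cs sA]].
  left; exists (lshift q i) => x y xy; rewrite /cross_cube.
  rewrite (si (fun i => x (lshift q i)) (fun i => y (lshift q i))); last first.
    by move=> j ji; apply: xy; rewrite (inj_eq (@lshift_inj p q)).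
  by congr (g _ (t _)); apply: funext => j; apply: xy; rewrite eq_rlshift.
case: tB => [[i ti]|[ct tB]].
  left; exists (rshift p i) => x y xy; rewrite /cross_cube.
  rewrite (ti (fun i => x (rshift p i)) (fun i => y (rshift p i))); last first.
    by move=> j ji; apply: xy; rewrite (inj_eq (@rshift_inj p q)).
  by congr (g (s _) _); apply: funext => j; apply: xy; rewrite eq_lrshift.
right; split=> [|x]; last by apply: ABC; [exact: sA | exact: tB].
pose h (x : cube R (p + q)) : E * F :=
  (s (fun i => x (lshift q i)), t (fun j => x (rshift p j))).
suff ch : continuous h.
  by move=> x; exact: (@continuous_comp _ _ _ h (fun x => g x.1 x.2) x (ch x) (cg _)).
have cl : continuous (fun x : cube R (p + q) => (fun i => x (lshift q i)) : cube R p).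
  by apply: ptws_continuous => i; exact: ptws_eval_continuous.
have cr : continuous (fun x : cube R (p + q) => (fun i => x (rshift p i)) : cube R q).
  by apply: ptws_continuous => i; exact: ptws_eval_continuous.
move=> x; apply: cvg_pair; first exact: nbhs_filter.
- exact: (@continuous_comp _ _ _ _ s x (cl x) (cs _)).
- exact: (@continuous_comp _ _ _ _ t x (cr x) (ct _)).
Qed.

Lemma castc_on E k k' (A : set E) (c : chains R E k) :
  c \in chain_on A -> castc k' c \in chain_on A.
Proof. by rewrite /castc; case: eqP => [e|_ _]; [case: _ / e | exact: rpred0]. Qed.

End ChainsIn.

(** * Relative and cellular classes *)

Section RelativeHomologyTheory.
Variables (R : realType) (E : topologicalType) (k : nat).
Implicit Types (A B : set E) (c d : chains R E k).

Lemma bd_bdS (w : chains R E k.+1) : bd (bd w : chains R E k) = 0.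
Proof. exact: (bd_bd w). Qed.

Lemma rel_cycleP A B c :
  reflect (c \in chain_on A /\ bd c \in chain_on B) (c \in rel_cycle A B).
Proof.
apply: (iffP (asboolP _)) => -[h1 h2]; split; first exact/chain_onP.
- exact/chain_onP.
- exact/chain_onP.
- exact/chain_onP.
Qed.

Lemma hrep_cycle A B (x : relH R k A B) : hrep x \in rel_cycle A B.
Proof. exact: valP. Qed.

Lemma hrepK A B (x : relH R k A B) : hclass A B (hrep x) = x.
Proof. by rewrite /hclass /hrep valKd; exact: reprK. Qed.

Lemma hclassB A B c d : c \in rel_cycle A B -> d \in rel_cycle A B ->
  hclass A B (c - d) = hclass A B c - hclass A B d.
Proof.
move=> cZ dZ; rewrite /hclass.
have -> : insubd (0 : cycles R k A B) (c - d) =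
    insubd (0 : cycles R k A B) c - insubd (0 : cycles R k A B) d.
  by apply: val_inj; rewrite raddfB /= !insubdK ?rpredB.
exact: raddfB.
Qed.

Lemma hclass_eqP A B c d : c \in rel_cycle A B -> d \in rel_cycle A B ->
  (hclass A B c = hclass A B d) <->
  (exists2 w : chains R E k.+1, w \in chain_on A & c - d - bd w \in chain_on B).
Proof.
move=> cZ dZ; rewrite /hclass.
have e : (\pi_(Quotient.quot (@rel_boundary R E k A B)) (insubd (0 : cycles R k A B) c) ==
     \pi_(Quotient.quot (@rel_boundary R E k A B)) (insubd (0 : cycles R k A B) d))%qT =
   `[< exists2 w : chains R E k.+1, chain_in A w & chain_in B (c - d - bd w) >].
  rewrite -Quotient.idealrBE /in_mem /= /rel_boundary.
  by rewrite raddfB /= !insubdK.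
split=> [/eqP|[w /chain_onP w1 /chain_onP w2]].
  rewrite e => /asboolP[w w1 w2]; exists w; exact/chain_onP.
by apply/eqP; rewrite e; apply/asboolP; exists w.
Qed.

(** It suffices that [c] is a cycle: [d] differs from it by a boundary and a chain of [B], hence is
    a cycle as well. *)
Lemma hclass_eq A B c d (w : chains R E k.+1) : B `<=` A ->
  c \in rel_cycle A B -> w \in chain_on A -> c - d - bd w \in chain_on B ->
  hclass A B c = hclass A B d.
Proof.
move=> BA cZ wA cdw; have /rel_cycleP[cA bcB] := cZ.
apply/hclass_eqP => //; last by exists w.
have -> : d = c - bd w - (c - d - bd w) by rewrite !opprB addrA subrK addrC subrK.
apply/rel_cycleP; split.
  by apply: rpredB; [apply: rpredB => //; exact: (bd_on wA) | exact: chain_on_sub cdw].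
rewrite raddfB raddfB /= bd_bdS subr0.
apply: rpredB => //; exact: bd_on.
Qed.

Lemma hclass0 A B : hclass A B (0 : chains R E k) = 0.
Proof. by rewrite -[X in hclass _ _ X](subrr 0) hclassB ?rpred0// subrr. Qed.

Lemma hclassN A B c : c \in rel_cycle A B -> hclass A B (- c) = - hclass A B c.
Proof. by move=> cZ; rewrite -sub0r hclassB ?rpred0// hclass0 sub0r. Qed.

Lemma hclassD A B c d : c \in rel_cycle A B -> d \in rel_cycle A B ->
  hclass A B (c + d) = hclass A B c + hclass A B d.
Proof. by move=> cZ dZ; rewrite -[d in LHS]opprK hclassB ?rpredN// hclassN// opprK. Qed.

Lemma hclassMz A B c (z : int) : c \in rel_cycle A B ->
  hclass A B (c *~ z) = hclass A B c *~ z.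
Proof.
move=> cZ; have hn n : hclass A B (c *+ n) = hclass A B c *+ n.
  elim: n => [|n IHn]; first by rewrite !mulr0n hclass0.
  by rewrite !mulrS hclassD ?rpredMn// IHn.
case: z => n; first by rewrite -!pmulrn hn.
by rewrite NegzE !mulrNz -!pmulrn hclassN ?hn// rpredMn.
Qed.

Lemma hclass_sum A B (I : Type) (r : seq I) (P : pred I) (F : I -> chains R E k) :
  (forall i, P i -> F i \in rel_cycle A B) ->
  hclass A B (\sum_(i <- r | P i) F i) = \sum_(i <- r | P i) hclass A B (F i).
Proof.
move=> FZ; suff : (\sum_(i <- r | P i) F i \in rel_cycle A B) /\
    hclass A B (\sum_(i <- r | P i) F i) = \sum_(i <- r | P i) hclass A B (F i).
  by case.
elim/big_rec2: _ => [|i x y Pi [yZ <-]]; first by rewrite rpred0 hclass0.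
by rewrite hclassD// ?rpredD//; exact: FZ.
Qed.

End RelativeHomologyTheory.

(** [hmap] uses a chosen representative; it differs from [c] by a boundary and a chain of [B], both
    of which are preserved by [push_chain]. *)
Lemma hmap_hclass (R : realType) (E F : topologicalType) k (f : E -> F) (A B : set E) (A' B' : set F) (c : chains R E k) :
  {within A, continuous f} -> (forall x, A x -> A' (f x)) ->
  B `<=` A -> (forall x, B x -> B' (f x)) -> c \in rel_cycle A B ->
  hmap f A' B' (hclass A B c) = hclass A' B' (push_chain f c).
Proof.
move=> cf AA' BA BB' cZ; set x := hclass A B c.
have cfB : {within B, continuous f} by exact: continuous_subspaceW BA cf.
have xZ := hrep_cycle x.
have pushZ e : e \in rel_cycle A B -> push_chain f e \in rel_cycle A' B'.
  move=> /rel_cycleP[eA eB]; apply/rel_cycleP; split; first exact: (push_on cf AA').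
  by rewrite -push_bd; exact: (push_on cfB BB').
have /hclass_eqP[//|//|w wA wB] : hclass A B (hrep x) = hclass A B c by rewrite hrepK.
apply/hclass_eqP; [exact: pushZ|exact: pushZ|].
exists (push_chain f w); first exact: (push_on cf AA').
have -> : push_chain f (hrep x) - push_chain f c - bd (push_chain f w) =
    push_chain f (hrep x - c - bd w).
  by rewrite -push_bd raddfB [in RHS]raddfB.
exact: (push_on cfB BB').
Qed.

(** * Boundary, maps and products on cellular classes *)

Section CellOperations.
Variable R : realType.
Implicit Types E F G : topologicalType.

Lemma skel_sub E (X : cells E) k k' : (k <= k')%N -> skel X k `<=` skel X k'.
Proof. by move=> kk' x [c ck cx]; exists c => //; exact: leq_trans kk'. Qed.

Lemma skel0 E (X : cells E) x : ~ skel X 0 x.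
Proof. by case. Qed.

Definition cell_cycle E (X : cells E) k : {pred chains R E k} :=
  rel_cycle (skel X k.+1) (skel X k).
Arguments cell_cycle E X k : clear implicits.

Definition cell_class E (X : cells E) k (c : chains R E k) : cell_chains R X k :=
  hclass (skel X k.+1) (skel X k) c.

Lemma cell_class_rep E (X : cells E) k (x : cell_chains R X k) :
  exists2 c, c \in cell_cycle E X k & x = cell_class X c.
Proof. by exists (hrep x); [exact: hrep_cycle | rewrite /cell_class hrepK]. Qed.

Lemma cell_class_eq E (X : cells E) k (c d : chains R E k) (w : chains R E k.+1) :
  c \in cell_cycle E X k -> w \in chain_on (skel X k.+1) ->
  c - d - bd w \in chain_on (skel X k) ->
  cell_class X c = cell_class X d.
Proof. exact/hclass_eq/skel_sub. Qed.

Lemma bd_cell_cycle E (X : cells E) k (c : chains R E k) :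
  c \in cell_cycle E X k -> bd c \in cell_cycle E X k.-1.
Proof.
move=> /rel_cycleP[cA cB]; apply/rel_cycleP; rewrite bd_bd rpred0; split=> //.
by apply: chain_on_sub cB; exact: skel_sub (leqSpred _).
Qed.

Lemma cell_bd_class E (X : cells E) k (c : chains R E k) :
  c \in cell_cycle E X k -> cell_bd (cell_class X c) = cell_class X (bd c).
Proof.
move=> cZ; rewrite /cell_bd; set x := cell_class X c.
case: k c cZ @x => [|k] c cZ x; first by rewrite !bd_dim0.
have xZ := hrep_cycle x; have [_ xB] := rel_cycleP _ _ _ xZ.
have /hclass_eqP[//|//|w wA wB] :
  hclass (skel X k.+2) (skel X k.+1) (hrep x) = hclass _ _ c by rewrite hrepK.
(* This discrepancy lies in the lower skeleton, and its boundary is exactly the difference of the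
   two boundaries. *)
pose w' : chains R E k.+1 := hrep x - c - bd w.
apply: (@cell_class_eq _ _ _ _ _ w') => //.
- exact: (bd_cell_cycle xZ).
- by rewrite /w' !bdB bd_bdS subr0 subrr rpred0.
Qed.

Lemma cell_map_class E F (X : cells E) (Y : cells F) (f : E -> F) k (c : chains R E k) :
  {within skel X k.+1, continuous f} ->
  (forall j x, skel X j x -> skel Y j (f x)) ->
  c \in cell_cycle E X k ->
  cell_map Y f (cell_class X c) = cell_class Y (push_chain f c).
Proof.
by move=> cf XY; apply: hmap_hclass => //; [exact: XY | exact: skel_sub | exact: XY].
Qed.

Lemma castc_bd E k k' (c : chains R E k) : k = k' -> bd (castc k' c) = castc k'.-1 (bd c).
Proof. by move=> e; case: _ / e; rewrite !castc_id. Qed.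

Section Cross.
Variables (E F G : topologicalType) (X : cells E) (Y : cells F) (Z : cells G).
Variable (g : E -> F -> G).
Hypothesis cg : continuous (fun x : E * F => g x.1 x.2).
Hypothesis gXY : forall a b x y, skel X a.+1 x -> skel Y b.+1 y ->
  skel Z (a + b).+1 (g x y).

(** The versions [gl] and [gr] serve the two terms of the Leibniz rule; they remain valid in
    dimension 0 because [skel X 0] is empty. *)
Let gl p q x y : skel X p x -> skel Y q.+1 y -> skel Z (p + q) (g x y).
Proof. by case: p => [/skel0//|p]; exact: gXY. Qed.

Let gr p q x y : skel X p.+1 x -> skel Y q y -> skel Z (p + q) (g x y).
Proof. by case: q => [_ /skel0//|q]; rewrite addnS; exact: gXY. Qed.

Lemma cross_cell_cycle p q (c : chains R E p) (d : chains R F q) :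
  c \in cell_cycle E X p -> d \in cell_cycle F Y q ->
  cross_chain g c d \in cell_cycle G Z (p + q).
Proof.
move=> /rel_cycleP[cA cB] /rel_cycleP[dA dB]; apply/rel_cycleP; split.
  exact: (cross_on cg (@gXY p q)).
rewrite bd_cross rpredD// ?rpredMz//; apply: castc_on.
  exact: (cross_on cg (@gl p q)).
exact: (cross_on cg (@gr p q)).
Qed.

Lemma cross_class_eql p q (c c' : chains R E p) (d : chains R F q) :
  c \in cell_cycle E X p -> c' \in cell_cycle E X p -> d \in cell_cycle F Y q ->
  cell_class X c = cell_class X c' ->
  cell_class Z (cross_chain g c d) = cell_class Z (cross_chain g c' d).
Proof.
move=> cZ c'Z dZ /hclass_eqP[//|//|w wA wB].
have [dA dB] := rel_cycleP _ _ _ dZ.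
apply: (@cell_class_eq _ _ _ _ _ (cross_chain g w d)).
- exact: cross_cell_cycle.
- exact: (cross_on cg (@gXY p q) wA dA).
rewrite (bd_cross g w d) castc_id opprD addrA -!crossBl -mulrNz rpredD//.
  exact: (cross_on cg (@gl p q)).
by rewrite rpredMz//; apply/castc_on/(cross_on cg (@gr p q)).
Qed.

Lemma cross_class_eqr p q (c : chains R E p) (d d' : chains R F q) :
  c \in cell_cycle E X p -> d \in cell_cycle F Y q -> d' \in cell_cycle F Y q ->
  cell_class Y d = cell_class Y d' ->
  cell_class Z (cross_chain g c d) = cell_class Z (cross_chain g c d').
Proof.
move=> cZ dZ d'Z /hclass_eqP[//|//|w wA wB].
have [cA cB] := rel_cycleP _ _ _ cZ.
(* The sign compensates the one in front of [bd w] in the Leibniz rule. *)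
pose v := castc (p + q).+1 (cross_chain g c w) *~ (-1) ^+ p.
apply: (@cell_class_eq _ _ _ _ _ v).
- exact: cross_cell_cycle.
- by rewrite rpredMz//; apply/castc_on/(cross_on cg (@gXY p q)).
have -> : bd v = castc (p + q) (cross_chain g (bd c) w) *~ (-1) ^+ p +
    cross_chain g c (bd w).
  rewrite /v (raddfMz (@bd R G (p + q).+1)) /= castc_bd ?addnS// bd_cross.
  rewrite (raddfD (@castc R G _ _)) (raddfMz (@castc R G _ _)) /= !castc_castc ?addnS//.
  by rewrite castc_id mulrzDl -mulrzA -expr2 sqrr_sign mulr1z.
rewrite opprD addrCA -mulrNz -2!raddfB rpredD//.
  by rewrite rpredMz//; apply/castc_on/(cross_on cg (@gl p q)).
exact: (cross_on cg (@gr p q)).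
Qed.

Lemma cell_cross_class p q (c : chains R E p) (d : chains R F q) :
  c \in cell_cycle E X p -> d \in cell_cycle F Y q ->
  cell_cross Z g (cell_class X c) (cell_class Y d) = cell_class Z (cross_chain g c d).
Proof.
move=> cZ dZ; rewrite /cell_cross; set x := cell_class X c; set y := cell_class Y d.
have xZ := hrep_cycle x; have yZ := hrep_cycle y.
rewrite -[LHS]/(cell_class Z _) (@cross_class_eql _ _ _ c) ?hrepK//.
  by rewrite (@cross_class_eqr _ _ _ _ d)// /cell_class hrepK.
by rewrite /cell_class hrepK.
Qed.

End Cross.
End CellOperations.

(** * Ribbon trees *)

Section Trees.
Implicit Types (t s : ribbon) (ts : seq ribbon) (e : edge).

Lemma ribbon_nested_ind (P : ribbon -> Prop) :
  P Leaf -> (forall ts, (forall t, t \in ts -> P t) -> P (Node ts)) ->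
  forall t, P t.
Proof.
move=> P0 PN; fix IH 1 => -[//|ts]; apply: PN.
elim: ts => [s|t ts IHts s]; first by rewrite in_nil => h; discriminate h.
by rewrite inE => /orP[/eqP ->|]; [exact: IH | exact: IHts].
Qed.

Fixpoint forest_edges (o : nat) ts : seq edge :=
  match ts with
  | [::] => [::]
  | t' :: ts' => vertex_edges o t' ++ forest_edges (o + leaves t')%N ts'
  end.

Lemma vertex_edges_node o ts :
  vertex_edges o (Node ts) = (o, leaves (Node ts)) :: forest_edges o ts.
Proof. by rewrite /=; congr cons; elim: ts o => //= t ts IH o; rewrite IH. Qed.
Arguments vertex_edges : simpl never.

Lemma edges_node ts : edges (Node ts) = forest_edges 0 ts.
Proof. by rewrite /edges vertex_edges_node. Qed.

Definition forest_leaves ts := sumn (map leaves ts).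

Lemma leaves_node ts : leaves (Node ts) = forest_leaves ts.
Proof. by []. Qed.

Lemma forest_leaves1 t : forest_leaves [:: t] = leaves t.
Proof. exact: addn0. Qed.

Lemma forest_edges1 o t : forest_edges o [:: t] = vertex_edges o t.
Proof. exact: cats0. Qed.

Lemma forest_edges_cat o ts1 ts2 :
  forest_edges o (ts1 ++ ts2) =
  forest_edges o ts1 ++ forest_edges (o + forest_leaves ts1) ts2.
Proof.
elim: ts1 o => [|t ts IH] o /=; first by rewrite addn0.
by rewrite IH catA /forest_leaves /= addnA.
Qed.

Definition shift_edge (d : nat) e : edge := (e.1 + d, e.2)%N.

Lemma vertex_edges_shift d o t :
  vertex_edges (o + d) t = map (shift_edge d) (vertex_edges o t).
Proof.
elim/ribbon_nested_ind: t o => [//|ts IH] o.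
rewrite !vertex_edges_node /= /shift_edge /=; congr cons.
elim: ts o IH => [//|t ts IHts] o IH /=; rewrite map_cat IH ?mem_head//.
congr (_ ++ _); rewrite -IHts ?(addnAC o d)// => s sts o'.
by rewrite IH// inE sts orbT.
Qed.

Lemma leaves_gt0 t : stable t -> (0 < leaves t)%N.
Proof.
elim/ribbon_nested_ind: t => [//|[//|t ts] IH /= /andP[_ /andP[st _]]].
by rewrite ltn_addr// IH// mem_head.
Qed.

Lemma forest_leaves_ge ts : all stable ts -> (size ts <= forest_leaves ts)%N.
Proof.
elim: ts => [//|t ts IH] /= /andP[/leaves_gt0 st /IH].
by rewrite /forest_leaves /=; lia.
Qed.

Lemma vertex_edges_in o t e : stable t -> e \in vertex_edges o t ->
  [/\ (o <= e.1)%N, (e.1 + e.2 <= o + leaves t)%N & (2 <= e.2)%N].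
Proof.
elim/ribbon_nested_ind: t o e => [//|ts IH] o e /[dup] st.
rewrite vertex_edges_node inE /= => /andP[sz sts] /orP[/eqP -> /=|].
  by split=> //; apply: leq_trans sz (forest_leaves_ge sts).
elim: ts o sts IH {st sz} => [//|t ts IHts] o /= /andP[st sts] IH.
rewrite mem_cat => /orP[/IH|/IHts]; rewrite ?mem_head// /forest_leaves /=.
  by move=> /(_ isT st)[? ? ?]; split=> //; lia.
case=> // [s sts' |? ? ?]; [by move=> o' e'; apply: IH; rewrite inE sts' orbT|].
by split; lia.
Qed.

Lemma forest_edges_in o ts e : all stable ts -> e \in forest_edges o ts ->
  [/\ (o <= e.1)%N, (e.1 + e.2 <= o + forest_leaves ts)%N & (2 <= e.2)%N].
Proof.
elim: ts o => [//|t ts IHts] o /= /andP[st sts].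
rewrite mem_cat => /orP[/(vertex_edges_in st)|/(IHts _ sts)]; rewrite /forest_leaves /= => -[? ? ?];
by split=> //; lia.
Qed.

(** Each of the at least two trees has a leaf, so no vertex of one of them lies below all leaves:
    internal edges differ from the root edge. *)
Lemma forest_edges_small o ts e : (1 < size ts)%N -> all stable ts ->
  e \in forest_edges o ts -> (e.2 < forest_leaves ts)%N.
Proof.
case: ts => [//|t [//|t' ts]] _ /= /and3P[st st' sts].
have := leaves_gt0 st; have := leaves_gt0 st'; rewrite /forest_leaves /= => p1 p2.
rewrite mem_cat => /orP[/(vertex_edges_in st)[] |]; first by lia.
move=> /(@forest_edges_in (o + leaves t) (t' :: ts)) /=; rewrite st' sts /forest_leaves /=.
by move=> /(_ isT)[]; lia.
Qed.

Lemma edges_in t e : stable t -> e \in edges t ->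
  [/\ (e.1 + e.2 <= leaves t)%N, (2 <= e.2)%N & (e.2 < leaves t)%N].
Proof.
case: t => [//|ts] /= /andP[sz sts]; rewrite edges_node => ets.
have [_ h1 h2] := forest_edges_in sts ets; split=> //.
exact: forest_edges_small ets.
Qed.

Lemma vertex_edges_uniq o t : stable t -> uniq (vertex_edges o t).
Proof.
elim/ribbon_nested_ind: t o => [//|ts IH] o /andP[sz sts].
rewrite vertex_edges_node cons_uniq; apply/andP; split.
  apply/negP => /(forest_edges_small sz sts) /=.
  by rewrite ltnn.
elim: ts o sts IH {sz} => [//|t ts IHts] o /= /andP[st sts] IH.
rewrite cat_uniq IH ?mem_head//= IHts// ?andbT; last first.
  by move=> s ss; apply: IH; rewrite inE ss orbT.
apply/hasPn => e /(forest_edges_in sts)[h1 h2 h3].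
by apply/negP => /(vertex_edges_in st)[]; lia.
Qed.

Lemma edges_uniq t : stable t -> uniq (edges t).
Proof.
move=> st; rewrite /edges; have := vertex_edges_uniq 0 st.
by case: (vertex_edges 0 t) => //= e s /andP[].
Qed.

Lemma size_vertex_edges o t : stable t -> (size (vertex_edges o t) < leaves t)%N.
Proof.
elim/ribbon_nested_ind: t o => [//|ts IH] o /andP[sz sts].
rewrite vertex_edges_node /=.
suff : (size (forest_edges o ts) + size ts <= forest_leaves ts)%N.
  by rewrite /forest_leaves; lia.
elim: ts o sts IH {sz} => [//|t ts IHts] o /= /andP[st sts] IH.
have h1 := IH t (mem_head _ _) o st.
have := IHts (o + leaves t)%N sts (fun s ss => IH s (mem_behead (s := t :: ts) ss)).
by rewrite size_cat /forest_leaves /=; lia.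
Qed.

Lemma size_edges t : stable t -> (size (edges t) <= leaves t - 2)%N.
Proof. by move=> /(size_vertex_edges 0); rewrite /edges size_behead; lia. Qed.

Lemma edges_leaf t : stable t -> leaves t = 1%N -> t = Leaf.
Proof.
case: t => [//|ts] /= /andP[sz /forest_leaves_ge]; rewrite /forest_leaves; lia.
Qed.

(* Removal of the vertices whose bottom edge does not satisfy [P]. *)
Fixpoint splice (P : pred edge) (o : nat) t : seq ribbon :=
  match t with
  | Leaf => [:: Leaf]
  | Node ts =>
      let fs := (fix go (o : nat) ts : seq ribbon :=
        match ts with
        | [::] => [::]
        | t' :: ts' => splice P o t' ++ go (o + leaves t')%N ts'
        end) o ts in
      if P (o, leaves t) then [:: Node fs] else fs
  end.

Fixpoint splices (P : pred edge) (o : nat) ts : seq ribbon :=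
  match ts with
  | [::] => [::]
  | t' :: ts' => splice P o t' ++ splices P (o + leaves t')%N ts'
  end.

Lemma splice_node P o ts :
  splice P o (Node ts) =
  if P (o, leaves (Node ts)) then [:: Node (splices P o ts)] else splices P o ts.
Proof.
suff e : (fix go (o : nat) ts : seq ribbon :=
        match ts with
        | [::] => [::]
        | t' :: ts' => splice P o t' ++ go (o + leaves t')%N ts'
        end) o ts = splices P o ts by rewrite /= e.
by elim: ts o => //= t ts IH o; rewrite IH.
Qed.

Lemma forest_leaves_cat ts1 ts2 :
  forest_leaves (ts1 ++ ts2) = (forest_leaves ts1 + forest_leaves ts2)%N.
Proof. by rewrite /forest_leaves map_cat sumn_cat. Qed.

(** The inequality of sizes says that removing vertices never lowers the number of inputs of those
    below, which keeps the tree stable. *)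
Definition splice_spec (P : pred edge) (o : nat) ts' ts :=
  [/\ forest_leaves ts' = forest_leaves ts, all stable ts',
      (size ts <= size ts')%N & forest_edges o ts' = [seq e <- forest_edges o ts | P e]].

Lemma splicesP P o ts : all stable ts ->
  (forall t, t \in ts -> forall o, splice_spec P o (splice P o t) [:: t]) ->
  splice_spec P o (splices P o ts) ts.
Proof.
elim: ts o => [//|t ts IH] o /= /andP[st sts] H.
have [h1 h2 h3 h4] := H t (mem_head _ _) o.
have [|g1 g2 g3 g4] := IH (o + leaves t)%N sts.
  by move=> s ss; apply: H; rewrite inE ss orbT.
have e1 : forest_leaves (splice P o t) = leaves t by rewrite h1 /forest_leaves /= addn0.
split=> /=.
- by rewrite forest_leaves_cat e1 g1.
- by rewrite all_cat h2.
- by rewrite size_cat; move: h3 => /=; lia.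
- by rewrite forest_edges_cat h4 e1 g4 /= cats0 filter_cat.
Qed.

Lemma spliceP P o t : stable t -> splice_spec P o (splice P o t) [:: t].
Proof.
elim/ribbon_nested_ind: t o => [//|ts IH] o /andP[sz sts].
have [|h1 h2 h3 h4] := @splicesP P o _ sts.
  by move=> t tts o'; apply: IH => //; exact: (allP sts).
rewrite splice_node; case: ifP => P0; split; rewrite ?forest_leaves1 ?forest_edges1 //.
- by rewrite /= andbT h2 (leq_trans sz h3).
- rewrite !vertex_edges_node !leaves_node h1 h4.
  by move: P0; rewrite leaves_node /= => ->.
- exact: leq_trans (ltnW sz) h3.
- by rewrite vertex_edges_node h4 /= P0.
Qed.

(** The root vertex is always kept: its bottom edge is not internal. *)
Definition collapse (P : pred edge) t :=
  if t is Node ts then Node (splices P 0 ts) else Leaf.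

Lemma collapseP P t : stable t ->
  [/\ stable (collapse P t), leaves (collapse P t) = leaves t &
      edges (collapse P t) = [seq e <- edges t | P e]].
Proof.
case: t => [//|ts] /andP[sz sts].
have [|h1 h2 h3 h4] := @splicesP P 0 _ sts.
  by move=> t tts o'; apply: spliceP; exact: (allP sts).
by rewrite /collapse !edges_node /= h2 (leq_trans sz h3) h4.
Qed.

End Trees.

(** * Grafting of trees and depth-first lists of edges *)

Section TreeGraft.
Implicit Types (t s : ribbon) (ts : seq ribbon) (e : edge).

(* Replaces the leaf of [t] numbered [i] (from 0) with [t']. *)
Fixpoint tgraft t (i : nat) t' : ribbon :=
  match t with
  | Leaf => t'
  | Node ts =>
      Node ((fix go i ts : seq ribbon :=
        match ts with
        | [::] => [::]
        | s :: ss => if (i < leaves s)%N then tgraft s i t' :: ss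
                     else s :: go (i - leaves s)%N ss
        end) i ts)
  end.

Fixpoint fgraft ts (i : nat) t' : seq ribbon :=
  match ts with
  | [::] => [::]
  | s :: ss => if (i < leaves s)%N then tgraft s i t' :: ss
               else s :: fgraft ss (i - leaves s)%N t'
  end.

Lemma tgraft_node ts i t' : tgraft (Node ts) i t' = Node (fgraft ts i t').
Proof. by rewrite /=; congr Node; elim: ts i => //= s ss IH i; rewrite IH. Qed.

Lemma size_fgraft ts i t' : size (fgraft ts i t') = size ts.
Proof. by elim: ts i => //= s ss IH i; case: ifP => //= _; rewrite IH. Qed.

Lemma leaves_tgraft t i t' : (i < leaves t)%N ->
  (leaves (tgraft t i t')).+1 = (leaves t + leaves t')%N.
Proof.
elim/ribbon_nested_ind: t i => [|ts IH] i //.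
rewrite tgraft_node !leaves_node.
elim: ts i IH => [//|s ss IHss] i IH; rewrite /forest_leaves /= => ilt.
case: ifP => is_ /=.
  by have := IH s (mem_head _ _) i is_; lia.
have := IHss (i - leaves s)%N (fun t h => IH t (mem_behead (s := s :: ss) h)).
by rewrite /forest_leaves => /(_ ltac:(lia)); lia.
Qed.

Lemma stable_tgraft t i t' : stable t -> stable t' -> stable (tgraft t i t').
Proof.
move=> st st'; elim/ribbon_nested_ind: t i st => [//|ts IH] i /andP[sz sts].
rewrite tgraft_node /= size_fgraft sz /=.
elim: ts i sts IH {sz} => [//|s ss IHss] i /= /andP[sts ssts] IH.
case: ifP => _ /=; first by rewrite IH ?mem_head.
apply/andP; split=> //; apply: IHss => // t tss.
by apply: IH; rewrite inE tss orbT.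
Qed.

(* The edge of [t] turned into an edge of the tree obtained by grafting a tree
   with [h] leaves at the leaf [j]. *)
Definition outer (j h : nat) e : edge :=
  if (e.1 + e.2 <= j)%N then e
  else if (e.1 <= j)%N then (e.1, e.2 + h - 1)%N
  else (e.1 + h - 1, e.2)%N.

(** An edge whose first leaf is at most [j] either lies below the leaf [j] or ends before it, so
    depth-first search meets it before the grafted tree; all others come after. *)
Definition graft_edges (j h : nat) (s s' : seq edge) : seq edge :=
  map (outer j h) [seq e <- s | (e.1 <= j)%N] ++ s' ++
  map (outer j h) [seq e <- s | (j < e.1)%N].

Lemma vertex_edges_tgraft o t i t' : stable t -> stable t' -> (i < leaves t)%N ->
  vertex_edges o (tgraft t i t') =
  graft_edges (o + i) (leaves t') (vertex_edges o t) (vertex_edges (o + i) t').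
Proof.
move=> st st'; have lt' := leaves_gt0 st'.
elim/ribbon_nested_ind: t o i st => [|ts IH] o i.
  by rewrite ltnS leqn0 => _ /eqP->; rewrite addn0 /graft_edges /= cats0.
move=> /andP[sz sts] ilt; rewrite tgraft_node !vertex_edges_node.
rewrite {1}/graft_edges /= leq_addr ltnNge leq_addr /=.
have lf : (forest_leaves (fgraft ts i t')).+1 = (forest_leaves ts + leaves t')%N.
  by have := @leaves_tgraft (Node ts) i t' ilt; rewrite tgraft_node.
congr cons.
  rewrite /outer /= -!/(forest_leaves _) leq_add2l leqNgt ilt /= leq_addr.
  by congr pair; lia.
rewrite -/(graft_edges _ _ _ _).
move: ilt; rewrite -/(forest_leaves _) => {lf}.
elim: ts o i sts IH {sz} => [//|s ss IHss] o i /= /andP[sts ssts] IH.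
rewrite /forest_leaves /= => ilt.
case: ifP => ils /=.
  rewrite IH ?mem_head// /graft_edges !filter_cat !map_cat -!catA; congr (_ ++ _).
  have a1 e : e \in forest_edges (o + leaves s) ss -> (o + i < e.1)%N.
    by move=> /(forest_edges_in ssts)[]; lia.
  have -> : [seq e <- forest_edges (o + leaves s) ss | (e.1 <= o + i)%N] = [::].
    by apply/eqP; rewrite -[_ == _]negbK -has_filter; apply/hasPn => e /a1; lia.
  rewrite cat0s; do 2 congr (_ ++ _).
  have -> : [seq e <- forest_edges (o + leaves s) ss | (o + i < e.1)%N] =
            forest_edges (o + leaves s) ss by apply/all_filterP/allP.
  have -> : (o + leaves (tgraft s i t') = o + leaves s + (leaves t' - 1))%N.
    by have := leaves_tgraft t' ils; lia.
  have -> : forest_edges (o + leaves s + (leaves t' - 1))%N ss =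
            map (shift_edge (leaves t' - 1)%N) (forest_edges (o + leaves s) ss).
    elim: ss (o + leaves s)%N {IHss ssts ilt IH a1} => [//|u us IHus] p /=.
    by rewrite map_cat vertex_edges_shift -IHus addnAC.
  apply/eq_in_map => e /[dup] /a1 e1 /(forest_edges_in ssts)[_ _ e2].
  rewrite /outer /shift_edge ifF; last lia; rewrite ifF; last lia.
  by congr pair; lia.
have b1 e : e \in vertex_edges o s -> (e.1 <= o + i)%N && (e.1 + e.2 <= o + i)%N.
  by move=> /(vertex_edges_in sts)[]; lia.
rewrite IHss//; last first.
- by rewrite leaves_node /forest_leaves; lia.
- by move=> t tss; apply: IH; rewrite inE tss orbT.
have -> : (o + leaves s + (i - leaves s) = o + i)%N by lia.
rewrite /graft_edges !filter_cat !map_cat -!catA.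
have -> : [seq e <- vertex_edges o s | (e.1 <= o + i)%N] = vertex_edges o s.
  by apply/all_filterP/allP => e /b1 /andP[].
have -> : [seq e <- vertex_edges o s | (o + i < e.1)%N] = [::].
  by apply/eqP; rewrite -[_ == _]negbK -has_filter; apply/hasPn => e /b1; lia.
congr (_ ++ _); rewrite -[LHS]map_id; apply/eq_in_map => e /b1 /andP[_ e2].
by rewrite /outer e2.
Qed.

Lemma edges_tgraft t i t' : stable t -> stable t' -> (1 < leaves t)%N ->
  (1 < leaves t')%N -> (i < leaves t)%N ->
  edges (tgraft t i t') =
  graft_edges i (leaves t') (edges t) ((i, leaves t') :: map (shift_edge i) (edges t')).
Proof.
case: t => [//|ts]; case: t' => [//|ts'] st st' l1 l1' ilt.
have := vertex_edges_tgraft 0 st st' ilt.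
rewrite tgraft_node !vertex_edges_node add0n.
rewrite -[X in (i, leaves _) :: forest_edges X _](add0n i) -[forest_edges 0 (fgraft _ _ _)]edges_node.
have -> : (i, leaves (Node ts')) :: forest_edges (0 + i) ts' =
   (i, leaves (Node ts')) :: map (shift_edge i) (edges (Node ts')).
  congr cons; have := vertex_edges_shift i 0 (Node ts').
  by rewrite !vertex_edges_node /= => -[->]; rewrite edges_node.
by rewrite /graft_edges /= => -[_ ->]; rewrite edges_node.
Qed.

Lemma perm_graft_edges j h (u u' : seq edge) :
  perm_eq (graft_edges j h u u') (map (outer j h) u ++ u').
Proof.
rewrite /graft_edges perm_sym; apply: perm_trans (_ : perm_eq _
  (map (outer j h) ([seq e <- u | (e.1 <= j)%N] ++ [seq e <- u | (j < e.1)%N]) ++ u')) _.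
  rewrite perm_cat2r perm_map// perm_sym.
  have -> : [seq e <- u | (j < e.1)%N] = [seq e <- u | predC (fun e : edge => e.1 <= j)%N e].
    by apply: eq_filter => e /=; rewrite ltnNge.
  by rewrite perm_filterC.
by rewrite map_cat -!catA perm_cat2l perm_catC.
Qed.

End TreeGraft.

(** * Skeleta of the two cell decompositions *)

Section Skeleta.
Variable R : realType.
Implicit Types (l : lengths R) (t : ribbon) (e : edge).
Local Open Scope ereal_scope.

(** Edges of length 0 are allowed, so [t] is not unique. All edges of nonzero length belong to every
    such [t], so counting them does not depend on the choice. *)
Definition tree_point n l t :=
  [/\ stable t, leaves t = n, forall e, 0 <= l e & forall e, e \notin edges t -> l e = 0].

Definition infinite l : pred edge := fun e => l e == +oo.
Definition finite_pos l : pred edge := fun e => (l e != 0) && (l e != +oo).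

Lemma Tbar_tree n l : Tbar n l <-> exists t, tree_point n l t.
Proof.
by split=> [[t [st lt] [l0 lt0]]|[t [st lt l0 lt0]]]; exists t.
Qed.

Lemma tree_point_collapse n l t : tree_point n l t ->
  exists2 t', tree_point n l t' & edges t' = [seq e <- edges t | l e != 0].
Proof.
move=> [st lt l0 lt0]; have [h1 h2 h3] := collapseP (fun e => l e != 0) st.
exists (collapse (fun e => l e != 0) t) => //; split; rewrite ?h2// h3 => e.
rewrite mem_filter negb_and negbK => /orP[/eqP//|]; exact: lt0.
Qed.

(** The dimension of the cell containing [l] is its number of finite nonzero lengths. To recover the
    index of that cell, collapse the edges of length 0 and break those of infinite length. *)
Lemma skel_OmegaP n k l : skel (@OmegaBAs_cells R n) k l <->
  exists2 t, tree_point n l t & (count (finite_pos l) (edges t) < k)%N.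
Proof.
split=> [[[[t b] /= [[st lt] sb]] /= dk H]|[t lt ck]].
  have ub := edges_uniq st.
  have lE e : e \in b -> l e = +oo by case: (H e) => + _ _; exact.
  exists t.
    split=> // e; last by move=> ne; case: (H e) => _ _; exact.
    have [eb|nb] := boolP (e \in b); first by rewrite lE// leey.
    have [et|nt] := boolP (e \in edges t); last by case: (H e) => _ _ ->.
    by case: (H e) => _ /(_ et nb) /andP[/ltW].
  apply: leq_ltn_trans dk; rewrite -(count_predC (mem b) (edges t)).
  have -> : count (mem b) (edges t) = size b.
    by rewrite -size_filter -(subseq_uniqP ub sb).
  rewrite addKn; apply: sub_count => e; rewrite /finite_pos /= => /andP[_].
  by apply: contraNN => /lE ->.
have [t' [st' lt' l0 l't] et'] := tree_point_collapse lt.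
unshelve eexists.
  exists (t', [seq e <- edges t' | infinite l e]); split=> //=.
  exact: filter_subseq.
  rewrite /=; apply: leq_ltn_trans ck.
  rewrite size_filter -(count_predC (infinite l)) addKn et' count_filter.
  by apply: sub_count => e; rewrite /= /finite_pos /infinite andbC.
move=> e; rewrite /= mem_filter /infinite; split.
- by move=> /andP[/eqP].
- move=> et; rewrite et andbT => li; rewrite lt_neqAle l0 andbT lt_neqAle li leey !andbT.
  by move: et; rewrite et' mem_filter eq_sym => /andP[].
- exact: l't.
Qed.

(** Here the index of the cell is recovered by collapsing all edges of finite length. *)
Lemma skel_AinfP n k l : skel (@Ainf_cells R n) k l <->
  exists2 t, tree_point n l t & (n - 2 - count (infinite l) (edges t) < k)%N.
Proof.
split=> [[[s [ss sl]] /= dk [/Tbar_tree[t lt] H]]|[t lt ck]].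
  exists t => //; apply: leq_ltn_trans dk; rewrite leq_sub2l//.
  rewrite -size_filter; apply: uniq_leq_size; first exact: edges_uniq.
  move=> e /H li; rewrite mem_filter /infinite li eqxx /=.
  by case: lt => _ _ _ lt0; apply/negPn/negP => /lt0; rewrite li.
have [st ltn l0 lt0] := lt.
have [h1 h2 h3] := collapseP (infinite l) st.
unshelve eexists.
  by exists (collapse (infinite l) t); split=> //; rewrite h2.
  by rewrite /= h3 size_filter.
split=> /=; first by apply/Tbar_tree; exists t.
move=> e; rewrite h3 mem_filter /infinite; split=> [li|/andP[/eqP]//].
by rewrite li eqxx /=; apply/negPn/negP => /lt0; rewrite li.
Qed.

Lemma count_finite_infinite n l t : tree_point n l t ->
  (count (finite_pos l) (edges t) + count (infinite l) (edges t) <= n - 2)%N.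
Proof.
move=> [st <- _ _]; apply: leq_trans (size_edges st).
rewrite -count_predUI addnC (@eq_count _ _ pred0) ?count_pred0 ?count_size//.
by move=> e; rewrite /= /finite_pos /infinite -andbA andNb andbF.
Qed.

(** A stable tree has at most [n - 2] internal edges, so the finite ones number at most [n - 2]
    minus the infinite ones. *)
Lemma skel_Ainf_Omega n k : skel (@Ainf_cells R n) k `<=` skel (@OmegaBAs_cells R n) k.
Proof.
move=> l /skel_AinfP[t lt ck]; apply/skel_OmegaP; exists t => //.
by have := count_finite_infinite lt; lia.
Qed.

Lemma Ainf_Omega_cellular n : cellular (@Ainf_cells R n) (@OmegaBAs_cells R n) id.
Proof.
split=> [|k x]; last exact: skel_Ainf_Omega.
by apply: continuous_subspaceT => x; exact: cvg_id.
Qed.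

(** Each coordinate of a grafted tree is a constant or a fixed coordinate of one factor, whence
    continuity. *)
Lemma graft_cases k h i e :
  [\/ exists c, forall l l', graft k h i l l' e = c,
      exists e', forall l l', graft k h i l l' e = l e' |
      exists e', forall l l', graft k h i l l' e = l' e'].
Proof.
case: e => a b; rewrite /graft.
case: eqP => _; first by apply: Or31; eexists => l l'; reflexivity.
case: ((i <= a) && (a + b <= i + h))%N; first by apply: Or33; eexists => l l'; reflexivity.
case: ((a <= i) && (i + h <= a + b))%N; first by apply: Or32; eexists => l l'; reflexivity.
case: (a + b <= i)%N; first by apply: Or32; eexists => l l'; reflexivity.
case: (i + h <= a)%N; first by apply: Or32; eexists => l l'; reflexivity.
by apply: Or31; eexists => l l'; reflexivity.
Qed.

Lemma graft_continuous k h i :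
  continuous (fun x : lengths R * lengths R => graft k h i x.1 x.2).
Proof.
apply: ptws_continuous => e.
pose f (x : lengths R * lengths R) := graft k h i x.1 x.2 e.
rewrite -[X in continuous X]/f.
have [[c ce]|[e' ce]|[e' ce]] := graft_cases k h i e.
- have -> : f = fun=> c by apply: funext => x; exact: ce.
  exact: (@cst_continuous (lengths R * lengths R)%type (\bar R) c).
- have -> : f = fun x => x.1 e' by apply: funext => x; exact: ce.
  move=> x; apply: (@continuous_comp _ _ _ fst (fun l : lengths R => l e')).
    exact: cvg_fst.
  exact: ptws_eval_continuous.
- have -> : f = fun x => x.2 e' by apply: funext => x; exact: ce.
  move=> x; apply: (@continuous_comp _ _ _ snd (fun l : lengths R => l e')).
    exact: cvg_snd.
  exact: ptws_eval_continuous.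
Qed.

Lemma outer_neq h i e : (1 < h)%N -> (1 < e.2)%N -> outer i h e != (i, h).
Proof.
case: e => a b /= h1 b1; rewrite /outer /=.
by do 2?case: ifP => ?; apply/eqP => -[]; lia.
Qed.

Lemma graft_outer k h i l l' e : (1 < h)%N -> (1 < e.2)%N ->
  graft k h i l l' (outer i h e) = l e.
Proof.
move=> h1; case: e => a b /= b1; have := @outer_neq h i (a, b) h1 b1.
rewrite /outer /=; case: (leqP (a + b) i) => abi.
  by move=> /negPf /= ->; rewrite ifF 1?ifF ?abi//; lia.
case: (leqP a i) => ai.
  move=> /negPf /= ->; rewrite ifF; last lia.
  by rewrite ai /= ifT; [congr (l (_, _)); lia|lia].
move=> /negPf /= ->; rewrite ifF; last lia.
rewrite ifF; last lia. rewrite ifF; last lia.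
by rewrite ifT; [congr (l (_, _)); lia|lia].
Qed.

Lemma graft_inner k h i l l' e : (e.1 + e.2 <= h)%N -> e != (0, h)%N ->
  graft k h i l l' (shift_edge i e) = l' e.
Proof.
case: e => a b /= abh ne; rewrite /shift_edge /graft /= ifF; last first.
  by apply: contraNF ne => /eqP[] ? ->; apply/eqP; congr pair; lia.
by rewrite ifT; [congr (l' (_, _)); lia | lia].
Qed.

Lemma graft_out k h i l l' (u u' : seq edge) e :
    (0 < h)%N -> (forall e, e \notin u -> l e = 0) -> (forall e, e \notin u' -> l' e = 0) ->
    e != (i, h) -> e \notin map (outer i h) u -> e \notin map (shift_edge i) u' ->
  graft k h i l l' e = 0.
Proof.
move=> h0 lu lu'; case: e => a b ne no ns; rewrite /graft (negPf ne).
case: ifP => c1.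
  apply: lu'; apply: contra ns => /(map_f (shift_edge i)); rewrite /shift_edge /=.
  by rewrite subnK//; lia.
case: ifP => c2.
  apply: lu; apply: contra no => /(map_f (outer i h)); rewrite /outer /=.
  rewrite ifF; last lia.
  by rewrite ifT; [rewrite (_ : (b + 1 - h + h - 1 = b)%N)//; lia | lia].
case: ifP => c3.
  by apply: lu; apply: contra no => /(map_f (outer i h)); rewrite /outer /= c3.
case: ifP => c4 //.
apply: lu; apply: contra no => /(map_f (outer i h)); rewrite /outer /=.
rewrite ifF; last lia. rewrite ifF; last lia.
by rewrite (_ : (a + 1 - h + h - 1 = a)%N)//; lia.
Qed.

Lemma graft_leafr k i l l' t : (i < k)%N -> tree_point k l t ->
  (forall e, l' e = 0) -> graft k 1 i l l' = l.
Proof.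
move=> ik [st lt l0 lt0] l'0; apply: funext => -[a b].
have lb e : (e.2 < 2)%N -> l e = 0.
  by move=> e2; apply: lt0; apply: contraL e2 => /(edges_in st)[]; lia.
rewrite /graft l'0 andbF; case: eqP => [[-> ->]|_]; first by rewrite lb.
case: ifP => c1; first by rewrite lb//=; lia.
case: ifP => c2; first by congr l; congr pair; lia.
case: ifP => c3 //; case: ifP => c4; first by congr l; congr pair; lia.
by lia.
Qed.

Lemma graft_leafl h l l' t : tree_point h l' t ->
  (forall e, l e = 0) -> graft 1 h 0 l l' = l'.
Proof.
move=> [st lt l0 lt0] le0; apply: funext => -[a b].
rewrite /graft !le0 /=; case: eqP => [[-> ->]|_].
  rewrite lt0//; apply/negP => /(edges_in st)[] /=; lia.
case: ifP => c1; first by congr l'; congr pair; lia.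
rewrite !if_same [RHS]lt0//; apply/negP => /(edges_in st)[] /=; lia.
Qed.

Lemma graft_tree_point k h i l l' t t' :
    (1 < k)%N -> (1 < h)%N -> (i < k)%N -> tree_point k l t -> tree_point h l' t' ->
  tree_point (k + h).-1 (graft k h i l l') (tgraft t i t').
Proof.
move=> k1 h1 ik [st lt l0 lt0] [st' lt' l0' lt0']; subst k h; split.
- exact: stable_tgraft.
- by have := @leaves_tgraft t i t' ik; lia.
- by case=> a b; rewrite /graft; do 6?case: ifP => // _; rewrite ?leey.
move=> e; rewrite edges_tgraft// (perm_mem (perm_graft_edges _ _ _ _)).
rewrite mem_cat inE !negb_or => /and3P[e1 e2 e3].
exact: (graft_out _ (ltnW h1) lt0 lt0').
Qed.

Lemma count_graft (P : \bar R -> bool) k h i l l' t t' :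
    (1 < k)%N -> (1 < h)%N -> (i < k)%N -> tree_point k l t -> tree_point h l' t' ->
  count (P \o graft k h i l l') (edges (tgraft t i t')) =
  (count (P \o l) (edges t) + P +oo + count (P \o l') (edges t'))%N.
Proof.
move=> k1 h1 ik [st lt l0 lt0] [st' lt' l0' lt0']; subst k h.
rewrite edges_tgraft// (seq.permP (perm_graft_edges _ _ _ _)).
rewrite count_cat /= eqxx k1 h1 /= !count_map -addnA; congr (_ + (_ + _))%N.
  apply: eq_in_count => e /(edges_in st)[_ e2 _] /=.
  by rewrite graft_outer.
apply: eq_in_count => e /(edges_in st')[e1 e2 e3].
rewrite -[LHS]/(P (graft (leaves t) (leaves t') i l l' (shift_edge i e))).
rewrite graft_inner//; apply: contraTneq e3 => -> /=.
by rewrite ltnn.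
Qed.

Lemma tree_point1 l t : tree_point 1 l t -> forall e, l e = 0.
Proof.
move=> [st lt l0 lt0] e; apply: lt0; apply/negP => /(edges_in st)[].
by rewrite lt; lia.
Qed.

Lemma tree_point_gt0 n l t : tree_point n l t -> (0 < n)%N.
Proof. by move=> [st <- _ _]; exact: leaves_gt0. Qed.

Definition graft_cellular (X : nat -> cells (lengths R)) :=
  forall m n i a b l l', (i < m)%N -> skel (X m) a.+1 l -> skel (X n) b.+1 l' ->
    skel (X (m + n).-1) (a + b).+1 (graft m n i l l').

Lemma graft_cellular_Omega : graft_cellular (@OmegaBAs_cells R).
Proof.
move=> m n i a b l l' im /skel_OmegaP[t lt ct] /skel_OmegaP[t' lt' ct'].
have m0 := tree_point_gt0 lt; have n0 := tree_point_gt0 lt'.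
apply/skel_OmegaP; have [m1|m1] := leqP m 1.
  have em : m = 1%N by lia. have ei : i = 0%N by lia. subst m i.
  by exists t'; rewrite (graft_leafl lt' (tree_point1 lt)) ?add1n//; lia.
have [n1|n1] := leqP n 1.
  have en : n = 1%N by lia. subst n.
  by exists t; rewrite (graft_leafr im lt (tree_point1 lt')) ?addn1//; lia.
exists (tgraft t i t'); first exact: graft_tree_point.
have := count_graft (fun x => (x != 0) && (x != +oo)) m1 n1 im lt lt'.
rewrite /finite_pos /= ?eqxx ?andbF ?addn0 => ->.
by rewrite !ltnS in ct ct' *; exact: leq_add.
Qed.

(** The new infinite edge makes dimensions add: [(m + n - 1) - 2 - 1 = (m - 2) + (n - 2)]. The bound
    on the number of edges keeps the truncated subtractions exact. *)
Lemma graft_cellular_Ainf : graft_cellular (@Ainf_cells R).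
Proof.
move=> m n i a b l l' im /skel_AinfP[t lt ct] /skel_AinfP[t' lt' ct'].
have m0 := tree_point_gt0 lt; have n0 := tree_point_gt0 lt'.
apply/skel_AinfP; have [m1|m1] := leqP m 1.
  have em : m = 1%N by lia. have ei : i = 0%N by lia. subst m i.
  by exists t'; rewrite (graft_leafl lt' (tree_point1 lt)) ?add1n//; lia.
have [n1|n1] := leqP n 1.
  have en : n = 1%N by lia. subst n.
  by exists t; rewrite (graft_leafr im lt (tree_point1 lt')) ?addn1//; lia.
exists (tgraft t i t'); first exact: graft_tree_point.
have := count_graft (fun x => x == +oo) m1 n1 im lt lt'.
rewrite [X in _ -> X]/= => ->; rewrite eqxx.
have := count_finite_infinite lt; have := count_finite_infinite lt'.
move: ct ct'; rewrite -[count (_ \o l) _]/(count (infinite l) (edges t)).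
by rewrite -[count (_ \o l') _]/(count (infinite l') (edges t')) /=; lia.
Qed.

End Skeleta.

(** * Cubes of edge lengths *)

Section LengthTopology.
Variable R : realType.
Local Open Scope ereal_scope.

Lemma min_ereal_continuous (T : topologicalType) (f g : T -> \bar R) :
  continuous f -> continuous g -> continuous (fun x => Order.min (f x) (g x)).
Proof.
move=> cf cg x; have sep (f' g' : T -> \bar R) : continuous f' -> continuous g' ->
    f' x < g' x -> \forall y \near x, f' y < g' y.
  move=> cf' cg' fg; have [r fr rg] : exists2 r : \bar R, f' x < r & r < g' x.
    case: (f' x) (g' x) fg => [r||] [s||] //= rs.
    - by exists ((r + s) / 2)%:E; rewrite lte_fin (midf_lt rs).
    - by exists (r + 1)%:E; rewrite ?ltry// lte_fin ltrDl.
    - by exists (s - 1)%:E; rewrite ?ltNyr// lte_fin ltrBlDr ltrDl.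
    - by exists 0.
  have h1 := cf' x _ (open_ereal_lt' fr); have h2 := cg' x _ (open_ereal_gt' rg).
  near=> y; apply: (@lt_trans _ _ r); near: y; [exact: h1|exact: h2].
move=> A nA0; change (\forall y \near x, A (Order.min (f y) (g y))).
move: nA0; rewrite /=; case: (ltgtP (f x) (g x)) => fg nA.
- have h := sep _ _ cf cg fg; near=> y => /=; rewrite min_l; last by apply/ltW; near: y.
  by near: y; exact: cf nA.
- have h := sep _ _ cg cf fg; near=> y => /=; rewrite min_r; last by apply/ltW; near: y.
  by near: y; exact: cg nA.
- have h1 := cf x A nA; rewrite fg in nA; have h2 := cg x A nA.
  near=> y => /=; rewrite /Order.min; case: ifP => _; near: y; [exact: h1|exact: h2].
Unshelve. all: by end_near.
Qed.

Lemma unitI_itv (u : unitI R) : (0 <= set_val u <= 1)%R.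
Proof. by have := set_valP u; rewrite /= in_itv. Qed.

Lemma length_of_ge0 (u : unitI R) : 0 <= length_of u.
Proof.
rewrite /length_of; case: eqP => _; first exact: leey.
have /andP[u0 u1] := unitI_itv u.
by rewrite lee_fin divr_ge0// subr_ge0.
Qed.

Lemma length_of_bool b : length_of (unitI_bool R b) = if b then +oo else 0.
Proof.
rewrite /length_of /=; case: b => /=; first by rewrite eqxx.
by rewrite eq_sym oner_eq0 mul0r.
Qed.

Lemma length_of_continuous : continuous (@length_of R).
Proof.
pose uval (u : unitI R) : R := set_val u.
have cv : continuous uval by exact: initial_continuous.
move=> u; have /andP[u0 u1] := unitI_itv u.
have [e|ne] := eqVneq (set_val u) 1%R; last first.
  have ult : (set_val u < 1)%R by rewrite lt_neqAle ne.
  have eu : length_of u = (set_val u / (1 - set_val u))%:E by rewrite /length_of (negPf ne).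
  have cg : {for set_val u, continuous (fun x : R => x / (1 - x))%R}.
    apply: continuousM; first exact: cvg_id.
    apply: continuousV; first by rewrite subr_eq0 eq_sym.
    by apply: continuousB; [exact: cvg_cst | exact: cvg_id].
  move=> A; rewrite eu => nA.
  have h1 : \forall v \near u, (set_val v < 1)%R.
    exact: (cv u [set x : R | (x < 1)%R] (lt_nbhsl ult)).
  have h2 : \forall v \near u, A (set_val v / (1 - set_val v))%:E.
    exact: (cv u (fun x => A (x / (1 - x))%:E) (cg (fun x => A x%:E) nA)).
  change (\forall v \near u, A (length_of v)).
  near=> v; rewrite /length_of ifN; first by near: v.
  by rewrite lt_eqF//; near: v.
move=> A; rewrite {1}/length_of e eqxx => -[M [_ MA]].
(* With [v > 1 - 1/(2N)] one gets [N (1 - v) < 1/2], and [1 - v <= N (1 - v)] as [N >= 1]; hence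
   [v > 1/2 > N (1 - v) >= M (1 - v)]. *)
pose N : R := (`|M| + 1)%R.
have N1 : (1 <= N)%R by rewrite lerDr.
have N0 : (0 < N)%R by exact: lt_le_trans N1.
have h : \forall v \near u, (1 - (2 * N)^-1 < set_val v)%R.
  apply: (cv u [set x : R | (1 - (2 * N)^-1 < x)%R]); rewrite /uval e.
  by apply: lt_nbhsr; rewrite ltrBlDr ltrDl invr_gt0 mulr_gt0.
change (\forall v \near u, A (length_of v)).
near=> v; apply: MA; rewrite /length_of; case: eqP => [_|/eqP nv]; first exact: ltry.
have /andP[v0 v1] := unitI_itv v.
have vlt : (0 < 1 - set_val v)%R by rewrite subr_gt0 lt_neqAle nv.
have hv : (1 - (2 * N)^-1 < set_val v)%R by near: v.
rewrite lte_fin ltr_pdivlMr//.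
have h1 : (1 - set_val v < (2 * N)^-1)%R by rewrite ltrBlDr addrC -ltrBlDr.
have h2 : ((1 - set_val v) * (2 * N) < 1)%R by rewrite -ltr_pdivlMr ?mulr_gt0// mul1r.
have h3 : (M <= N)%R by rewrite (le_trans (ler_norm M))// lerDl.
apply: (@le_lt_trans _ _ (N * (1 - set_val v))%R); first by rewrite ler_wpM2r// ltW.
have h4 : (2 * (N * (1 - set_val v)) < 1)%R by rewrite mulrA mulrC.
have h5 : (1 - set_val v <= N * (1 - set_val v))%R by exact: ler_peMl (ltW vlt) N1.
by move: h4 h5; set t := (N * _)%R => h4 h5; lra.
Unshelve. all: by end_near.
Qed.

End LengthTopology.

Lemma subrACA (V : zmodType) (a b c d : V) : a - b - (c - d) = a - c - (b - d).
Proof. by rewrite !opprB addrACA [RHS]addrACA [- b - c]addrC. Qed.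

(** * Alternating sums over deletions from a list of edges *)

Section DeletionSums.
Variable V : zmodType.
Implicit Types (w : seq edge) (b : pred edge).

(** The recursion on the head lets the alternating sum of deletions be handled without index
    arithmetic; [dsumE] gives the indexed form. *)
Fixpoint dsum (F : edge -> seq edge -> V) w : V :=
  if w is x :: w' then F x w' - dsum (fun y u => F y (x :: u)) w' else 0.

Definition del (i : nat) w := take i w ++ drop i.+1 w.

Lemma dsumE F w :
  dsum F w = \sum_(i < size w) F (nth (0, 0)%N w i) (del i w) *~ (-1) ^+ i.
Proof.
elim: w F => [|x w IH] F; first by rewrite big_ord0.
rewrite /= big_ord_recl /del /= drop0 mulr1z IH; congr (_ + _).
by rewrite -sumrN; apply: eq_bigr => i _; rewrite exprS mulN1r mulrNz.
Qed.

Lemma dsumB F G w : dsum (fun x u => F x u - G x u) w = dsum F w - dsum G w.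
Proof.
elim: w F G => [|x w IH] F G /=; first by rewrite subr0.
by rewrite IH subrACA.
Qed.

Lemma dsumN F w : dsum (fun x u => - F x u) w = - dsum F w.
Proof. by elim: w F => [|x w IH] F /=; rewrite ?oppr0// IH -opprD. Qed.

Lemma perm_cons_del x y u w : perm_eq (y :: u) w -> perm_eq (y :: x :: u) (x :: w).
Proof.
move=> h; rewrite (perm_catCA [:: y] [:: x] u); by rewrite perm_cons.
Qed.

Lemma eq_dsum F G w :
  (forall x u, perm_eq (x :: u) w -> F x u = G x u) -> dsum F w = dsum G w.
Proof.
elim: w F G => [//|x w IH] F G FG /=; rewrite FG//; congr (_ - _).
by apply: IH => y u yu; apply/FG/perm_cons_del.
Qed.

Lemma dsum_in (S : zmodClosed V) F w :
  (forall x u, perm_eq (x :: u) w -> F x u \in S) -> dsum F w \in S.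
Proof.
elim: w F => [|x w IH] F FS /=; first by rewrite rpred0.
rewrite rpredB ?FS// IH// => y u yu; exact/FS/perm_cons_del.
Qed.

Lemma dsum_cat F u v :
  dsum F (u ++ v) = dsum (fun x u' => F x (u' ++ v)) u +
    dsum (fun x v' => F x (u ++ v')) v *~ (-1) ^+ size u.
Proof.
elim: u F => [|x u IH] F /=; first by rewrite add0r mulr1z.
by rewrite IH opprD addrA exprS mulN1r mulrNz.
Qed.

Lemma dsum_map F (f : edge -> edge) w :
  dsum F (map f w) = dsum (fun x u => F (f x) (map f u)) w.
Proof. by elim: w F => //= x w IH F; rewrite IH. Qed.

(** The length is fixed because a chain of degree [k] is meaningful only for [k] free edges.
    Adjacent transpositions generate all permutations. *)
Definition alt_at k (F : seq edge -> V) := forall u x y v,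
  size (u ++ x :: y :: v) = k -> F (u ++ x :: y :: v) = - F (u ++ y :: x :: v).

(** Exchanging two neighbours exchanges the two terms deleting them, whose signs are opposite; every
    other term changes sign by alternation of [F]. *)
Lemma dsum_alt k F : (forall z, alt_at k (F z)) -> alt_at k.+1 (dsum F).
Proof.
move=> aF u; elim: u k F aF => [|z u IH] k F aF x y v /=.
  move=> [sk]; have -> : dsum (fun z w => F z (y :: x :: w)) v =
      - dsum (fun z w => F z (x :: y :: w)) v.
    rewrite -dsumN; apply: eq_dsum => z v' /perm_size/= zv.
    by apply: (aF z [::]); rewrite /= zv.
  by rewrite opprK !opprB addrA addrAC.
case: k aF => [|k] aF [sk]; first by rewrite size_cat /= addnS in sk.
rewrite (aF z u x y v sk).
rewrite [dsum _ (u ++ y :: x :: v)](_ : _ = - dsum (fun y w => F y (z :: w)) (u ++ x :: y :: v)).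
  by rewrite opprK opprD.
apply: (IH k) => [z'|]; last by rewrite -sk !size_cat.
by move=> u' x' y' v' sk'; apply: (aF z' (z :: u')); rewrite /= sk'.
Qed.

Definition setb x b : pred edge := fun e => (e == x) || b e.

Lemma setbC x y b : setb x (setb y b) = setb y (setb x b).
Proof. by apply: funext => e; rewrite /setb orbCA. Qed.

(* The boundary of the cube with free edges [w], whose other edges have infinite
   length when they satisfy [b] and length 0 otherwise. *)
Definition delta (F : pred edge -> seq edge -> V) b w : V :=
  dsum (fun x u => F (setb x b) u - F b u) w.

Lemma deltaB F G b w :
  delta (fun b u => F b u - G b u) b w = delta F b w - delta G b w.
Proof.
rewrite /delta -dsumB; apply: eq_dsum => x u _.
by rewrite subrACA.
Qed.

(** Any two edges are removed in both orders, with opposite signs, and declaring them infinite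
    commutes by [setbC]. *)
Lemma delta_delta F b w : delta (delta F) b w = 0.
Proof.
elim: w F b => [//|x w IH] F b.
rewrite /delta /= -/(delta F _ _) -/(delta F _ _).
have -> : dsum (fun y u => delta F (setb y b) (x :: u) - delta F b (x :: u)) w =
    delta (fun b u => F (setb x b) u - F b u - delta (fun b u => F b (x :: u)) b u) b w.
  by [].
rewrite !deltaB IH subr0; apply/eqP; rewrite subr_eq0; apply/eqP; congr (_ - _).
by apply: eq_dsum => y u _; rewrite setbC.
Qed.

Lemma delta_alt k F : (forall b, alt_at k (F b)) -> forall b, alt_at k.+1 (delta F b).
Proof.
move=> aF b; apply: dsum_alt => z u x y v suv.
by rewrite (aF (setb z b) u x y v suv) (aF b u x y v suv) opprK opprB addrC.
Qed.

Lemma alt_move k F u x v w : alt_at k F -> size (u ++ x :: v ++ w) = k ->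
  F (u ++ x :: v ++ w) = F (u ++ v ++ x :: w) *~ (-1) ^+ size v.
Proof.
move=> aF; elim: v u => [|y v IH] u; first by rewrite mulr1z.
move=> /= sk; rewrite aF// -cat_rcons IH; last first.
  by rewrite -sk !size_cat size_rcons /= !addnS.
by rewrite cat_rcons exprS mulN1r mulrNz.
Qed.

Lemma alt_swap k F u v w z : alt_at k F -> size (u ++ v ++ w ++ z) = k ->
  F (u ++ v ++ w ++ z) = F (u ++ w ++ v ++ z) *~ (-1) ^+ (size v * size w).
Proof.
move=> aF; elim: v u => [|x v IH] u /= sk; first by rewrite mulr1z.
rewrite -cat_rcons IH; last first.
  by rewrite -sk !size_cat size_rcons /= ?size_cat; lia.
rewrite cat_rcons (alt_move (k := k))//; last first.
  by rewrite -sk !size_cat /= !size_cat; lia.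
by rewrite -mulrzA -exprD mulSn addnC.
Qed.

End DeletionSums.

Lemma raddf_dsum (V W : zmodType) (f : {additive V -> W}) F w :
  f (dsum F w) = dsum (fun x u => f (F x u)) w.
Proof. by elim: w F => [|x w IH] F /=; rewrite ?raddf0// raddfB /= IH. Qed.

Lemma zmod_regroup (V : zmodType) (a b c d : V) :
  a - b - c = - (b - d) - (c - (a - d)).
Proof.
rewrite (opprB b d) (opprB c (a - d)) [RHS]addrC [RHS]addrAC; congr (_ - _).
by rewrite addrA subrK.
Qed.

(** * Cubes of lengths, cones, and alternating replacements *)

Section CubeSystems.
Variable R : realType.
Implicit Types (w : seq edge) (b : pred edge) (l : lengths R).
Local Notation L := (lengths R).
(** No cube maps into the empty set, so these are the combinations of degenerate cubes. *)
Local Notation dg := (@chain_on R L _ set0).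

Definition good b w := uniq w && all (predC b) w.

Lemma good_cons b w x u : good b w -> perm_eq (x :: u) w ->
  good (setb x b) u /\ good b u.
Proof.
move=> /andP[uw /allP bw] xu; have : uniq (x :: u) by rewrite (perm_uniq xu).
move=> /= /andP[nx uu]; split; apply/andP; split=> //; apply/allP => e eu;
  have /bw be : e \in w by rewrite -(perm_mem xu) inE eu orbT.
- by rewrite /= /setb negb_or (be : ~~ b e) andbT; apply: contraNneq nx => <-.
- by [].
Qed.

Definition edge_cube k b w (x : cube R k) : L :=
  fun e => if e \in w then
             (if insub (index e w) is Some i then length_of (x i) else +oo%E)
           else if b e then +oo%E else 0%E.

(** The free edges need not come from a tree: this is just a product of copies of [[0, +oo]],
    contractible for any [w]. *)
Definition closed_cell b w : set L :=
  [set l | forall e, (0 <= l e)%E /\ (e \notin w -> l e = if b e then +oo%E else 0%E)].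

Lemma closed_cell_face b w x u : perm_eq (x :: u) w ->
  closed_cell (setb x b) u `<=` closed_cell b w.
Proof.
move=> xu l lc e; split; first by case: (lc e).
rewrite -(perm_mem xu) inE negb_or => /andP[ex eu].
by case: (lc e) => _ -> //; rewrite /setb (negPf ex).
Qed.

Lemma closed_cell_face0 b w x u : perm_eq (x :: u) w ->
  closed_cell b u `<=` closed_cell b w.
Proof.
move=> xu l lc e; split; first by case: (lc e).
rewrite -(perm_mem xu) inE negb_or => /andP[ex eu].
by case: (lc e) => _ ->.
Qed.

Lemma edge_cube_in b k w (x : cube R k) : closed_cell b w (edge_cube b w x).
Proof.
move=> e; rewrite /edge_cube; split; last by move=> /negPf ->.
case: ifP => _; last by case: ifP => _; rewrite ?leey.
by case: insubP => [i _ _|_]; [exact: length_of_ge0 | rewrite leey].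
Qed.

Lemma edge_cube_continuous k b w : continuous (@edge_cube k b w).
Proof.
apply: ptws_continuous => e; rewrite /edge_cube; case: (e \in w); last first.
  exact: (@cst_continuous (cube R k) (\bar R)).
case: (insub _) => [i|]; last exact: (@cst_continuous (cube R k) (\bar R)).
move=> x; apply: (@continuous_comp _ _ _ (fun x : cube R k => x i) (@length_of R)).
  exact: ptws_eval_continuous.
exact: length_of_continuous.
Qed.

Definition edge_chain k b w : chains R L k := scube (@edge_cube k b w).

Lemma edge_chain_on k b w : edge_chain k b w \in chain_on (closed_cell b w).
Proof.
apply: scube_on; right; split; first exact: edge_cube_continuous.
by move=> x; exact: edge_cube_in.
Qed.

Lemma edge_cube_face k b w (i : 'I_k.+1) c : size w = k.+1 -> good b w ->
  @edge_cube k.+1 b w \o face_map i c =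
  @edge_cube k (if c then setb (nth (0, 0)%N w i) b else b) (del i w).
Proof.
move=> sw /andP[uw /allP bw]; have iw : (i < size w)%N by rewrite sw.
set x := nth _ w i; have wE : w = take i w ++ x :: drop i.+1 w.
  by rewrite -drop_nth// cat_take_drop.
have pw : perm_eq (x :: del i w) w.
  by rewrite [X in perm_eq _ X]wE -cat1s perm_catCA.
have xw : x \in w by exact: mem_nth.
have nx : x \notin del i w.
  by have := uw; rewrite -(perm_uniq pw) => /andP[].
apply: funext => y; apply: funext => e; rewrite /= /edge_cube.
have -> : (e \in w) = (e == x) || (e \in del i w) by rewrite -(perm_mem pw) inE.
have [->|ex] := eqVneq e x.
  rewrite (negPf nx) /= index_uniq//; case: insubP => [j _ ij|]; last by rewrite ltn_ord.
  have -> : j = i by exact: val_inj.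
  rewrite /face_map unlift_none length_of_bool; case: c; first by rewrite /setb eqxx.
  by rewrite (negPf (bw _ xw)).
rewrite /=; case: ifP => ed; last by case: c => //; rewrite /setb (negPf ex).
have ie : index e w = bump i (index e (del i w)).
  rewrite [in LHS]wE /del !index_cat /bump; case: ifP => et.
    have : (index e (take i w) < size (take i w))%N by rewrite index_mem.
    by rewrite size_take iw; lia.
  rewrite /= eq_sym (negPf ex) size_take iw; lia.
have dk : (index e (del i w) < k)%N.
  have sk : size (del i w) = k by move/perm_size: pw; rewrite sw => -[].
  by rewrite -[X in (_ < X)%N]sk index_mem.
rewrite (insubT (fun m => m < k)%N dk) /=.
have ik : (index e w < k.+1)%N by rewrite -sw index_mem -(perm_mem pw) inE ed orbT.
rewrite (insubT (fun m => m < k.+1)%N ik) /=; congr length_of.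
rewrite /face_map; have -> : Sub (index e w) ik = lift i (Ordinal dk) by exact: val_inj.
by rewrite liftK; congr y; exact: val_inj.
Qed.

Lemma bd_edge_chain k b w : size w = k.+1 -> good b w ->
  bd (edge_chain k.+1 b w) = delta (edge_chain k) b w.
Proof.
move=> sw gw; rewrite /edge_chain bd_scube /bd_cube /delta dsumE sw.
by apply: eq_bigr => i _; rewrite !edge_cube_face.
Qed.

(** Free lengths are truncated at a height going from 0 to infinity: on [closed_cell b w] this joins
    the vertex with all free lengths 0 to the identity. *)
Definition contraction b w l (u : unitI R) : L :=
  fun e => if e \in w then Order.min (l e) (length_of u)
           else if b e then +oo%E else 0%E.

Definition cone b w k (c : chains R L k) : chains R L k.+1 :=
  uncurry_chain (push_chain (contraction b w) c).

HB.instance Definition _ b w k :=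
  GRing.Additive.copy (@cone b w k)
    (@uncurry_chain R L k \o @push_chain R L (unitI R -> L) (contraction b w) k).

(** Independence of the order of the free edges is what makes coned chains alternate exactly. *)
Lemma cone_mem b w w' k : w =i w' -> @cone b w k = @cone b w' k.
Proof.
move=> ww'; rewrite /cone; have -> // : contraction b w = contraction b w'.
by apply: funext => l; apply: funext => u; apply: funext => e;
   rewrite /contraction ww'.
Qed.

Lemma contraction_in b w l u : (forall e, 0 <= l e)%E ->
  closed_cell b w (contraction b w l u).
Proof.
move=> l0 e; rewrite /contraction; split; last by move=> /negPf ->.
case: ifP => _; last by case: ifP => _; rewrite ?leey.
by rewrite le_min l0 length_of_ge0.
Qed.

Lemma cone_on b w k (c : chains R L k) :
  c \in chain_on (closed_cell b w) -> cone b w c \in chain_on (closed_cell b w).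
Proof.
apply: (chain_on_ind (f := @cone b w k)) => s sA.
rewrite /= /cone push_scube uncurry_scube; apply: scube_on.
case: sA => [[i si]|[cs sA]].
  left; exists (lift ord0 i) => x y xy; rewrite /uncurry_cube /= xy//.
  rewrite (si (fun j => x (lift ord0 j)) (fun j => y (lift ord0 j)))// => j ji.
  by apply: xy; rewrite (inj_eq lift_inj).
right; split=> [|x]; last first.
  by apply: contraction_in => e; case: (sA (fun j => x (lift ord0 j)) e).
apply: ptws_continuous => e; rewrite /uncurry_cube /contraction /=.
case: (e \in w); last exact: (@cst_continuous (cube R k.+1) (\bar R)).
apply: min_ereal_continuous.
  have ct : continuous (fun x : cube R k.+1 => (fun j => x (lift ord0 j)) : cube R k).
    by apply: ptws_continuous => j; exact: ptws_eval_continuous.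
  have cse : continuous (fun x : cube R k => s x e).
    move=> x; apply: (@continuous_comp _ _ _ s (fun l : L => l e)); first exact: cs.
    exact: ptws_eval_continuous.
  by move=> x; exact: (@continuous_comp _ _ _ _ _ x (ct x) (cse _)).
move=> x; apply: (@continuous_comp _ _ _ (fun x : cube R k.+1 => x ord0) (@length_of R)).
  exact: ptws_eval_continuous.
exact: length_of_continuous.
Qed.

Lemma cone_dg b w k (c : chains R L k) : c \in dg -> cone b w c \in dg.
Proof.
apply: (chain_on_ind (f := @cone b w k)) => s sA.
rewrite /= /cone push_scube uncurry_scube; apply: scube_on; left.
case: sA => [[i si]|[_ /(_ (fun=> unitI_bool R true))//]].
exists (lift ord0 i) => x y xy; rewrite /uncurry_cube /= xy//.
rewrite (si (fun j => x (lift ord0 j)) (fun j => y (lift ord0 j)))// => j ji.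
by apply: xy; rewrite (inj_eq lift_inj).
Qed.

Lemma eval_push c b w k (d : chains R L k) :
  eval_chain c (push_chain (contraction b w) d) =
  push_chain (fun l => contraction b w l (unitI_bool R c)) d.
Proof.
rewrite /eval_chain /push_chain lift_comp; apply: eq_lift_chains => s /=.
by rewrite lift_scube.
Qed.

(** At the end [true] the contraction fixes the closed cell; at the end [false] it is constant
    there, which gives degenerate cubes because the degree is positive. *)
Lemma bd_cone b w k (c : chains R L k.+1) : c \in chain_on (closed_cell b w) ->
  bd (cone b w c) - (c - cone b w (bd c)) \in dg.
Proof.
pose p u := @push_chain R L L (fun l => contraction b w l (unitI_bool R u)) k.+1.
have -> : bd (cone b w c) - (c - cone b w (bd c)) = p true c - c - p false c.
  by rewrite /cone bd_uncurryS -push_bd !eval_push subrACA subrr subr0 addrAC.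
pose f : {additive chains R L k.+1 -> chains R L k.+1} := (p true \- idfun) \- p false.
apply: (chain_on_ind (f := f)) => s sA; rewrite /f /p /= !push_scube.
have sd : degenerate s -> forall g : L -> L, scube (g \o s) \in dg.
  by move=> [i si] g; apply/scube_on; left; exists i => x y xy /=; rewrite (si x y).
case: (sA) => [ds|[cs sc]]; first by rewrite !rpredB ?sd//; exact: (sd ds id).
have -> : (fun l => contraction b w l (unitI_bool R true)) \o s = s.
  apply: funext => x; apply: funext => e; rewrite /= /contraction length_of_bool.
  have [_ se] := sc x e; case: ifP => ew; first by rewrite min_l ?leey.
  by rewrite se// ew.
rewrite subrr sub0r rpredN scube_on//; left; exists ord0 => x y _ /=.
apply: funext => e; rewrite /contraction length_of_bool; case: ifP => // _.
by rewrite !min_r//; [case: (sc y e) | case: (sc x e)].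
Qed.

(* A system of chains with the same boundary relations as the cubes [edge_chain], but
   exactly alternating in the ordering of the free edges. *)
Fixpoint alt_chain k : pred edge -> seq edge -> chains R L k :=
  match k with
  | 0 => fun b w => edge_chain 0 b w
  | k'.+1 => fun b w =>
      if k' is 0 then edge_chain k'.+1 b w else cone b w (delta (alt_chain k') b w)
  end.

Lemma alt_chain_on k b w : alt_chain k b w \in chain_on (closed_cell b w).
Proof.
elim: k b w => [|k IH] b w; first exact: edge_chain_on.
rewrite /=; case: k IH => [|k] IH; first exact: edge_chain_on.
apply: cone_on; apply: dsum_in => x u xu; apply: rpredB.
  exact: (chain_on_sub (closed_cell_face (b := b) xu)).
exact: (chain_on_sub (closed_cell_face0 (b := b) xu)).
Qed.

Lemma delta_in k (S : zmodClosed (chains R L k)) F b w : good b w ->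
  (forall b' u, good b' u -> (size u).+1 = size w -> F b' u \in S) ->
  delta F b w \in S.
Proof.
move=> gw FS; apply: dsum_in => x u xu; have [g1 g2] := good_cons gw xu.
by apply: rpredB; apply: FS => //; rewrite -(perm_size xu).
Qed.

Lemma bd_delta k F b w : bd (delta F b w : chains R L k) = delta (fun b u => bd (F b u)) b w.
Proof.
rewrite /delta (raddf_dsum (@bd R L k)); apply: eq_dsum => x u _; exact: raddfB.
Qed.

Lemma delta_dg k (F G : pred edge -> seq edge -> chains R L k) b w : good b w ->
  (forall b' u, good b' u -> (size u).+1 = size w -> F b' u - G b' u \in dg) ->
  delta F b w - delta G b w \in dg.
Proof. by move=> gw FG; rewrite -deltaB; exact: delta_in. Qed.

Lemma bd_cone_cycle b w k (z : chains R L k.+1) : z \in chain_on (closed_cell b w) ->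
  bd z \in dg -> bd (cone b w z) - z \in dg.
Proof.
move=> zc bz; have := bd_cone zc; rewrite opprB addrCA addrC => h.
have -> : bd (cone b w z) - z = bd (cone b w z) - z + cone b w (bd z) - cone b w (bd z).
  by rewrite addrK.
by rewrite rpredB//; exact: cone_dg.
Qed.

(** By induction and [delta_delta], the prescribed boundary is a cycle modulo degenerate cubes, and
    coning fills it. *)
Lemma bd_alt_chain k b w : size w = k.+1 -> good b w ->
  bd (alt_chain k.+1 b w) - delta (alt_chain k) b w \in dg.
Proof.
elim: k b w => [|k IH] b w sw gw; first by rewrite bd_edge_chain// subrr rpred0.
set z := delta (alt_chain k.+1) b w.
have zc : z \in chain_on (closed_cell b w).
  apply: dsum_in => x u xu; apply: rpredB.
    exact: (chain_on_sub (closed_cell_face (b := b) xu) (alt_chain_on _ _ _)).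
  exact: (chain_on_sub (closed_cell_face0 (b := b) xu) (alt_chain_on _ _ _)).
apply: (bd_cone_cycle zc).
rewrite /z bd_delta -[delta _ _ _]subr0 -(delta_delta (alt_chain k) b w).
by apply: delta_dg => // b' u gu; rewrite sw => -[su]; exact: IH.
Qed.

(** In degrees 0 and 1 there are no two edges to exchange. Above, the prescribed boundary alternates
    by [delta_alt] and the cone ignores the order. *)
Lemma alt_chain_alt k b : alt_at k (alt_chain k b).
Proof.
elim: k b => [|k IH] b u x y v; first by rewrite size_cat /= addnS.
case: k IH => [|k] IH; first by rewrite size_cat /= !addnS.
move=> sw; rewrite /= (@cone_mem b (u ++ y :: x :: v) (u ++ x :: y :: v)); last first.
  by move=> e; rewrite !mem_cat !inE; do !case: (_ == _).
by rewrite (@delta_alt _ k.+1 (alt_chain k.+1) IH b u x y v sw) raddfN.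
Qed.

(** Acyclic models: the difference of the two systems, corrected by the homotopies already built on
    the faces, is coned off. The systems agree in degree 0. *)
Fixpoint alt_homotopy k : pred edge -> seq edge -> chains R L k.+1 :=
  match k with
  | 0 => fun _ _ => 0
  | k'.+1 => fun b w => cone b w (edge_chain k'.+1 b w - alt_chain k'.+1 b w - delta (alt_homotopy k') b w)
  end.

Lemma alt_homotopy_on k b w : alt_homotopy k b w \in chain_on (closed_cell b w).
Proof.
elim: k b w => [|k IH] b w; first exact: rpred0.
rewrite /=; apply: cone_on; apply: rpredB.
  by apply: rpredB; [exact: edge_chain_on | exact: (alt_chain_on k.+1)].
apply: dsum_in => x u xu; apply: rpredB.
  exact: (chain_on_sub (closed_cell_face (b := b) xu)).
exact: (chain_on_sub (closed_cell_face0 (b := b) xu)).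
Qed.

Definition delta_homotopy k : pred edge -> seq edge -> chains R L k :=
  if k is k'.+1 then delta (alt_homotopy k') else fun _ _ => 0.

Lemma delta_delta_homotopy k b w : delta (delta_homotopy k) b w = 0.
Proof.
case: k => [|k]; last exact: delta_delta.
rewrite /delta (eq_dsum (G := fun _ _ => 0 - 0)); last by move=> *; rewrite /= subrr.
by rewrite dsumB subrr.
Qed.

(** The coned chain [z] has degenerate boundary: the boundaries of both systems are their faces, and
    the induction hypothesis on each face accounts for the correction. *)
Lemma bd_alt_homotopy k b w : size w = k -> good b w ->
  bd (alt_homotopy k b w) - (edge_chain k b w - alt_chain k b w - delta_homotopy k b w) \in dg.
Proof.
elim: k b w => [|k IH] b w sw gw; first by rewrite raddf0 subrr !subr0 rpred0.
set z : chains R L k.+1 := edge_chain k.+1 b w - alt_chain k.+1 b w - delta_homotopy k.+1 b w.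
have zc : z \in chain_on (closed_cell b w).
  apply: rpredB; first by apply: rpredB; [exact: edge_chain_on | exact: (alt_chain_on k.+1)].
  apply: dsum_in => x u xu; apply: rpredB.
    exact: (chain_on_sub (closed_cell_face (b := b) xu) (alt_homotopy_on _ _ _)).
  exact: (chain_on_sub (closed_cell_face0 (b := b) xu) (alt_homotopy_on _ _ _)).
apply: (bd_cone_cycle zc).
have -> : bd z = - (bd (alt_chain k.+1 b w) - delta (alt_chain k) b w) -
   (delta (fun b u => bd (alt_homotopy k b u)) b w -
    delta (fun b u => edge_chain k b u - alt_chain k b u - delta_homotopy k b u) b w).
  rewrite /z !bdB bd_edge_chain// [delta_homotopy _ _ _]/= bd_delta !deltaB delta_delta_homotopy subr0.
  exact: zmod_regroup.
rewrite rpredB ?rpredN//; first exact: bd_alt_chain.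
apply: delta_dg => // b' u gu; rewrite sw => -[su]; exact: IH.
Qed.

End CubeSystems.

(** * Signed sums over binary trees *)

Section BinaryTrees.
Implicit Types (t x y : ribbon).

Lemma binary_ind (P : ribbon -> Prop) : P Leaf ->
  (forall x y, binary x -> binary y -> P x -> P y -> P (Node [:: x; y])) ->
  forall t, binary t -> P t.
Proof.
move=> P0 PN; elim/ribbon_nested_ind => [//|ts IH] /andP[].
case: ts IH => [//|x [//|y [|//]]] IH _ /and3P[bx yb _].
by apply: PN => //; apply: IH => //; rewrite !inE eqxx ?orbT.
Qed.

Lemma binary_stable t : binary t -> stable t.
Proof. by elim/binary_ind: t / => //= x y _ _ -> ->. Qed.

(** [k] is fuel, sufficient once [n <= k] since both subtrees have fewer leaves. *)
Fixpoint brt_upto (k n : nat) : seq ribbon :=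
  if k is k'.+1 then
    if n == 1%N then [:: Leaf] else
    [seq Node [:: z.1; z.2] | z <- flatten
      [seq [seq (x, y) | x <- brt_upto k' a, y <- brt_upto k' (n - a)%N]
         | a <- iota 1 n.-1]]
  else [::].

Definition brt n := brt_upto n n.

Lemma brt_upto_in k n t : t \in brt_upto k n -> binary t /\ leaves t = n.
Proof.
elim: k n t => [//|k IH] n t /=; case: eqP => [->|n1]; first by rewrite inE => /eqP ->.
move=> /mapP[[x y] /flattenP[s /mapP[a]]].
rewrite mem_iota => /andP[a0 an] -> /allpairsP[[x' y'] /= [/IH[bx lx] /IH[yb ly] [-> ->]]] ->.
rewrite /= bx yb lx ly /= addn0 subnKC//.
by apply: (leq_trans (ltnW an)); rewrite add1n; case: (n) an => //=; rewrite ltnS leqNgt a0.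
Qed.

Lemma mem_brt_upto k n t : (n <= k)%N ->
  (t \in brt_upto k n) = binary t && (leaves t == n).
Proof.
move=> nk; apply/idP/andP => [/brt_upto_in[-> ->]//|[bt /eqP lt]].
elim: k n t nk bt lt => [|k IH] n t nk bt lt.
  by have := leaves_gt0 (binary_stable bt); rewrite lt; lia.
rewrite /=; case: eqP => [n1|n1].
  by rewrite inE; apply/eqP/edges_leaf; rewrite ?lt//; exact: binary_stable.
apply/mapP; case: t bt lt => [_ /esym/n1//|ts].
move=> /andP[]; case: ts => [//|x [//|y [|//]]] _ /and3P[bx yb _] /= lt.
have lx := leaves_gt0 (binary_stable bx); have ly := leaves_gt0 (binary_stable yb).
exists (x, y) => //; apply/flattenP.
exists [seq (x', y') | x' <- brt_upto k (leaves x), y' <- brt_upto k (n - leaves x)%N].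
  by apply/mapP; exists (leaves x) => //; rewrite mem_iota; lia.
by apply/allpairsP; exists (x, y); split=> //; apply: IH => //=; lia.
Qed.

Lemma mem_brt n t : t \in brt n = binary t && (leaves t == n).
Proof. exact: mem_brt_upto. Qed.

Lemma uniq_brt_upto k n : uniq (brt_upto k n).
Proof.
elim: k n => [//|k IH] n /=; case: eqP => // _.
rewrite map_inj_uniq; last by move=> [x y] [x' y'] /= [-> ->].
elim: (iota 1 n.-1) (iota_uniq 1 n.-1) => [//|a s IHs] /= /andP[nas us].
rewrite cat_uniq IHs// andbT allpairs_uniq//=; last by move=> [? ?] [? ?].
apply/hasPn => -[x y] /flattenP[u /mapP[c cs ->]] /allpairsP[[x' y'] /= [xc _ [-> _]]].
apply/negP => /allpairsP[[x'' y''] /= [xa _ [ex _]]].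
move: xc xa; rewrite ex => /brt_upto_in[_ e1] /brt_upto_in[_ e2].
by rewrite -e2 e1 cs in nas.
Qed.

Lemma brt_upto_eq k n : (n <= k)%N -> perm_eq (brt_upto k n) (brt n).
Proof.
move=> nk; apply: uniq_perm; [exact: uniq_brt_upto|exact: uniq_brt_upto|].
by move=> t; rewrite !mem_brt_upto.
Qed.

Lemma brt1 : brt 1 = [:: Leaf]. Proof. by []. Qed.

Lemma sum_brt (V : zmodType) n (F : ribbon -> V) : (2 <= n)%N ->
  \sum_(t <- brt n) F t =
  \sum_(1 <= a < n) \sum_(x <- brt a) \sum_(y <- brt (n - a)) F (Node [:: x; y]).
Proof.
case: n => [//|n] n2; rewrite /brt /= ifN; last by apply/eqP; lia.
rewrite big_map big_flatten big_map /index_iota /=.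
have -> : (n.+1 - 1 = n)%N by lia.
apply: eq_big_seq => a; rewrite mem_iota => an.
rewrite big_allpairs_dep/= (perm_big (brt a)) /=; last by apply: brt_upto_eq; lia.
apply: eq_bigr => x _; rewrite (perm_big (brt (n.+1 - a)))//.
by apply: brt_upto_eq; lia.
Qed.

(* The sign relating [omega_can t] to the depth-first ordering [edges t]: each
   rotation that leads down to [t] from the comb moves an edge past others. *)
Fixpoint tree_sign t : nat :=
  if t is Node [:: x; y] then (tree_sign x + tree_sign y + (leaves x).-1)%N else 0%N.

End BinaryTrees.

(** * Cancellation of the faces with a collapsed edge *)

Section InteriorFaces.
Variable V : zmodType.
Implicit Types (t x y : ribbon) (F : seq edge -> V).

Lemma vertex_edges_binary o x y :
  vertex_edges o (Node [:: x; y]) =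
  (o, (leaves x + leaves y)%N) ::
    vertex_edges o x ++ vertex_edges (o + leaves x) y.
Proof. by rewrite vertex_edges_node /= cats0 addn0. Qed.

Lemma size_vertex_edges_binary o t : binary t -> size (vertex_edges o t) = (leaves t).-1.
Proof.
move=> bt; elim/binary_ind: t / bt o => [//|x y bx yb IHx IHy] o.
rewrite vertex_edges_binary /= size_cat IHx IHy addn0.
have := leaves_gt0 (binary_stable bx); have := leaves_gt0 (binary_stable yb); lia.
Qed.

Lemma mulrz_signD (v : V) m n : v *~ (-1) ^+ m *~ (-1) ^+ n = v *~ (-1) ^+ (m + n).
Proof. by rewrite -mulrzA -exprD. Qed.

Lemma eq_mulrz_sign (v : V) m n : odd m = odd n -> v *~ (-1) ^+ m = v *~ (-1) ^+ n.
Proof. by move=> mn; rewrite -signr_odd mn signr_odd. Qed.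

Lemma sumr_mulrz (I : Type) (r : seq I) (P : pred I) (f : I -> V) (z : int) :
  (\sum_(i <- r | P i) f i) *~ z = \sum_(i <- r | P i) f i *~ z.
Proof. by elim/big_rec2: _ => [|i a b _ <-]; rewrite ?mul0rz// mulrzDl. Qed.

Definition d0 F : seq edge -> V := dsum (fun _ u => F u).

(** The root edge is included in [sumV] and removed in [sumQ], which is 0 when there is no root
    vertex. The offset [o] lets both be applied to subtrees. *)
Definition sumV n o F := \sum_(t <- brt n) F (vertex_edges o t) *~ (-1) ^+ tree_sign t.
Definition sumQ n o F :=
  if (2 <= n)%N then \sum_(t <- brt n) F (behead (vertex_edges o t)) *~ (-1) ^+ tree_sign t
  else 0.

Lemma sumQE n o F : sumQ n o F = \sum_(1 <= a < n) \sum_(x <- brt a) \sum_(y <- brt (n - a))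
  F (vertex_edges o x ++ vertex_edges (o + a) y) *~ (-1) ^+ (tree_sign x + tree_sign y + a.-1).
Proof.
rewrite /sumQ; case: ifP => n2; last by rewrite big_geq//; lia.
rewrite sum_brt//; apply: eq_bigr => a _; apply: eq_big_seq => x.
rewrite mem_brt => /andP[_ /eqP xa]; apply: eq_bigr => y _.
by rewrite vertex_edges_binary /= xa.
Qed.

(** Deleting the root edge gives the right-hand side; the other deletions keep it in front and
    cancel by hypothesis. *)
Lemma sumV_d0 n o F : sumQ n o (d0 (fun u => F ((o, n) :: u))) = 0 ->
  sumV n o (d0 F) = sumQ n o F.
Proof.
rewrite /sumV /sumQ; case: ifP => n2 Q0.
  rewrite -[RHS]subr0 -[X in _ - X]Q0 -sumrB; apply: eq_big_seq => t.
  rewrite mem_brt => /andP[bt /eqP tn]; rewrite -mulrzBl.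
  elim/binary_ind: t / bt tn => [tn|x y _ _ _ _ tn]; first by rewrite -tn in n2.
  by rewrite vertex_edges_binary /d0 /=; rewrite -tn /= addn0.
case: n n2 {Q0} => [|[|//]] _; first by rewrite /brt big_nil.
by rewrite brt1 big_seq1 mul0rz.
Qed.

(** By induction, among the deletions inside the left or right subtree only that of its root edge
    survives. The trees with root decompositions [(xy)z] and [x(yz)] then yield the same list of
    edges, with opposite signs. *)
Lemma sumQ_d0 n o F : sumQ n o (d0 F) = 0.
Proof.
elim/ltn_ind: n o F => n IH o F.
have IHV m p G : (m < n)%N -> sumV m p (d0 G) = sumQ m p G by move=> mn; exact/sumV_d0/IH.
(* The three subtrees above the contracted vertex, with [p], [q] and [r] leaves. *)
pose T3 p q r := \sum_(x <- brt p) \sum_(y <- brt q) \sum_(z <- brt r)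
  F (vertex_edges o x ++ vertex_edges (o + p) y ++ vertex_edges (o + p + q) z) *~
    (-1) ^+ (tree_sign x + tree_sign y + tree_sign z).
have e1 : sumQ n o (d0 F) =
    \sum_(1 <= a < n) (\sum_(1 <= p < a) T3 p (a - p)%N (n - a)%N *~ (-1) ^+ (a + p) +
                       \sum_(1 <= b < n - a) T3 a b (n - a - b)%N *~ (-1) ^+ b.-1).
  rewrite sumQE; apply: eq_big_nat => a /andP[a0 an].
  under eq_bigr => x _ do under eq_bigr => y _ do rewrite /d0 dsum_cat mulrzDl.
  under eq_bigr => x _ do rewrite big_split.
  rewrite big_split /=; congr (_ + _).
    rewrite exchange_big /=.
    transitivity (\sum_(y <- brt (n - a))
        sumQ a o (fun u => F (u ++ vertex_edges (o + a) y)) *~ (-1) ^+ (tree_sign y + a.-1)).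
      apply: eq_bigr => y _; rewrite -IHV// sumr_mulrz; apply: eq_bigr => x _.
      by rewrite mulrz_signD addnA.
    transitivity (\sum_(y <- brt (n - a)) \sum_(1 <= p < a) \sum_(x1 <- brt p)
       \sum_(x2 <- brt (a - p))
         F ((vertex_edges o x1 ++ vertex_edges (o + p) x2) ++ vertex_edges (o + a) y)
           *~ (-1) ^+ (tree_sign x1 + tree_sign x2 + p.-1 + (tree_sign y + a.-1))).
      apply: eq_bigr => y _; rewrite sumQE sumr_mulrz; apply: eq_bigr => p _.
      rewrite sumr_mulrz; apply: eq_bigr => x1 _.
      by rewrite sumr_mulrz; apply: eq_bigr => x2 _; rewrite mulrz_signD.
    rewrite exchange_big /=; apply: eq_big_nat => p /andP[p0 pa].
    rewrite exchange_big /T3 sumr_mulrz; apply: eq_bigr => x1 _.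
    rewrite exchange_big sumr_mulrz; apply: eq_bigr => x2 _.
    rewrite sumr_mulrz; apply: eq_bigr => y _.
    have -> : (o + p + (a - p) = o + a)%N by lia.
    rewrite catA !mulrz_signD; apply: eq_mulrz_sign.
    lia.
  transitivity (\sum_(x <- brt a)
        sumQ (n - a) (o + a) (fun v => F (vertex_edges o x ++ v)) *~ (-1) ^+ tree_sign x).
    apply: eq_big_seq => x; rewrite mem_brt => /andP[bx /eqP xa].
    rewrite -IHV; last lia. rewrite sumr_mulrz; apply: eq_bigr => y _.
    rewrite size_vertex_edges_binary// xa !mulrz_signD; apply: eq_mulrz_sign.
    lia.
  transitivity (\sum_(x <- brt a) \sum_(1 <= b < n - a) \sum_(y <- brt b)
     \sum_(z <- brt (n - a - b))
         F (vertex_edges o x ++ vertex_edges (o + a) y ++ vertex_edges (o + a + b) z)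
           *~ (-1) ^+ (tree_sign y + tree_sign z + b.-1 + tree_sign x)).
    apply: eq_bigr => x _; rewrite sumQE sumr_mulrz; apply: eq_bigr => b _.
    rewrite sumr_mulrz; apply: eq_bigr => y _.
    by rewrite sumr_mulrz; apply: eq_bigr => z _; rewrite mulrz_signD.
  rewrite exchange_big /=; apply: eq_bigr => b _.
  rewrite /T3 sumr_mulrz; apply: eq_bigr => x _.
  rewrite !sumr_mulrz; apply: eq_bigr => y _.
  rewrite !sumr_mulrz; apply: eq_bigr => z _.
  by rewrite !mulrz_signD; apply: eq_mulrz_sign; lia.
rewrite e1 big_split /=.
have -> : \sum_(1 <= a < n) \sum_(1 <= b < n - a) T3 a b (n - a - b)%N *~ (-1) ^+ b.-1 =
    \sum_(1 <= a < n) \sum_(1 <= c < n | (a < c)%N)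
       T3 a (c - a)%N (n - c)%N *~ (-1) ^+ (c - a).-1.
  apply: eq_big_nat => a /andP[a0 an].
  transitivity (\sum_(a.+1 <= c < n) T3 a (c - a)%N (n - c)%N *~ (-1) ^+ (c - a).-1);
    last by rewrite (big_nat_widenl _ 1).
  rewrite -[a.+1]add1n big_addn; apply: eq_bigr => b _.
  by rewrite addnK [in RHS]addnC subnDA.
have -> : \sum_(1 <= a < n) \sum_(1 <= p < a) T3 p (a - p)%N (n - a)%N *~ (-1) ^+ (a + p) =
    \sum_(1 <= a < n) \sum_(1 <= p < n | (p < a)%N)
       T3 p (a - p)%N (n - a)%N *~ (-1) ^+ (a + p).
  by apply: eq_big_nat => a /andP[a0 an]; rewrite (big_nat_widen 1 a n)// ltnW.
rewrite [X in X + _](exchange_big_dep_nat predT) //=.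
rewrite -big_split big1_seq//= => p _; rewrite -big_split big1_seq//= => a /andP[pa _].
(* With [p] leaves in the first subtree and [a] in the first two together, the exponents [a + p] and
   [a - p - 1] have opposite parities. *)
rewrite (_ : (a + p = (a - p).-1.+1 + 2 * p)%N); last by lia.
by rewrite exprD exprM sqrrN expr1n mulr1 exprS mulN1r mulrNz addNr.
Qed.

(* Contracting an internal edge of a binary tree creates a quaternary vertex, which
   comes from two binary trees: their contributions cancel. *)
Lemma sum_interior_faces n F :
  \sum_(t <- brt n) d0 F (edges t) *~ (-1) ^+ tree_sign t = 0.
Proof.
have := sumQ_d0 n 0 F; rewrite /sumQ; case: ifP => // n2 _.
case: n n2 => [|[|//]] _; first by rewrite /brt big_nil.
by rewrite brt1 big_seq1 mul0rz.
Qed.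

End InteriorFaces.

Arguments tgraft : simpl never.

(** * Binary trees with a prescribed edge, and the sign of a graft *)

Section BinaryGraft.
Implicit Types (t x y : ribbon).

Lemma tgraft_binary x y i t' : tgraft (Node [:: x; y]) i t' =
  if (i < leaves x)%N then Node [:: tgraft x i t'; y]
  else if (i - leaves x < leaves y)%N then Node [:: x; tgraft y (i - leaves x) t']
  else Node [:: x; y].
Proof. by rewrite tgraft_node /=; do 2?case: ifP. Qed.

Lemma mem_vertex_edges_offset a i l t : stable t ->
  ((i, l) \in vertex_edges a t) = (a <= i)%N && ((i - a, l)%N \in vertex_edges 0 t).
Proof.
move=> st; have -> : vertex_edges a t = map (shift_edge a) (vertex_edges 0 t).
  by rewrite -vertex_edges_shift add0n.
apply/mapP/andP => [[[c d] cd [-> ->]]|[ai il]]; first by rewrite leq_addl addnK.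
by exists (i - a, l)%N => //; rewrite /shift_edge /= subnK.
Qed.

(** Cutting at the edge [(i, l)] is inverse to grafting. The induction follows the splitting of the
    leaves at the root. *)
Lemma sum_brt_edge (V : zmodType) n i l (F : ribbon -> V) :
    (2 <= l)%N -> (i + l <= n)%N ->
  \sum_(t <- brt n | (i, l) \in vertex_edges 0 t) F t =
  \sum_(t1 <- brt (n + 1 - l)) \sum_(t2 <- brt l) F (tgraft t1 i t2).
Proof.
move=> l2; elim/ltn_ind: n i F => n IH i F iln.
have [ln|ln] := eqVneq l n.
  have i0 : i = 0%N by lia.
  subst l i; rewrite addnC addnK brt1 big_seq1 /=.
  rewrite big_seq_cond [RHS]big_seq; apply: eq_bigl => t.
  rewrite andb_idr// mem_brt => /andP[bt /eqP tn].
  elim/binary_ind: t / bt tn => [tn|x y _ _ _ _ tn]; first by rewrite -tn in l2.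
  by rewrite vertex_edges_binary -tn /= addn0 mem_head.
have ln' : (l < n)%N by lia.
rewrite big_mkcond /= [LHS]sum_brt; last lia.
rewrite [RHS]sum_brt; last lia.
pose G a : V := \sum_(x <- brt a) \sum_(y <- brt (n - a))
  (if (i, l) \in vertex_edges 0 (Node [:: x; y]) then F (Node [:: x; y]) else 0).
pose G1 a : V := \sum_(x <- brt a) \sum_(y <- brt (n - a + 1 - l)) \sum_(t <- brt l)
  F (Node [:: x; tgraft y (i - a) t]).
pose G2 a : V := \sum_(x <- brt (a + 1 - l)) \sum_(y <- brt (n - a)) \sum_(t <- brt l)
  F (Node [:: tgraft x i t; y]).
have mem_node a x y : x \in brt a -> y \in brt (n - a) -> (1 <= a < n)%N ->
    ((i, l) \in vertex_edges 0 (Node [:: x; y])) =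
    ((i, l) \in vertex_edges 0 x) || (a <= i)%N && ((i - a, l)%N \in vertex_edges 0 y).
  rewrite !mem_brt => /andP[bx /eqP xa] /andP[yb /eqP ya] an.
  rewrite vertex_edges_binary inE mem_cat add0n -mem_vertex_edges_offset; last exact: binary_stable.
  by rewrite xa ya; case: eqP => //= -[_]; lia.
have xin a x : x \in brt a -> (i, l) \in vertex_edges 0 x -> (i + l <= a)%N.
  by rewrite mem_brt => /andP[bx /eqP <-] /(vertex_edges_in (binary_stable bx))[].
have E1 a : (1 <= a < n)%N -> (a <= i)%N -> G a = G1 a.
  move=> an ai; apply: eq_big_seq => x xa.
  transitivity (\sum_(y <- brt (n - a) | (i - a, l)%N \in vertex_edges 0 y) F (Node [:: x; y])).
    rewrite [RHS]big_mkcond; apply: eq_big_seq => y ya; rewrite (mem_node a)// ai /=.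
    case: (boolP ((i, l) \in vertex_edges 0 x)) => //= /(xin _ _ xa); lia.
  by rewrite (IH (n - a)%N) //; lia.
have E2 a : (1 <= a < n)%N -> (i < a)%N -> (i + l <= a)%N -> G a = G2 a.
  move=> an ia ila; rewrite /G exchange_big /G2 [RHS]exchange_big; apply: eq_big_seq => y ya.
  transitivity (\sum_(x <- brt a | (i, l) \in vertex_edges 0 x) F (Node [:: x; y])).
    rewrite [RHS]big_mkcond; apply: eq_big_seq => x xa; rewrite (mem_node a)//.
    by rewrite [(a <= i)%N]leqNgt ia /= orbF.
  by rewrite (IH a) //; lia.
have E3 a : (1 <= a < n)%N -> (i < a)%N -> (a < i + l)%N -> G a = 0.
  move=> an ia ail; rewrite /G big_seq big1// => x xa; rewrite big_seq big1// => y ya.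
  rewrite (mem_node a)// [(a <= i)%N]leqNgt ia /= orbF.
  by case: ifP => // /(xin _ _ xa); lia.
(* Let [a] be the number of leaves on the left of the root. The edge lies in the right subtree if
   [a <= i], in the left one if [i + l <= a], and cannot exist in between. *)
rewrite -[LHS]/(\sum_(1 <= a < n) G a).
rewrite (@big_cat_nat _ _ _ i.+1)/=; [|lia|lia].
rewrite (@big_cat_nat _ _ _ (i + l)%N i.+1)/=; [|lia|lia].
rewrite [X in _ + (X + _)]big1_seq ?add0r; last first.
  by move=> a; rewrite mem_index_iota => /andP[_ an]; rewrite E3//; lia.
rewrite [RHS](@big_cat_nat _ _ _ i.+1)/=; [|lia|lia].
congr (_ + _).
  apply: eq_big_nat => a ai; rewrite E1; [|lia|lia].
  apply: eq_big_seq => x; rewrite mem_brt => /andP[_ /eqP xa].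
  have -> : (n - a + 1 - l = n + 1 - l - a)%N by lia.
  apply: eq_big_seq => y; rewrite mem_brt => /andP[_ /eqP ya].
  apply: eq_bigr => t _; rewrite tgraft_binary xa ya ifF; last by lia.
  by rewrite ifT//; lia.
rewrite (_ : (i + l = i.+1 + (l - 1))%N); last by lia.
transitivity (\sum_(i.+1 + (l - 1) <= a < n) G2 a).
  by apply: eq_big_nat => a ai; rewrite E2//; lia.
rewrite big_addn (_ : (n - (l - 1) = n + 1 - l)%N); last by lia.
apply: eq_big_nat => c ci; rewrite /G2.
rewrite (_ : (c + (l - 1) + 1 - l = c)%N); last by lia.
rewrite (_ : (n - (c + (l - 1)) = n + 1 - l - c)%N); last by lia.
apply: eq_big_seq => x; rewrite mem_brt => /andP[_ /eqP xa].
apply: eq_bigr => y _; apply: eq_bigr => t _.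
by rewrite tgraft_binary ifT//; lia.
Qed.

(** The number of vertices having the leaf [i] above their left input. *)
Fixpoint left_count t (i : nat) : nat :=
  if t is Node [:: x; y] then
    (if (i < leaves x)%N then (left_count x i).+1 else left_count y (i - leaves x)%N)
  else 0%N.

(** Grafting adds [leaves t' - 1] leaves above the left input of exactly the vertices counted by
    [left_count]. *)
Lemma tree_sign_tgraft t i t' : binary t -> stable t' -> (i < leaves t)%N ->
  tree_sign (tgraft t i t') = (tree_sign t + tree_sign t' + left_count t i * (leaves t').-1)%N.
Proof.
move=> bt st'; have lt' := leaves_gt0 st'.
elim/binary_ind: t / bt i => [|x y bx yb IHx IHy] i.
  by move=> _; rewrite mul0n addn0 add0n.
have lx := leaves_gt0 (binary_stable bx); have ly := leaves_gt0 (binary_stable yb).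
rewrite [leaves _]/= addn0 tgraft_binary => il; case: ifP => ix.
  by rewrite /= ix IHx//; have := leaves_tgraft t' ix; lia.
rewrite ifT /=; last by lia.
by rewrite ix IHy; lia.
Qed.

(* In-order, the vertices to the right of the leaf [i] are those having [i] above
   their left input and those all of whose leaves are to the right of [i]. *)
Lemma left_count_right t i : binary t -> (i < leaves t)%N ->
  (left_count t i + count (fun e : edge => i < e.1)%N (vertex_edges 0 t) + i).+1 = leaves t.
Proof.
move=> bt; elim/binary_ind: t / bt i => [[|i]//|x y bx yb IHx IHy] i.
have sx := binary_stable bx; have sy := binary_stable yb.
have lx := leaves_gt0 sx; have ly := leaves_gt0 sy.
rewrite vertex_edges_binary /= count_cat addn0 => il.
have ey : vertex_edges (0 + leaves x) y = map (shift_edge (leaves x)) (vertex_edges 0 y).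
  by rewrite -vertex_edges_shift.
case: ifP => ix.
  have -> : count (fun e : edge => i < e.1)%N (vertex_edges (0 + leaves x) y) = (leaves y).-1.
    rewrite -(size_vertex_edges_binary 0 yb) ey count_map.
    by apply/eqP; rewrite -all_count; apply/allP => e _ /=; lia.
  by have := IHx i ix; lia.
have -> : count (fun e : edge => i < e.1)%N (vertex_edges 0 x) = 0%N.
  apply/eqP; rewrite -leqn0 leqNgt -has_count; apply/hasPn => e.
  by move=> /(vertex_edges_in sx)[]; lia.
rewrite ey count_map add0n; have := IHy (i - leaves x)%N ltac:(lia).
rewrite (@eq_count _ (preim (shift_edge (leaves x)) (fun e : edge => i < e.1)%N)
  (fun e : edge => i - leaves x < e.1)%N); first by lia.
by move=> e /=; lia.
Qed.

End BinaryGraft.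

Arguments vertex_edges : simpl never.

(** * Canonical orientations *)

Section CanonicalOrientation.
Implicit Types (t x y : ribbon) (e : edge).

(** In depth-first order the rotation moves its edge in front of the [leaves t1 - 1] vertices of the
    subtree [t1], while [tree_sign] grows by [leaves t1]. The successor in the parity is the sign of
    the covering relation. *)
Lemma rotation_spec o t t' e e' : rotation o t t' e e' -> binary t ->
  [/\ binary t', leaves t' = leaves t &
      exists u v w, [/\ vertex_edges o t = (o, leaves t) :: u ++ v ++ e :: w,
        vertex_edges o t' = (o, leaves t) :: u ++ e' :: v ++ w &
        odd (tree_sign t' + size v).+1 = odd (tree_sign t)]].
Proof.
elim=> {t t' e e' o} [ o t1 t2 t3| o t t' s e e' _ IH| o t t' s e e' _ IH].
- rewrite /= !andbT => /and3P[b1 b2 b3]; rewrite b1 b2 b3; split=> //; first by lia.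
  exists [::], (vertex_edges o t1), (vertex_edges (o + leaves t1) t2 ++
    vertex_edges (o + leaves t1 + leaves t2) t3).
  rewrite !vertex_edges_binary /= !addn0 -!catA !addnA; split=> //.
  rewrite size_vertex_edges_binary//.
  by have := leaves_gt0 (binary_stable b1); have := leaves_gt0 (binary_stable b2); lia.
- move=> /= /and3P[bt bs _]; have [bt' lt' [u [v [w [e1 e2 e3]]]]] := IH bt.
  rewrite bt' bs lt'; split=> //.
  exists ((o, leaves t) :: u), v, (w ++ vertex_edges (o + leaves t) s).
  rewrite !vertex_edges_binary e1 e2 lt' /= !addn0 -?catA /= -?catA; split=> //; lia.
- move=> /= /and3P[bs bt _]; have [bt' lt' [u [v [w [e1 e2 e3]]]]] := IH bt.
  rewrite bt' bs lt'; split=> //.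
  exists (vertex_edges o s ++ (o + leaves s, leaves t)%N :: u), v, w.
  rewrite !vertex_edges_binary e1 e2 lt' /= !addn0 -?catA /= -?catA; split=> //; lia.
Qed.

Lemma right_combS n : right_comb n.+2 = Node [:: Leaf; right_comb n.+1].
Proof. by []. Qed.

Lemma right_comb_spec n : [/\ binary (right_comb n.+1), leaves (right_comb n.+1) = n.+1,
  tree_sign (right_comb n.+1) = 0%N &
  forall o, vertex_edges o (right_comb n.+1) = [seq (o + a, n.+1 - a)%N | a <- iota 0 n]].
Proof.
elim: n => [|n [h1 h2 h3 h4]]; first by split.
rewrite right_combS; split=> [|||o]; first by rewrite /= h1.
- by rewrite /= h2 addn0.
- by rewrite /= h3.
rewrite vertex_edges_binary h2 /= h4 addn0 subn0; congr cons.
rewrite -[1%N]addn0 iotaDl -map_comp; apply: eq_map => a /=.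
by congr pair; lia.
Qed.

(** Equality up to even permutation is expressed by testing against all alternating functions, so no
    parity of a permutation has to be computed. *)
Lemma canonical_spec t w : Defs.canonical t w ->
  [/\ binary t, (2 <= leaves t)%N, perm_eq w.2 (edges t) &
   forall (V : zmodType) (F : seq edge -> V), alt_at (leaves t - 2) F ->
     F w.2 *~ (-1) ^+ w.1 = F (edges t) *~ (-1) ^+ tree_sign t].
Proof.
elim=> {t w} [n n2|t t' e e' [s w] _ [bt lt pw IH] rot].
  case: n n2 => [|[|n]] // _; have [h1 h2 h3 h4] := right_comb_spec n.+1.
  have ee : edges (right_comb n.+2) = [seq (a, n.+2 - a)%N | a <- iota 1 (n.+2 - 2)].
    by rewrite /edges h4 !subSS subn0.
  rewrite ee h1 h2 h3; split=> //= V F _.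
have [bt' lt' [u [v [w' [e1 e2 e3]]]]] := rotation_spec rot bt.
have et : edges t = u ++ v ++ e :: w' by rewrite /edges e1.
have et' : edges t' = u ++ e' :: v ++ w' by rewrite /edges e2.
pose f := (fun x : edge => if x == e then e' else x).
have [nu [nv nw]] : e \notin u /\ e \notin v /\ e \notin w'.
  have := edges_uniq (binary_stable bt); rewrite et catA cat_uniq => /and3P[_ /hasPn hh].
  move=> /= /andP[nw _]; have := hh e (mem_head _ _); rewrite /= mem_cat negb_or => /andP[-> ->].
  by rewrite nw.
have fid s' : e \notin s' -> map f s' = s'.
  move=> ns; rewrite -[RHS]map_id; apply/eq_in_map => x xs; rewrite /f.
  by case: eqP => // xe; rewrite -xe xs in ns.
have fet : map f (edges t) = u ++ v ++ e' :: w'.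
  by rewrite et !map_cat /= !fid// /f eqxx.
rewrite bt' lt' lt; split=> //=.
  rewrite et' -/f; apply: perm_trans (perm_map f pw) _; rewrite fet.
  by rewrite perm_cat2l -cat1s perm_catCA.
(* Absorbing the renaming of [e] into [F] makes the induction hypothesis for [t] applicable. *)
move=> V F aF; have aFf : alt_at (leaves t - 2) (fun s => F (map f s)).
  move=> a x y b sab; rewrite !map_cat /=; apply: aF.
  by rewrite -sab !size_cat /= !size_map.
have sz : size (edges t') = (leaves t - 2)%N.
  by rewrite -lt' /edges size_behead size_vertex_edges_binary//; lia.
have {IH} := IH V _ aFf; rewrite /= -/f fet => IH.
have h : F (u ++ e' :: v ++ w') = F (u ++ v ++ e' :: w') *~ (-1) ^+ size v.
  by apply: (alt_move aF); rewrite -et'.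
rewrite et' h mulrz_signD.
have -> : F (map f w) = F (u ++ v ++ e' :: w') *~ (-1) ^+ (tree_sign t + s).
  by rewrite -mulrz_signD -IH mulrz_signD addnn -signr_odd odd_double mulr1z.
rewrite mulrz_signD; apply: eq_mulrz_sign.
by move: e3; case: (s); lia.
Qed.

(** The comb rotates to a root carrying two smaller combs, which then rotate independently to the
    two subtrees of [t]. *)
Lemma canonical_exists t : binary t -> (2 <= leaves t)%N -> exists w, Defs.canonical t w.
Proof.
(* Reflexive transitive closure of rotation, in impredicative form, at the offset [o]. *)
pose reach o t t' := forall P : ribbon -> Prop, P t ->
  (forall x y e e', P x -> rotation o x y e e' -> P y) -> P t'.
have reach_refl o t1 : reach o t1 t1 by move=> P Pt _.
have reach_trans o t1 t2 t3 : reach o t1 t2 -> reach o t2 t3 -> reach o t1 t3.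
  by move=> r1 r2 P P1 PS; apply: r2 => //; apply: r1.
have reach_step o t1 t2 e e' : rotation o t1 t2 e e' -> reach o t1 t2.
  by move=> r P P1 PS; apply: PS r.
have reach_left o t1 t2 s : reach o t1 t2 -> reach o (Node [:: t1; s]) (Node [:: t2; s]).
  move=> r; apply: (r (fun t2 => reach o (Node [:: t1; s]) (Node [:: t2; s]))) => // x y e e' rx xy.
  by apply: reach_trans rx _; apply: reach_step; exact: rotation_left xy.
have reach_right o t1 t2 s : reach (o + leaves s)%N t1 t2 ->
    reach o (Node [:: s; t1]) (Node [:: s; t2]).
  move=> r; apply: (r (fun t2 => reach o (Node [:: s; t1]) (Node [:: s; t2]))) => // x y e e' rx xy.
  by apply: reach_trans rx _; apply: reach_step; exact: rotation_right xy.
have comb_node p q o :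
    reach o (right_comb (p.+1 + q.+1)) (Node [:: right_comb p.+1; right_comb q.+1]).
  elim: p o => [|p IH] o //.
  apply: reach_trans (reach_right o _ _ Leaf (IH _)) _.
  by apply: reach_step; exact: rotation_root.
have comb_reach t1 : binary t1 -> forall o, reach o (right_comb (leaves t1)) t1.
  elim/binary_ind => {t1} [ o //|x y bx yb IHx IHy o].
  have := leaves_gt0 (binary_stable bx); have := leaves_gt0 (binary_stable yb).
  rewrite /= addn0; case lx : (leaves x) => [|p] //; case ly : (leaves y) => [|q] // _ _.
  apply: (reach_trans o _ _ _ (comb_node p q o)).
  apply: (reach_trans o _ (Node [:: x; right_comb q.+1])) .
    by apply: reach_left; rewrite -lx.
  by apply: reach_right; rewrite -ly.
move=> bt lt; apply: (comb_reach t bt 0%N (fun t => exists w, Defs.canonical t w)).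
  by eexists; exact: canonical_comb.
by move=> x y e e' [w cw] xy; eexists; exact: canonical_step cw xy.
Qed.

Lemma omega_can_spec t : binary t -> (2 <= leaves t)%N ->
  perm_eq (omega_can t).2 (edges t) /\
  forall (V : zmodType) (F : seq edge -> V), alt_at (leaves t - 2) F ->
     F (omega_can t).2 *~ (-1) ^+ (omega_can t).1 = F (edges t) *~ (-1) ^+ tree_sign t.
Proof.
move=> bt lt; have [w cw] := canonical_exists bt lt.
have : Defs.canonical t (omega_can t) by rewrite /omega_can; apply: xgetPex; exists w.
by move=> /canonical_spec[].
Qed.

End CanonicalOrientation.

(** * Free operads *)

Section Transport.
Variable O : operad_data.

Lemma transport_id n k (x : op O n k) : transport x = x.
Proof. by rewrite /transport; case: eqP => // e; rewrite eq_axiomK. Qed.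

Lemma transport_neq n k n' k' (x : op O n k) :
  (n, k) != (n', k') -> transport x = 0 :> op O n' k'.
Proof. by rewrite /transport; case: eqP. Qed.

Lemma transportB n k n' k' (x y : op O n k) :
  transport (x - y) = transport x - transport y :> op O n' k'.
Proof.
have [[en ek]|ne] := eqVneq (n, k) (n', k'); last by rewrite !transport_neq// subr0.
by subst n' k'; rewrite !transport_id.
Qed.

HB.instance Definition _ n k n' k' :=
  GRing.isZmodMorphism.Build (op O n k) (op O n' k') (@transport O n k n' k')
    (@transportB n k n' k').

End Transport.

Lemma map_transport (O P : operad_data) (f : forall n k, op O n k -> op P n k) :
  (forall n k, f n k 0 = 0) -> forall n k n' k' (x : op O n k),
  f n' k' (transport x) = transport (f n k x).
Proof.
move=> f0 n k n' k' x; have [[en ek]|ne] := eqVneq (n, k) (n', k').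
  by subst n' k'; rewrite !transport_id.
by rewrite !transport_neq.
Qed.

Section SubZmodule.
Variables (V : zmodType) (S : zmodClosed V).
Record sub_zmod := SubZmod { sub_zmod_val : V; _ : sub_zmod_val \in S }.
HB.instance Definition _ := [isSub for sub_zmod_val].
HB.instance Definition _ := [Choice of sub_zmod by <:].
HB.instance Definition _ := [SubChoice_isSubZmodule of sub_zmod by <:].
End SubZmodule.

Section OperadMorphism.
Variables (O P : operad_data) (f : forall n k, op O n k -> op P n k).
Hypothesis fP : is_operad_mor (@f).

Lemma operad_morB n k : zmod_morphism (@f n k).
Proof. by move=> x y; have [h _ _] := fP; exact: h. Qed.

Lemma operad_mor0 n k : @f n k 0 = 0.
Proof. by rewrite -[X in @f _ _ X](subrr 0) operad_morB subrr. Qed.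

Lemma operad_mor_sum n k (I : Type) (r : seq I) (Q : pred I) (F : I -> op O n k) :
  @f n k (\sum_(i <- r | Q i) F i) = \sum_(i <- r | Q i) @f n k (F i).
Proof.
pose fM := GRing.isZmodMorphism.Build _ _ (@f n k) (@operad_morB n k).
pose f' : {additive op O n k -> op P n k} := HB.pack (@f n k) fM.
exact: (raddf_sum f').
Qed.

Lemma operad_morN n k x : @f n k (- x) = - @f n k x.
Proof. by rewrite -sub0r operad_morB operad_mor0 sub0r. Qed.

Lemma operad_morMz n k x (z : int) : @f n k (x *~ z) = @f n k x *~ z.
Proof.
pose fM := GRing.isZmodMorphism.Build _ _ (@f n k) (@operad_morB n k).
pose f' : {additive op O n k -> op P n k} := HB.pack (@f n k) fM.
exact: (raddfMz f').
Qed.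

Lemma operad_mor_transport n k n' k' (x : op O n k) :
  @f n' k' (transport x) = transport (@f n k x).
Proof. exact/map_transport/operad_mor0. Qed.

End OperadMorphism.

Section FreeOperad.
Variables (A : operad_data) (m : forall n, op A n (n - 2)).
Hypothesis A_operad : is_operad A.
Hypothesis A_free : is_free_on m.

Lemma ocompBl i M n p q (x x' : op A M p) (y : op A n q) : (i < M)%N ->
  ocomp i (x - x') y = ocomp i x y - ocomp i x' y.
Proof. by case: A_operad => h _ _ _ _ iM; case: (h _ _ _ _ _ x x' y y iM). Qed.

Lemma ocompBr i M n p q (x : op A M p) (y y' : op A n q) : (i < M)%N ->
  ocomp i x (y - y') = ocomp i x y - ocomp i x y'.
Proof. by case: A_operad => h _ _ _ _ iM; case: (h _ _ _ _ _ x x y y' iM). Qed.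

Lemma ocomp0l i M n p q (y : op A n q) : (i < M)%N -> ocomp i (0 : op A M p) y = 0.
Proof. by move=> iM; rewrite -[X in ocomp _ X _](subrr 0) ocompBl// subrr. Qed.

Lemma ocomp0r i M n p q (x : op A M p) : (i < M)%N -> ocomp i x (0 : op A n q) = 0.
Proof. by move=> iM; rewrite -[X in ocomp _ _ X](subrr 0) ocompBr// subrr. Qed.

Lemma ocompMzl i M n p q (x : op A M p) (y : op A n q) (z : int) : (i < M)%N ->
  ocomp i (x *~ z) y = ocomp i x y *~ z.
Proof.
move=> iM; pose f (x : op A M p) := ocomp i x y.
have fB : zmod_morphism f by move=> a b; exact: ocompBl.
pose fM := GRing.isZmodMorphism.Build _ _ f fB.
pose f' : {additive op A M p -> op A (M + n).-1 (p + q)} := HB.pack f fM.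
exact: (raddfMz f').
Qed.

Lemma ocompMzr i M n p q (x : op A M p) (y : op A n q) (z : int) : (i < M)%N ->
  ocomp i x (y *~ z) = ocomp i x y *~ z.
Proof.
move=> iM; pose f (y : op A n q) := ocomp i x y.
have fB : zmod_morphism f by move=> a b; exact: ocompBr.
pose fM := GRing.isZmodMorphism.Build _ _ f fB.
pose f' : {additive op A n q -> op A (M + n).-1 (p + q)} := HB.pack f fM.
exact: (raddfMz f').
Qed.

(* These elements form a suboperad containing the generators, hence everything,
   since [A] is free: this computes [A] in the degrees [k >= n - 2]. *)
Definition top_spanned n k : {pred op A n k} := fun x =>
  `[< ((n <= 1)%N -> exists z : int, x = transport (@ounit A) *~ z) /\
      ((2 <= n)%N -> (n - 2 <= k)%N -> exists z : int, x = transport (m n) *~ z) >].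

Fact top_spanned_closed n k : zmod_closed (@top_spanned n k).
Proof.
split=> [|x y /asboolP[x1 x2] /asboolP[y1 y2]]; apply/asboolP; split.
- by exists 0; rewrite mulr0z.
- by exists 0; rewrite mulr0z.
- by move=> h; have [a ->] := x1 h; have [b ->] := y1 h; exists (a - b); rewrite mulrzBr.
- by move=> h k'; have [a ->] := x2 h k'; have [b ->] := y2 h k'; exists (a - b); rewrite mulrzBr.
Qed.
HB.instance Definition _ n k := GRing.isZmodClosed.Build (op A n k) (@top_spanned n k)
  (@top_spanned_closed n k).

Lemma top_spanned_transport n k n' k' (x : op A n k) :
  (n, k) = (n', k') -> transport x \in @top_spanned n' k' -> x \in @top_spanned n k.
Proof. by move=> [en ek]; case: _ / en; case: _ / ek; rewrite transport_id. Qed.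

Lemma top_spanned_ocomp i M n p q (x : op A M p) (y : op A n q) : (i < M)%N ->
  x \in @top_spanned M p -> y \in @top_spanned n q ->
  ocomp i x y \in @top_spanned (M + n).-1 (p + q).
Proof.
move=> iM /[dup] xS /asboolP[x1 x2] /[dup] yS /asboolP[y1 y2].
have [_ unitl unitr _ _] := A_operad.
have [M1|M2] := leqP M 1.
  have eM : M = 1%N by lia. have ei : i = 0%N by lia.
  have {x1}[z xz] := x1 M1; subst M i.
  have [p0|pn] := eqVneq p 0%N; last first.
    by rewrite xz transport_neq ?mul0rz ?ocomp0l ?rpred0// xpair_eqE eqxx eq_sym.
  subst p; rewrite xz transport_id ocompMzl// rpredMz//.
  by have := unitl _ _ y; rewrite transport_id => ->.
have [n1|n2] := leqP n 1.
  have {y1}[z yz] := y1 n1.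
  have [e|ne] := eqVneq (1%N, 0%N) (n, q); last first.
    by rewrite yz transport_neq// mul0rz ocomp0r// rpred0.
  case: e yz => en eq; subst n q; rewrite transport_id => yz.
  apply: (@top_spanned_transport _ _ M p); first by congr pair; lia.
  by rewrite yz ocompMzr// raddfMz rpredMz//= unitr.
apply/asboolP; split; first by lia.
(* From [M + n - 3 <= p + q] one factor has degree above the top one for its arity. It is then a
   multiple of a transport between different degrees, that is 0. *)
move=> _ hk; exists 0; rewrite mulr0z.
have [hp|hp] := ltnP (M - 2) p.
  have [z ->] := x2 M2 (ltnW hp).
  by rewrite transport_neq ?mul0rz ?ocomp0l// xpair_eqE eqxx /=; lia.
have hq : (n - 2 < q)%N by lia.
have [z ->] := y2 n2 (ltnW hq).
by rewrite transport_neq ?mul0rz ?ocomp0r// xpair_eqE eqxx /=; lia.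
Qed.

Lemma ounit_top_spanned : @ounit A \in @top_spanned 1 0.
Proof. by apply/asboolP; split=> // _; exists 1; rewrite transport_id. Qed.

(** Composites are known to stay in the subgroups only at inputs [i < M]; elsewhere [insubd]
    supplies 0. *)
Definition top_operad : operad_data :=
  @OperadData (fun n k => sub_zmod (@top_spanned n k))
    (SubZmod ounit_top_spanned)
    (fun M n p q i x y => insubd 0 (ocomp i (val x) (val y))).

Lemma val_top_ocomp i M n p q (x : op top_operad M p) (y : op top_operad n q) :
  (i < M)%N -> val (ocomp i x y) = ocomp i (val x) (val y).
Proof. by move=> iM; rewrite insubdK//; apply: top_spanned_ocomp => //; exact: valP. Qed.

Lemma val_topB n k (x y : op top_operad n k) : val (x - y) = val x - val y.
Proof. exact: (raddfB (val : sub_zmod (@top_spanned n k) -> op A n k)). Qed.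

Lemma val_topMz n k (x : op top_operad n k) (z : int) : val (x *~ z) = val x *~ z.
Proof. exact: (raddfMz (val : sub_zmod (@top_spanned n k) -> op A n k)). Qed.

Lemma val_top_transport n k n' k' (x : op top_operad n k) :
  val (transport x : op top_operad n' k') = transport (val x).
Proof. exact: (@map_transport top_operad A (fun n k => val)). Qed.

Lemma top_operadP : is_operad top_operad.
Proof.
have [_ u1 u2 a1 a2] := A_operad.
split.
- move=> M n p q i x x' y y' iM; split; apply: val_inj.
    by rewrite val_topB !val_top_ocomp// val_topB ocompBl.
  by rewrite val_topB !val_top_ocomp// val_topB ocompBr.
- by move=> n k x; apply: val_inj; rewrite val_top_transport val_top_ocomp//=.
- by move=> n k x i iM; apply: val_inj; rewrite val_top_transport val_top_ocomp//= u2.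
- move=> l M n p q r i j x y z il jM; apply: val_inj.
  by rewrite val_top_transport !val_top_ocomp//=; [exact: a1 | lia].
- move=> l M n p q r i j x y z ijl; apply: val_inj.
  rewrite val_top_transport val_topMz !val_top_ocomp//=; [exact: a2 | lia..].
Qed.

(** Freeness gives a morphism to the suboperad fixing the generators; followed by the inclusion it
    is the identity, by uniqueness. *)
Lemma free_top_span n (x : op A n (n - 2)) : (2 <= n)%N -> exists z : int, x = m n *~ z.
Proof.
move=> n2.
have mS k : (2 <= k)%N -> m k \in @top_spanned k (k - 2).
  by move=> k2; apply/asboolP; split; [lia | exists 1; rewrite transport_id].
pose p k : op top_operad k (k - 2) := insubd 0 (m k).
have [[f f_mor fm] _] := A_free p top_operadP.
have [_ A_uniq] := A_free m A_operad.
pose g n k (x : op A n k) : op A n k := val (f n k x).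
have g_mor : is_operad_mor g.
  have [fB f1 fo] := f_mor; split=> [? ? ? ?||M' n' ? ? i ? ? iM].
  - by rewrite /g fB val_topB.
  - by rewrite /g f1.
  - by rewrite /g fo// val_top_ocomp.
have gid : g n (n - 2)%N x = x.
  apply: (A_uniq g (fun n k x => x)) => // k k2.
  by rewrite /g fm// insubdK//; exact: mS.
have /asboolP[_ /(_ n2 (leqnn _))[z xz]] := valP (f n (n - 2)%N x).
by exists z; rewrite -{1}gid /g xz transport_id.
Qed.

End FreeOperad.

(** * An operad detecting one term of the A-infinity equation *)

Section TestOperad.
Variable N : nat.
Hypothesis N3 : (3 <= N)%N.

(* All composites of two elements of arity at least 2 vanish, except that of the
   binary generator with the generator of arity [N - 1] at its first input: a
   morphism to this operad reads off one coefficient of the boundary of [m N]. *)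
Definition test_comp (M p i n q : nat) : bool :=
  [|| (M == 1%N) && (p == 0%N), (n == 1%N) && (q == 0%N) |
      [&& M == 2%N, p == 0%N, i == 0%N, n == N.-1 & q == (N - 3)%N]].

Definition test_operad : operad_data :=
  @OperadData (fun _ _ => int : zmodType) (1 : int)
    (fun M n p q i (x y : int) => if test_comp M p i n q then x * y else 0).

Lemma test_transport n k n' k' (x : op test_operad n k) : (n, k) = (n', k') ->
  (transport x : op test_operad n' k') = x :> int.
Proof. by move=> [en ek]; subst n' k'; rewrite transport_id. Qed.

Lemma test_unitl i n q : test_comp 1 0 i n q. Proof. by []. Qed.

Lemma test_unitr M p i : test_comp M p i 1 0. Proof. by rewrite /test_comp orbT. Qed.

Definition test_special (M p i n q : nat) : bool :=
  [&& M == 2%N, p == 0%N, i == 0%N, n == N.-1 & q == (N - 3)%N].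

Lemma test_special_or M p i n q : ~~ ((M == 1%N) && (p == 0%N)) ->
  ~~ ((n == 1%N) && (q == 0%N)) -> test_comp M p i n q = test_special M p i n q.
Proof. by rewrite /test_comp => /negPf -> /negPf ->. Qed.

(** The special composite has arity [N >= 3], and an element of that arity composes to nonzero only
    with the unit. *)
Lemma test_special_comp l p i M q j n r : (i < l)%N ->
  ~~ ((n == 1%N) && (r == 0%N)) ->
  test_special l p i M q && test_comp (l + M).-1 (p + q) j n r = false.
Proof.
move=> il u; apply/negP => /andP[/and5P[/eqP -> /eqP -> _ /eqP -> /eqP ->]].
by rewrite /test_comp (negPf u) /=; lia.
Qed.

Lemma test_comp_assoc l M n p q r i j : (i < l)%N -> (j < M)%N ->
  test_comp l p i M q && test_comp (l + M).-1 (p + q) (i + j) n r =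
  test_comp M q j n r && test_comp l p i (M + n).-1 (q + r).
Proof.
move=> il jM.
have [/andP[/eqP e1 /eqP e2]|u1] := boolP ((l == 1%N) && (p == 0%N)).
  subst l p; have -> : i = 0%N by lia.
  by rewrite !test_unitl !add0n add1n andbT.
have [/andP[/eqP e1 /eqP e2]|u2] := boolP ((M == 1%N) && (q == 0%N)).
  subst M q; have -> : j = 0%N by lia.
  by rewrite test_unitl test_unitr !addn0 addn1 add1n add0n.
have [/andP[/eqP e1 /eqP e2]|u3] := boolP ((n == 1%N) && (r == 0%N)).
  by subst n r; rewrite !test_unitr !addn0 addn1 andbT.
rewrite (test_special_or _ u1 u2) (test_special_or _ u2 u3) test_special_comp//.
apply/esym/negP => /andP[/and5P[/eqP -> /eqP -> /eqP ej /eqP -> /eqP ->]].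
by rewrite /test_comp (negPf u1) /=; lia.
Qed.

Lemma test_comp_par l M n p q r i j : (i < j < l)%N ->
  test_comp l p i M q && test_comp (l + M).-1 (p + q) (j + M).-1 n r =
  test_comp l p j n r && test_comp (l + n).-1 (p + r) i M q.
Proof.
move=> ijl.
have u1 : ~~ ((l == 1%N) && (p == 0%N)) by lia.
have [/andP[/eqP e1 /eqP e2]|u2] := boolP ((M == 1%N) && (q == 0%N)).
  by subst M q; rewrite !test_unitr !addn0 !addn1 andbT.
have [/andP[/eqP e1 /eqP e2]|u3] := boolP ((n == 1%N) && (r == 0%N)).
  by subst n r; rewrite !test_unitr !addn0 !addn1 andbT.
rewrite (test_special_or _ u1 u2) (test_special_or _ u1 u3).
by rewrite !test_special_comp//; lia.
Qed.

(** Hence the Koszul sign is trivial whenever a parallel composite is nonzero. *)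
Lemma test_comp_par0 l M n p q r i j : (i < j < l)%N -> q != 0%N -> r != 0%N ->
  test_comp l p i M q && test_comp (l + M).-1 (p + q) (j + M).-1 n r = false.
Proof.
move=> ijl q0 r0; rewrite test_special_or; [|lia..].
by rewrite test_special_comp//; lia.
Qed.

Lemma test_operadP : is_operad test_operad.
Proof.
split.
- move=> M n p q i x x' y y' iM; rewrite /=.
  by case: ifP => _; rewrite ?subrr// mulrBl mulrBr.
- by move=> n k x; rewrite test_transport//= mul1r.
- move=> n k i x iM; rewrite test_transport; last by congr pair; lia.
  by rewrite /= /test_comp /= orbT mulr1.
- move=> l M n p q r i j x y z il jM; rewrite test_transport; last by congr pair; lia.
  have e : test_comp l p i M q && test_comp (l + M).-1 (p + q) (i + j) n r =
      test_comp M q j n r && test_comp l p i (M + n).-1 (q + r).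
    exact: test_comp_assoc.
  rewrite /=; move: e; do 4!case: (test_comp _ _ _ _ _); rewrite ?mul0r ?mulr0 ?mulrA//.
- move=> l M n p q r i j x y z ijl; rewrite test_transport; last by congr pair; lia.
  have e : test_comp l p i M q && test_comp (l + M).-1 (p + q) (j + M).-1 n r =
      test_comp l p j n r && test_comp (l + n).-1 (p + r) i M q.
    exact: test_comp_par.
  have s : test_comp l p i M q && test_comp (l + M).-1 (p + q) (j + M).-1 n r ->
      (q * r = 0)%N.
    have [->|q0] := eqVneq q 0%N; first by rewrite mul0n.
    have [->|r0] := eqVneq r 0%N; first by rewrite muln0.
    by rewrite test_comp_par0.
  rewrite /=; move: e s.
  case: (test_comp l p i M q); case: (test_comp (l + M).-1 _ _ _ _);
  case: (test_comp l p j n r); case: (test_comp (l + n).-1 _ _ _ _) => //= _;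
    rewrite ?mul0r ?mulr0 ?mul0rz// => ->//.
  by rewrite mulr1z mulrAC.
Qed.

Lemma test_comp_generators i1 i2 : (2 <= i2 < N)%N -> (i1 + i2 <= N)%N ->
  test_comp (i1 + 1 + (N - i1 - i2)) (i1 + 1 + (N - i1 - i2) - 2) i1 i2 (i2 - 2) =
  (i1 == 0%N) && (i2 == N.-1).
Proof. by rewrite /test_comp; lia. Qed.

End TestOperad.

(** Sending every generator to 1 in the test operad, one term of the expanded boundary survives,
    [i1 = 0] and [i2 = N - 1], so the boundary of [m N] maps to a unit of the integers. *)
Lemma Ainf_bd_torsion_free (A : dg_operad_data) (m : forall n, op A n (n - 2)) N (z : int) :
  is_Ainf m -> (3 <= N)%N -> odiff (m N) *~ z = 0 -> z = 0.
Proof.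
move=> [A_dg A_free A_bd] N3 hz; have [A_op _ _ _ _] := A_dg.
have [[f f_mor fm] _] := A_free _ (fun n => 1 : op (test_operad N) n (n - 2)) (test_operadP N3).
have := congr1 (f _ _) hz; rewrite (operad_mor0 f_mor) (operad_morMz f_mor) A_bd; last lia.
rewrite (operad_morN f_mor) (operad_mor_sum f_mor).
have term (i1 : 'I_N.+1) (i2 : 'I_N) : (2 <= i2)%N && (i1 + i2 <= N)%N ->
  f _ _ (let i3 := (N - i1 - i2)%N in
         transport (ocomp i1 (m (i1 + 1 + i3)%N) (m i2)) *~ (-1) ^+ (i1 + i2 * i3)
         : op A N (N - 2).-1) =
  (if ((i1 : nat) == 0%N) && ((i2 : nat) == N.-1) then (-1) ^+ (i1 + i2 * (N - i1 - i2)) else 0 : int).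
  move=> /andP[i2_ge iN]; rewrite /= (operad_morMz f_mor) (operad_mor_transport f_mor).
  have [_ _ fo] := f_mor; rewrite fo; last by lia.
  have i2N := ltn_ord i2; rewrite !fm//; last by lia.
  rewrite test_transport; last by congr pair; have := ltn_ord i2; lia.
  rewrite /= test_comp_generators//; last by have := ltn_ord i2; lia.
  by case: ifP => _; rewrite ?mul0rz// mul1r intz.
rewrite (eq_bigr (fun i1 : 'I_N.+1 => \sum_(i2 < N | (2 <= i2)%N && (i1 + i2 <= N)%N)
  (if ((i1 : nat) == 0%N) && ((i2 : nat) == N.-1)
   then (-1) ^+ (i1 + i2 * (N - i1 - i2)) else 0 : int))); last first.
  move=> i1 _; rewrite (operad_mor_sum f_mor).
  by apply: eq_bigr => i2 c; exact: term.
rewrite (bigD1 (ord0 : 'I_N.+1))//= [X in _ + X]big1 ?addr0; last first.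
  move=> i1 i1n0; apply: big1 => i2 c; rewrite ifF//.
  by apply/negP => /andP[/eqP e _]; move/eqP: i1n0; apply; exact: val_inj.
have NN : (N.-1 < N)%N by lia.
rewrite (bigD1 (Ordinal NN))/=; last by apply/andP; split; lia.
rewrite [X in _ + X]big1 ?addr0; last first.
  move=> i2 /andP[c i2n]; rewrite ifF//.
  by apply/negP => /eqP e; move/eqP: i2n; apply; exact: val_inj.
rewrite eqxx -mulrzr intz => /eqP; rewrite mulf_eq0 oppr_eq0 signr_eq0 /= => /eqP.
by [].
Qed.

(** * The boundary of the sum of all binary trees *)

Section EdgeOrder.

Lemma dsum_mem (V : zmodType) (F : edge -> seq edge -> V) w : uniq w ->
  dsum F w = \sum_(v <- w) F v (rem v w) *~ (-1) ^+ index v w.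
Proof.
elim: w F => [|x w IH] F; first by rewrite big_nil.
move=> /= /andP[xw uw]; rewrite big_cons /= eqxx expr0 mulr1z; congr (_ + _).
rewrite IH// -sumrN; apply: eq_big_seq => v vw.
have xv : x != v by apply: contraNneq xw => ->.
by rewrite (negPf xv) exprS mulN1r mulrNz.
Qed.

Lemma rem_cat_mid (T : eqType) (e : T) u v : e \notin u -> rem e (u ++ e :: v) = u ++ v.
Proof.
elim: u => [|x u IH] /=; first by rewrite eqxx.
by rewrite inE negb_or eq_sym => /andP[/negPf -> /IH ->].
Qed.

Lemma index_cat_mid (T : eqType) (e : T) u v : e \notin u -> index e (u ++ e :: v) = size u.
Proof. by move=> eu; rewrite index_cat (negPf eu) /= eqxx addn0. Qed.

(** Thus the edges starting at or before a given leaf form an initial segment of the list. *)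
Lemma vertex_edges_sorted o t : binary t ->
  pairwise (fun e e' : edge => e.1 <= e'.1)%N (vertex_edges o t).
Proof.
move=> bt; elim/binary_ind: t / bt o => [//|x y bx yb IHx IHy] o.
have sx := binary_stable bx; have sy := binary_stable yb.
rewrite vertex_edges_binary pairwise_cons pairwise_cat IHx IHy /= !andbT.
rewrite all_cat; apply/andP; split; [apply/andP; split|].
- by apply/allP => e /(vertex_edges_in sx)[].
- by apply/allP => e /(vertex_edges_in sy)[] /=; lia.
- apply/allrelP => e e' /(vertex_edges_in sx)[? ? ?] /(vertex_edges_in sy)[? ? ?]; lia.
Qed.

Lemma edges_sorted t : binary t ->
  pairwise (fun e e' : edge => e.1 <= e'.1)%N (edges t).
Proof.
move=> /(vertex_edges_sorted 0); rewrite /edges.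
by case: (vertex_edges 0 t) => //= e s /andP[].
Qed.

Lemma filter_start_cat i (s : seq edge) :
  pairwise (fun e e' : edge => e.1 <= e'.1)%N s ->
  [seq e <- s | (e.1 <= i)%N] ++ [seq e <- s | (i < e.1)%N] = s.
Proof.
elim: s => [//|x s IH] /= /andP[/allP xs ps]; have [xi|xi] := leqP x.1 i.
  by rewrite /= IH.
have e1 : [seq e <- s | (e.1 <= i)%N] = [::].
  by apply/eqP; rewrite -[_ == _]negbK -has_filter; apply/hasPn => e /xs; lia.
rewrite e1 /=; congr cons; rewrite -[RHS]IH// e1.
by [].
Qed.

Lemma size_edges_binary t : binary t -> size (edges t) = (leaves t - 2)%N.
Proof. by move=> bt; rewrite /edges size_behead size_vertex_edges_binary//; lia. Qed.

End EdgeOrder.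

Section CellsInSkeleta.
Variable R : realType.
Implicit Types (b : pred edge) (w : seq edge) (l : lengths R).

Lemma closed_cell_tree_point t b w l : stable t ->
  (forall e, b e -> e \in edges t) -> {subset w <= edges t} ->
  closed_cell b w l -> tree_point (leaves t) l t.
Proof.
move=> st bt wt lc; split=> // e; first by case: (lc e).
move=> et; case: (lc e) => _ -> //; last by apply: contra et; exact: wt.
by case: ifP => // /bt; rewrite (negPf et).
Qed.

(** [s] lists some of the infinite edges: each lowers the dimension by one, and the empty list
    places the cell in the top skeleton. *)
Lemma closed_cell_Ainf t b w (s : seq edge) : stable t ->
  (forall e, b e -> e \in edges t) -> {subset w <= edges t} ->
  uniq s -> (forall e, e \in s -> b e && (e \notin w)) ->
  @closed_cell R b w `<=` skel (@Ainf_cells R (leaves t)) (leaves t - 2 - size s).+1.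
Proof.
move=> st bt wt us sb l lc; apply/skel_AinfP; exists t; first exact: closed_cell_tree_point lc.
rewrite ltnS leq_sub2l// -size_filter; apply: uniq_leq_size => // e /sb /andP[be ew].
rewrite mem_filter (bt _ be) andbT /infinite; case: (lc e) => _ -> //.
by rewrite be.
Qed.

Lemma closed_cell_Omega t b w : stable t ->
  (forall e, b e -> e \in edges t) -> {subset w <= edges t} ->
  @closed_cell R b w `<=` skel (@OmegaBAs_cells R (leaves t)) (size w).+1.
Proof.
move=> st bt wt l lc; apply/skel_OmegaP; exists t; first exact: closed_cell_tree_point lc.
rewrite ltnS -size_filter; apply: uniq_leq_size; first exact/filter_uniq/edges_uniq.
move=> e; rewrite mem_filter /finite_pos => /andP[/andP[l0 li] _].
by apply/negPn/negP => ew; case: (lc e) => _ /(_ ew) le; move: l0 li; rewrite le; case: ifP; rewrite ?eqxx.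
Qed.

(** An equality of maps, not just of classes: the coordinates of a product are concatenated, as are
    the lists of free edges. *)
Lemma cross_edge_cube t1 t2 i : stable t1 -> stable t2 -> (1 < leaves t1)%N ->
  (1 < leaves t2)%N -> (i < leaves t1)%N -> forall p q,
  size (edges t1) = p -> size (edges t2) = q ->
  cross_cube (graft (leaves t1) (leaves t2) i)
    (@edge_cube R p pred0 (edges t1)) (@edge_cube R q pred0 (edges t2)) =
  @edge_cube R (p + q) (setb (i, leaves t2) pred0)
    (map (outer i (leaves t2)) (edges t1) ++ map (shift_edge i) (edges t2)).
Proof.
move=> s1 s2 l1 l2 il p q sp sq; apply: funext => x; rewrite /cross_cube.
set L1 := edge_cube _ _ _; set L2 := edge_cube _ _ _.
have L10 e : e \notin edges t1 -> L1 e = 0%E by rewrite /L1 /edge_cube => /negPf ->.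
have L20 e : e \notin edges t2 -> L2 e = 0%E by rewrite /L2 /edge_cube => /negPf ->.
have oinj : injective (outer i (leaves t2)).
  by move=> [a b] [c d]; rewrite /outer /=; do 4?case: ifP => ?; move=> -[]; do 2?move=> ?; congr pair; lia.
have sinj : injective (shift_edge i).
  by move=> [a b] [c d]; rewrite /shift_edge /= => -[? ->]; congr pair; lia.
apply: funext => e.
have ne1 : (i, leaves t2) \notin map (outer i (leaves t2)) (edges t1).
  apply/mapP => -[f /(edges_in s1)[_ f2 _] ef].
  by have := outer_neq i l2 f2; rewrite -ef eqxx.
have ne2 : (i, leaves t2) \notin map (shift_edge i) (edges t2).
  by apply/mapP => -[f /(edges_in s2)[_ f2 f3] [_ ef]]; move: f3; rewrite ef; lia.
rewrite /edge_cube mem_cat.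
have [->|ee] := eqVneq e (i, leaves t2).
  by rewrite (negPf ne1) (negPf ne2) orFb /setb /graft !eqxx l1 l2.
case: (boolP (e \in map (outer i (leaves t2)) (edges t1))) => e1; rewrite ?orTb ?orFb.
  have /mapP[f ft ef] := e1.
  rewrite index_cat e1 ef graft_outer//; last by case: (edges_in s1 ft).
  rewrite index_map// /L1 /edge_cube ft.
  have fp : (index f (edges t1) < p)%N by rewrite -sp index_mem.
  have fpq : (index f (edges t1) < p + q)%N by lia.
  rewrite (insubT (fun m => m < p)%N fp) (insubT (fun m => m < p + q)%N fpq) /=.
  by congr (length_of (x _)); exact: val_inj.
case: (boolP (e \in map (shift_edge i) (edges t2))) => e2.
  have /mapP[f ft ef] := e2; have [f1 f2 f3] := edges_in s2 ft.
  rewrite index_cat (negPf e1) ef graft_inner//; last by apply: contraTneq f3 => ->; rewrite ltnn.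
  rewrite index_map// size_map sp /L2 /edge_cube ft.
  have fq : (index f (edges t2) < q)%N by rewrite -sq index_mem.
  have fpq : (p + index f (edges t2) < p + q)%N by lia.
  rewrite (insubT (fun m => m < q)%N fq) (insubT (fun m => m < p + q)%N fpq) /=.
  by congr (length_of (x _)); exact: val_inj.
by rewrite /setb (negPf ee) (graft_out _ (ltnW l2) L10 L20).
Qed.

Lemma transport_class (X : nat -> cells (lengths R)) n k n' k' (c : chains R (lengths R) k) :
  n = n' -> k = k' ->
  transport (cell_class (X n) c : op (cell_operad X) n k) =
  (cell_class (X n') (castc k' c) : op (cell_operad X) n' k').
Proof. by move=> en ek; subst n' k'; rewrite transport_id castc_id. Qed.

End CellsInSkeleta.

(** * Faces with an infinite edge and the A-infinity signs *)

Section TreeSums.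
Variable V : zmodType.
Implicit Types (F : pred edge -> seq edge -> V) (t : ribbon).

Definition tree_sum (f : seq edge -> V) n : V :=
  \sum_(t <- brt n) f (edges t) *~ (-1) ^+ tree_sign t.

Definition delta_inf F b w : V := dsum (fun x u => F (setb x b) u) w.

Lemma deltaE F b w : delta F b w = delta_inf F b w - d0 (F b) w.
Proof. exact: dsumB. Qed.

Lemma tree_sum_delta F n b : tree_sum (delta F b) n = tree_sum (delta_inf F b) n.
Proof.
rewrite -[RHS]subr0 -(sum_interior_faces n (F b)) -sumrB; apply: eq_bigr => t _.
by rewrite -mulrzBl deltaE.
Qed.

Lemma sum_edges_range (G : nat -> nat -> V) n (s : seq edge) : uniq s ->
  (forall e, e \in s -> [/\ (e.1 + e.2 <= n)%N, (2 <= e.2)%N & (e.2 < n)%N]) ->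
  \sum_(e <- s) G e.1 e.2 =
  \sum_(i1 < n.+1) \sum_(i2 < n | (2 <= i2)%N && (i1 + i2 <= n)%N)
    (if (i1 : nat, i2 : nat) \in s then G i1 i2 else 0).
Proof.
move=> us se.
transitivity (\sum_(i1 < n.+1) \sum_(i2 < n | (2 <= i2)%N && (i1 + i2 <= n)%N)
    \sum_(e <- s) (if e == (i1 : nat, i2 : nat) then G e.1 e.2 else 0)); last first.
  apply: eq_bigr => i1 _; apply: eq_bigr => i2 _; case: ifP => h.
    rewrite (bigD1_seq (i1 : nat, i2 : nat))//= eqxx big1 ?addr0// => e /negPf -> //.
  by rewrite big_seq big1// => e es; case: eqP => // ee; rewrite -ee es in h.
under [RHS]eq_bigr => i1 _ do rewrite exchange_big.
rewrite exchange_big /=; apply: eq_big_seq => -[a b] /se /= [ab b2 bn].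
have an : (a < n.+1)%N by lia.
rewrite (bigD1 (Ordinal an)) //= (bigD1 (Ordinal bn)) /=; last by rewrite b2.
rewrite eqxx big1 ?addr0; last first.
  move=> i /andP[_ /eqP ni]; case: eqP => // -[bi]; case: ni; exact: val_inj.
rewrite big1 ?addr0// => i1 /eqP ni; rewrite big1// => i2 _.
by case: eqP => // -[ai _]; case: ni; exact: val_inj.
Qed.

Lemma count_edges i t : count (fun x : edge => (i < x.1)%N) (vertex_edges 0 t) =
  count (fun x : edge => (i < x.1)%N) (edges t).
Proof. by case: t => [//|ts]; rewrite edges_node vertex_edges_node. Qed.

(** Three signs are compared: the position of the new edge, the passage of the edges of [t2] across
    those of [t1] to their right, and the change of [tree_sign]. [left_count_right] relates them. *)
Lemma grafted_face_sign k (f : seq edge -> V) t1 t2 i : binary t1 -> binary t2 ->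
  (2 <= leaves t1)%N -> (2 <= leaves t2)%N -> (i < leaves t1)%N ->
  (k + 3 = leaves t1 + leaves t2 - 1)%N -> alt_at k f ->
  let e := (i, leaves t2) in let t := tgraft t1 i t2 in
  f (rem e (edges t)) *~ (-1) ^+ index e (edges t) *~ (-1) ^+ tree_sign t =
  - (f (map (outer i (leaves t2)) (edges t1) ++ map (shift_edge i) (edges t2))
       *~ (-1) ^+ (tree_sign t1 + tree_sign t2)
       *~ (-1) ^+ (i + leaves t2 * (leaves t1 + leaves t2 - 1 - i - leaves t2))).
Proof.
move=> b1 b2 l1 l2 il kE af e t.
have s1 := binary_stable b1; have s2 := binary_stable b2.
set u := [seq x <- edges t1 | (x.1 <= i)%N].
set v := [seq x <- edges t1 | (i < x.1)%N].
have uv : edges t1 = u ++ v by rewrite filter_start_cat//; exact: edges_sorted.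
have et : edges t = map (outer i (leaves t2)) u ++
    e :: (map (shift_edge i) (edges t2) ++ map (outer i (leaves t2)) v).
  by rewrite /t edges_tgraft.
have eu : e \notin map (outer i (leaves t2)) u.
  apply/mapP => -[x]; rewrite mem_filter => /andP[_ /(edges_in s1)[_ x2 _]] ex.
  by have := outer_neq i l2 x2; rewrite -ex eqxx.
rewrite et rem_cat_mid// index_cat_mid// size_map.
set E2 := map (shift_edge i) (edges t2).
have sz1 := size_edges_binary b1; have sz2 := size_edges_binary b2.
have suv : (size u + size v = leaves t1 - 2)%N by rewrite -size_cat -uv.
have sE2 : size E2 = (leaves t2 - 2)%N by rewrite size_map.
have -> : map (outer i (leaves t2)) u ++ E2 ++ map (outer i (leaves t2)) v =
    map (outer i (leaves t2)) u ++ E2 ++ map (outer i (leaves t2)) v ++ [::] by rewrite cats0.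
(* The edges of [t2] pass those of [t1] starting to the right of [i]: a sign of exponent
   [(leaves t2 - 2) * size v]. *)
rewrite (alt_swap af); last first.
  rewrite !size_cat sE2 !size_map /= addn0 addnCA suv; lia.
rewrite cats0 catA -map_cat -uv sE2 size_map !mulrz_signD.
have -> (x : V) m : - (x *~ (-1) ^+ m) = x *~ (-1) ^+ m.+1.
  by rewrite exprS mulN1r mulrNz.
apply: eq_mulrz_sign; rewrite /t tree_sign_tgraft//.
have := left_count_right b1 il.
have -> : count (fun x : edge => (i < x.1)%N) (vertex_edges 0 t1) = size v.
  by rewrite /v size_filter count_edges.
set c := left_count t1 i; move: (size u) (size v) suv => a d suv; clearbody c.
set q := leaves t2 in l2 *; clearbody q.
set p := leaves t1 in l1 suv *; clearbody p.
move=> cp; have -> : (p + q - 1 - i - q = c + d)%N by lia.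
(* From [a + d = p - 2] and [c + d + i + 1 = p] follows [a + 1 = c + i]; what remains is an identity
   of parities. *)
have : odd a = ~~ (odd c (+) odd i) by rewrite -oddD; lia.
case: q l2 => [//|[//|r]] _; rewrite subSS subSS subn0 /= !(oddD, oddM) /= => ->.
by case: (odd c) (odd i) (odd r) (odd d) (odd (tree_sign t1)) (odd (tree_sign t2)) => [] [] [] [] [] [].
Qed.

Definition grafted_sum F k i l : V :=
  \sum_(t1 <- brt (k + 4 - l)) \sum_(t2 <- brt l)
    F (setb (i, l) pred0) (map (outer i l) (edges t1) ++ map (shift_edge i) (edges t2))
      *~ (-1) ^+ (tree_sign t1 + tree_sign t2).

(** A tree with a distinguished internal edge is a pair of trees with a grafting position; the
    double sum is reorganized by the edge. *)
Lemma tree_sum_delta_inf F k : (forall b, alt_at k (F b)) ->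
  tree_sum (delta_inf F pred0) k.+3 =
  - \sum_(i1 < k.+4) \sum_(i2 < k.+3 | (2 <= i2)%N && (i1 + i2 <= k.+3)%N)
      grafted_sum F k i1 i2 *~ (-1) ^+ (i1 + i2 * (k.+3 - i1 - i2)).
Proof.
move=> aF.
pose T i l t : V := F (setb (i, l) pred0) (rem (i, l) (edges t))
  *~ (-1) ^+ index (i, l) (edges t) *~ (-1) ^+ tree_sign t.
transitivity (\sum_(t <- brt k.+3) \sum_(i1 < k.+4)
    \sum_(i2 < k.+3 | (2 <= i2)%N && (i1 + i2 <= k.+3)%N)
      (if (i1 : nat, i2 : nat) \in vertex_edges 0 t then T i1 i2 t else 0)).
  apply: eq_big_seq => t; rewrite mem_brt => /andP[bt /eqP tn].
  have st := binary_stable bt.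
  rewrite /delta_inf dsum_mem ?edges_uniq// sumr_mulrz.
  transitivity (\sum_(e <- edges t) T e.1 e.2 t).
    by apply: eq_bigr => -[a b] _.
  rewrite (@sum_edges_range (fun a b => T a b t) k.+3) ?edges_uniq//; last first.
    by move=> e /(edges_in st)[]; rewrite tn.
  apply: eq_bigr => i1 _; apply: eq_bigr => i2 _; congr (if _ then _ else _).
  case: t bt tn st => [|ts] bt tn st; first by move: tn.
  (* The bound [i2 < n] excludes the root edge, so [edges] may be replaced by [vertex_edges 0]. *)
  rewrite edges_node vertex_edges_node inE.
  have /negPf -> // : (i1 : nat, i2 : nat) != (0%N, leaves (Node ts)).
  by apply/eqP => -[_ e2]; have := ltn_ord i2; rewrite [X in (X < _)%N]e2 [X in (X < _)%N]tn ltnn.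
rewrite exchange_big -sumrN; apply: eq_bigr => i1 _.
rewrite exchange_big -sumrN; apply: eq_bigr => i2 /andP[i20 i12] /=.
have i2n := ltn_ord i2.
rewrite -big_mkcond sum_brt_edge// (_ : (k.+3 + 1 - i2 = k + 4 - i2)%N); last lia.
rewrite /grafted_sum sumr_mulrz -sumrN; apply: eq_big_seq => t1.
rewrite mem_brt => /andP[b1 /eqP l1]; rewrite sumr_mulrz -sumrN; apply: eq_big_seq => t2.
rewrite mem_brt => /andP[b2 /eqP l2]; rewrite /T -l2 (@grafted_face_sign k); rewrite ?l1 ?l2//; [|lia..].
by do 3?congr (- (_ *~ _)); congr (_ ^+ _); congr (_ + _ * _)%N; lia.
Qed.

End TreeSums.

Section GraftedFaces.
Variable R : realType.
Local Notation L := (lengths R).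
Implicit Types (b : pred edge) (w : seq edge) (t : ribbon).

Local Notation grafted t1 i t2 :=
  (map (outer i (leaves t2)) (edges t1) ++ map (shift_edge i) (edges t2)).

Lemma brt_leaves n t : t \in brt n -> binary t /\ leaves t = n.
Proof. by rewrite mem_brt => /andP[? /eqP]. Qed.

Lemma good_edges t : stable t -> good pred0 (edges t).
Proof. by move=> st; rewrite /good edges_uniq//=; apply/allP. Qed.

Section Pair.
Variables (t1 t2 : ribbon) (i : nat).
Hypotheses (s1 : stable t1) (s2 : stable t2).
Hypotheses (l1 : (1 < leaves t1)%N) (l2 : (1 < leaves t2)%N) (il : (i < leaves t1)%N).

Lemma perm_grafted : perm_eq ((i, leaves t2) :: grafted t1 i t2) (edges (tgraft t1 i t2)).
Proof.
rewrite edges_tgraft// perm_sym (permPl (perm_graft_edges _ _ _ _)).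
by rewrite -cat1s perm_catCA.
Qed.

Lemma good_grafted : good (setb (i, leaves t2) pred0) (grafted t1 i t2).
Proof.
by have [] := good_cons (good_edges (stable_tgraft i s1 s2)) perm_grafted.
Qed.

(** Used with [x] empty for the product cell itself, and with one edge for its infinite faces. *)
Lemma grafted_Ainf x u : perm_eq (x ++ u) (grafted t1 i t2) ->
  @closed_cell R (fun e => (e \in x) || setb (i, leaves t2) pred0 e) u `<=`
  skel (Ainf_cells R (leaves t1 + leaves t2).-1)
    ((leaves t1 + leaves t2).-1 - 2 - (size x).+1).+1.
Proof.
move=> xu; have st := stable_tgraft i s1 s2.
have lt := leaves_tgraft t2 il.
have -> : ((leaves t1 + leaves t2).-1 = leaves (tgraft t1 i t2))%N by rewrite -lt.
have pe : perm_eq ((i, leaves t2) :: x ++ u) (edges (tgraft t1 i t2)).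
  by rewrite -(permPr perm_grafted) perm_cons.
have : uniq ((i, leaves t2) :: x ++ u) by rewrite (perm_uniq pe) edges_uniq.
rewrite /= mem_cat cat_uniq negb_or => /and4P[/andP[nx nu] ux /hasPn xu' _].
apply: (@closed_cell_Ainf R _ _ u ((i, leaves t2) :: x)) => //=.
- move=> e; rewrite -(perm_mem pe) inE mem_cat /setb orbF => /orP[->|->//].
  by rewrite orbT.
- by move=> e eu; rewrite -(perm_mem pe) inE mem_cat eu !orbT.
- by rewrite nx.
- move=> e; rewrite inE /setb orbF => /orP[/eqP ->|ex]; first by rewrite eqxx orbT nu.
  by rewrite ex /=; apply/negP => /xu'; rewrite ex.
Qed.

End Pair.

Variable k : nat.
Implicit Types G : pred edge -> seq edge -> chains R L k.

(** Faces with a collapsed edge do not drop to a lower A-infinity cell; they cancel in the sum,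
    separately for the edges of [t1] and of [t2]. *)
Lemma grafted_delta G i l N : (2 <= l)%N -> (l < N.+3)%N -> (i + l <= N.+3)%N ->
  (forall b u, G b u \in chain_on (closed_cell b u)) ->
  \sum_(t1 <- brt (N + 4 - l)) \sum_(t2 <- brt l)
     delta G (setb (i, l) pred0) (map (outer i l) (edges t1) ++ map (shift_edge i) (edges t2))
       *~ (-1) ^+ (tree_sign t1 + tree_sign t2)
  \in chain_on (skel (Ainf_cells R N.+3) N).
Proof.
move=> l2 lN ilN GS.
pose b := setb (i, l) pred0.
have d0_sum : \sum_(t1 <- brt (N + 4 - l)) \sum_(t2 <- brt l)
     d0 (G b) (map (outer i l) (edges t1) ++ map (shift_edge i) (edges t2))
       *~ (-1) ^+ (tree_sign t1 + tree_sign t2) = 0.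
  under eq_bigr => t1 _ do under eq_bigr => t2 _ do
    rewrite /d0 dsum_cat mulrzDl !dsum_map size_map.
  under eq_bigr => t1 _ do rewrite big_split.
  rewrite big_split /= [X in X + _]exchange_big /=.
  rewrite [X in X + _]big1_seq ?add0r => [|t2 _].
    rewrite big1_seq// => t1 _.
    transitivity (tree_sum (d0 (fun v => G b (map (outer i l) (edges t1) ++ map (shift_edge i) v))) l
       *~ (-1) ^+ (size (edges t1) + tree_sign t1)).
      rewrite /tree_sum sumr_mulrz; apply: eq_bigr => t2 _.
      by rewrite !mulrz_signD; apply: eq_mulrz_sign; lia.
    by rewrite /tree_sum sum_interior_faces mul0rz.
  transitivity (tree_sum (d0 (fun u => G b (map (outer i l) u ++ map (shift_edge i) (edges t2))))
       (N + 4 - l) *~ (-1) ^+ tree_sign t2).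
    rewrite /tree_sum sumr_mulrz; apply: eq_bigr => t1 _.
    by rewrite mulrz_signD.
  by rewrite /tree_sum sum_interior_faces mul0rz.
(* Adding the vanishing sum of collapsed faces leaves only the infinite faces, which can be treated
   one at a time. *)
rewrite -[X in X \in _]addr0 -[X in _ + X]d0_sum -big_split big_seq rpred_sum// => t1.
move=> /brt_leaves[b1 e1]; rewrite -big_split big_seq rpred_sum// => t2 /brt_leaves[b2 e2].
rewrite /= -mulrzDl deltaE subrK rpredMz//.
have s1 := binary_stable b1; have s2 := binary_stable b2.
apply: dsum_in => x u; rewrite -e2 => xu.
have szu : (size u).+1 = N.
  have := perm_size xu; rewrite /= size_cat !size_map !size_edges_binary// e1 e2; lia.
have := @grafted_Ainf t1 t2 i s1 s2 ltac:(lia) ltac:(lia) ltac:(lia) [:: x] u xu.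
rewrite e1 e2 (_ : (N + 4 - l + l).-1 = N.+3)%N; last lia.
rewrite (_ : (N.+3 - 2 - 2).+1 = N)%N; last lia.
move=> xN; apply: chain_on_sub (GS _ _) => y yc; apply: xN.
move=> e; case: (yc e) => y0 y1; split=> // eu; rewrite y1// /b /setb inE.
by rewrite mem_seq1.
Qed.

End GraftedFaces.

(** * Sums over binary trees as relative cycles, and their boundary *)

Section TreeCycles.
Variable R : realType.
Local Notation L := (lengths R).
Local Notation X := (@Ainf_cells R).
Local Notation dg := (@chain_on R L _ set0).
Implicit Types (b : pred edge) (w : seq edge) (t : ribbon).

Lemma degenerate_sub k (D : set L) (c : chains R L k) : c \in dg -> c \in chain_on D.
Proof. exact: (chain_on_sub (sub0set _)). Qed.

Lemma tree_sub k t : t \in brt k.+2 ->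
  @closed_cell R pred0 (edges t) `<=` skel (X k.+2) k.+1.
Proof.
move=> /brt_leaves[bt lt]; have st := binary_stable bt.
have := @closed_cell_Ainf R t pred0 (edges t) [::] st.
by rewrite lt !subSS !subn0; apply=> // e; rewrite in_nil.
Qed.

Lemma tree_face_sub k t x u : t \in brt k.+2 -> perm_eq (x :: u) (edges t) ->
  @closed_cell R (setb x pred0) u `<=` skel (X k.+2) k.
Proof.
move=> /brt_leaves[bt lt] xu; have st := binary_stable bt.
have ux : uniq (x :: u) by rewrite (perm_uniq xu) edges_uniq.
have sz := perm_size xu; rewrite size_edges_binary// lt /= in sz.
have := @closed_cell_Ainf R t (setb x pred0) u [:: x] st.
rewrite lt (_ : (k.+2 - 2 - size [:: x]).+1 = k)%N; last by move=> /=; lia.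
apply=> //.
- by move=> e; rewrite /setb orbF => /eqP ->; rewrite -(perm_mem xu) mem_head.
- by move=> e eu; rewrite -(perm_mem xu) inE eu orbT.
- by move=> e; rewrite mem_seq1 => /eqP ->; rewrite /setb eqxx; case/andP: ux.
Qed.

Section Delta.
Variables (j : nat) (G : pred edge -> seq edge -> chains R L j).
Hypothesis GS : forall b u, G b u \in chain_on (closed_cell b u).

Lemma tree_sum_on k : tree_sum (G pred0) k.+2 \in chain_on (skel (X k.+2) k.+1).
Proof.
rewrite /tree_sum big_seq rpred_sum// => t tn; rewrite rpredMz//.
exact: chain_on_sub (tree_sub tn) (GS _ _).
Qed.

Lemma tree_sum_delta_on k : tree_sum (delta G pred0) k.+2 \in chain_on (skel (X k.+2) k).
Proof.
rewrite tree_sum_delta /tree_sum big_seq rpred_sum// => t tn; rewrite rpredMz//.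
by apply: dsum_in => x u xu; exact: chain_on_sub (tree_face_sub tn xu) (GS _ _).
Qed.

Lemma grafted_sum_on N i l : (2 <= l)%N -> (l < N.+3)%N -> (i + l <= N.+3)%N ->
  grafted_sum G N i l \in chain_on (skel (X N.+3) N.+1).
Proof.
move=> l2 lN ilN; rewrite /grafted_sum big_seq rpred_sum// => t1 /brt_leaves[b1 e1].
rewrite big_seq rpred_sum// => t2 /brt_leaves[b2 e2]; rewrite rpredMz//.
have s1 := binary_stable b1; have s2 := binary_stable b2.
have := @grafted_Ainf R t1 t2 i s1 s2 ltac:(lia) ltac:(lia) ltac:(lia) [::] _ (perm_refl _).
rewrite e1 e2 (_ : (N + 4 - l + l).-1 = N.+3)%N; last lia.
rewrite (_ : (N.+3 - 2 - 1).+1 = N.+1)%N; last lia.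
by move=> xN; apply: chain_on_sub (GS _ _).
Qed.

End Delta.

Lemma tree_sum_raddf (V W : zmodType) (h : {additive V -> W}) f n :
  h (tree_sum f n) = tree_sum (h \o f) n.
Proof. by rewrite raddf_sum; apply: eq_bigr => t _; rewrite raddfMz. Qed.

Lemma tree_sumB (V : zmodType) (f g : seq edge -> V) n :
  tree_sum f n - tree_sum g n = tree_sum (fun w => f w - g w) n.
Proof. by rewrite -sumrB; apply: eq_bigr => t _; rewrite mulrzBl. Qed.

Lemma tree_sum_dg j k (f : seq edge -> chains R L j) :
  (forall w, size w = k -> good pred0 w -> f w \in dg) -> tree_sum f k.+2 \in dg.
Proof.
move=> fdg; rewrite /tree_sum big_seq rpred_sum// => t /brt_leaves[bt lt].
rewrite rpredMz// fdg// ?size_edges_binary ?lt ?subSS ?subn0//.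
exact/good_edges/binary_stable.
Qed.

Lemma grafted_sumB (V : zmodType) (F G : pred edge -> seq edge -> V) N i l :
  grafted_sum F N i l - grafted_sum G N i l = grafted_sum (fun b w => F b w - G b w) N i l.
Proof.
rewrite -sumrB; apply: eq_bigr => t1 _; rewrite -sumrB.
by apply: eq_bigr => t2 _; rewrite mulrzBl.
Qed.

Lemma grafted_sum_raddf (V W : zmodType) (h : {additive V -> W}) F N i l :
  h (grafted_sum F N i l) = grafted_sum (fun b w => h (F b w)) N i l.
Proof.
rewrite raddf_sum; apply: eq_bigr => t1 _; rewrite raddf_sum.
by apply: eq_bigr => t2 _; rewrite raddfMz.
Qed.

Lemma grafted_sum_dg j N i l (F : pred edge -> seq edge -> chains R L j) :
  (2 <= l)%N -> (l < N.+3)%N -> (i + l <= N.+3)%N ->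
  (forall b w, size w = N -> good b w -> F b w \in dg) -> grafted_sum F N i l \in dg.
Proof.
move=> l2 lN ilN Fdg; rewrite /grafted_sum big_seq rpred_sum// => t1 /brt_leaves[b1 e1].
rewrite big_seq rpred_sum// => t2 /brt_leaves[b2 e2]; rewrite rpredMz//.
have s1 := binary_stable b1; have s2 := binary_stable b2.
apply: Fdg; first by rewrite size_cat !size_map !size_edges_binary// e1 e2; lia.
by rewrite -e2; apply: good_grafted => //; lia.
Qed.

Section CubeSystem.
(** Instantiated both with the cubes [edge_chain] and with their replacements [alt_chain]. *)
Variable G : forall k, pred edge -> seq edge -> chains R L k.
Hypothesis GS : forall k b u, G k b u \in chain_on (closed_cell b u).
Hypothesis bdG : forall k b w, size w = k.+1 -> good b w ->
  bd (G k.+1 b w) - delta (G k) b w \in dg.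

Lemma bd_tree_sum k :
  bd (tree_sum (G k.+1 pred0) k.+3) - tree_sum (delta_inf (G k) pred0) k.+3 \in dg.
Proof.
rewrite -tree_sum_delta (tree_sum_raddf (@bd R L k.+1)) tree_sumB.
by apply: tree_sum_dg => w; exact: bdG.
Qed.

Lemma tree_sum_cycle k : tree_sum (G k pred0) k.+2 \in @cell_cycle R L (X k.+2) k.
Proof.
apply/rel_cycleP; split; first exact: tree_sum_on.
case: k => [|k]; first by rewrite bd_dim0 rpred0.
rewrite -[X in X \in _](subrK (tree_sum (delta_inf (G k) pred0) k.+3)) rpredD//.
  exact/degenerate_sub/bd_tree_sum.
by rewrite -tree_sum_delta; exact: tree_sum_delta_on.
Qed.

Lemma cell_bd_tree_sum k : cell_bd (cell_class (X k.+3) (tree_sum (G k.+1 pred0) k.+3)) =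
  cell_class (X k.+3) (tree_sum (delta_inf (G k) pred0) k.+3).
Proof.
rewrite cell_bd_class; last exact: tree_sum_cycle.
apply: (@cell_class_eq _ _ _ _ _ _ 0); rewrite ?rpred0 ?raddf0 ?addr0//.
  exact: (bd_cell_cycle (tree_sum_cycle _)).
exact/degenerate_sub/bd_tree_sum.
Qed.

Lemma grafted_sum_cycle N i l : (2 <= l)%N -> (l < N.+3)%N -> (i + l <= N.+3)%N ->
  grafted_sum (G N) N i l \in @cell_cycle R L (X N.+3) N.
Proof.
move=> l2 lN ilN; apply/rel_cycleP; split; first exact: grafted_sum_on.
case: N lN ilN => [|N] lN ilN; first by rewrite bd_dim0 rpred0.
rewrite -[X in X \in _](subrK (grafted_sum (delta (G N)) N.+1 i l)) rpredD//; last first.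
  exact: grafted_delta.
rewrite (grafted_sum_raddf (@bd R L N.+1)) grafted_sumB; apply: degenerate_sub.
by apply: grafted_sum_dg => // b w; exact: bdG.
Qed.

End CubeSystem.

Lemma bd_edge_chain_dg k b w : size w = k.+1 -> good b w ->
  bd (edge_chain R k.+1 b w) - delta (edge_chain R k) b w \in dg.
Proof. by move=> sw gw; rewrite bd_edge_chain// subrr rpred0. Qed.

Let homotopy_regroup (V : zmodType) (a b c d : V) : a - b - c - d = - (c - (a - b - d)).
Proof. by rewrite opprB addrAC. Qed.

(** The boundary of the homotopy differs from the difference of the two sums by faces of the
    homotopy; in the sum over trees the collapsed ones cancel and the rest lies in the lower
    skeleton. *)
Lemma tree_sum_homotopy k :
  cell_class (X k.+2) (tree_sum (edge_chain R k pred0) k.+2) =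
  cell_class (X k.+2) (tree_sum (alt_chain R k pred0) k.+2).
Proof.
apply: (@cell_class_eq _ _ _ _ _ _ (tree_sum (alt_homotopy R k pred0) k.+2)).
- exact: (tree_sum_cycle (@edge_chain_on R) bd_edge_chain_dg).
- exact/tree_sum_on/alt_homotopy_on.
have hd : tree_sum (delta_homotopy R k pred0) k.+2 \in chain_on (skel (X k.+2) k).
  case: k => [|k]; last exact/tree_sum_delta_on/alt_homotopy_on.
  by rewrite /tree_sum big1 ?rpred0// => t _; rewrite mul0rz.
rewrite -[X in X \in _](subrK (tree_sum (delta_homotopy R k pred0) k.+2)) rpredD//.
apply: degenerate_sub.
rewrite (tree_sum_raddf (@bd R L k.+1)) !tree_sumB.
apply: tree_sum_dg => w sw gw; rewrite /= homotopy_regroup rpredN.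
exact: bd_alt_homotopy.
Qed.

Lemma grafted_sum_homotopy N i l : (2 <= l)%N -> (l < N.+3)%N -> (i + l <= N.+3)%N ->
  cell_class (X N.+3) (grafted_sum (edge_chain R N) N i l) =
  cell_class (X N.+3) (grafted_sum (alt_chain R N) N i l).
Proof.
move=> l2 lN ilN.
apply: (@cell_class_eq _ _ _ _ _ _ (grafted_sum (alt_homotopy R N) N i l)).
- exact: (grafted_sum_cycle (@edge_chain_on R) bd_edge_chain_dg).
- by apply: grafted_sum_on => //; exact: alt_homotopy_on.
have hd : grafted_sum (delta_homotopy R N) N i l \in chain_on (skel (X N.+3) N).
  case: N lN ilN => [|N] lN ilN; last by apply: grafted_delta => //; exact: alt_homotopy_on.
  by rewrite /grafted_sum big1 ?rpred0// => t1 _; rewrite big1// => t2 _; rewrite mul0rz.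
rewrite -[X in X \in _](subrK (grafted_sum (delta_homotopy R N) N i l)) rpredD//.
apply: degenerate_sub.
rewrite (grafted_sum_raddf (@bd R L N.+1)) !grafted_sumB.
apply: grafted_sum_dg => // b w sw gw; rewrite /= homotopy_regroup rpredN.
exact: bd_alt_homotopy.
Qed.

(** The signs are computed on the alternating chains; the homotopies translate both sides back to
    cubes, on which products are explicit. *)
Lemma cell_bd_binary_trees N :
  cell_bd (cell_class (X N.+3) (tree_sum (edge_chain R N.+1 pred0) N.+3)) =
  - \sum_(i1 < N.+4) \sum_(i2 < N.+3 | (2 <= i2)%N && (i1 + i2 <= N.+3)%N)
      cell_class (X N.+3) (grafted_sum (edge_chain R N) N i1 i2)
        *~ (-1) ^+ (i1 + i2 * (N.+3 - i1 - i2)).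
Proof.
have KZ := @grafted_sum_cycle (alt_chain R) (@alt_chain_on R) (@bd_alt_chain R) N.
rewrite tree_sum_homotopy (cell_bd_tree_sum (@alt_chain_on R) (@bd_alt_chain R)).
rewrite tree_sum_delta_inf; last by move=> b; exact: alt_chain_alt.
rewrite /cell_class hclassN; last first.
  by apply: rpred_sum => i1 _; apply: rpred_sum => i2 /andP[i20 ?]; rewrite rpredMz// KZ.
congr (- _); rewrite hclass_sum => [|i1 _]; last first.
  by apply: rpred_sum => i2 /andP[i20 ?]; rewrite rpredMz// KZ.
apply: eq_bigr => i1 _; rewrite hclass_sum => [|i2 /andP[i20 ?]]; last first.
  by rewrite rpredMz// KZ.
apply: eq_bigr => i2 /andP[i20 i12].
rewrite hclassMz; last by apply: KZ.
by have := grafted_sum_homotopy i20 (ltn_ord i2) i12; rewrite /cell_class => ->.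
Qed.

Lemma cross_tree_sum N i l : (2 <= l)%N -> (l < N.+3)%N -> (i + l <= N.+3)%N ->
  forall c p q, c = (N + 4 - l)%N -> p = (c - 2)%N -> q = (l - 2)%N ->
  castc N (cross_chain (graft c l i) (tree_sum (edge_chain R p pred0) c) (tree_sum (edge_chain R q pred0) l)) =
  grafted_sum (edge_chain R N) N i l.
Proof.
move=> l2 lN ilN c p q cE pE qE.
rewrite crosslE (tree_sum_raddf (crossl (graft c l i) _)).
rewrite (tree_sum_raddf (@castc R L (p + q) N)) /grafted_sum -cE.
apply: eq_big_seq => t1 /brt_leaves[b1 e1].
rewrite /= -crosslE (tree_sum_raddf (@cross_chain R L L L (graft c l i) p q _)).
rewrite (tree_sum_raddf (@castc R L (p + q) N)) sumr_mulrz.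
apply: eq_big_seq => t2 /brt_leaves[b2 e2].
rewrite mulrz_signD [(tree_sign t2 + _)%N]addnC /=; congr (_ *~ _).
have s1 := binary_stable b1; have s2 := binary_stable b2.
rewrite /edge_chain cross_scube.
have := @cross_edge_cube R t1 t2 i s1 s2; rewrite e1 e2 => -> //.
- rewrite -[scube _]/(edge_chain R (p + q) _ _).
  have pqN : (p + q = N)%N by lia.
  by clear pE qE; subst N; rewrite castc_id.
- by lia.
- by lia.
- by rewrite size_edges_binary ?e1.
- by rewrite size_edges_binary ?e2.
Qed.

End TreeCycles.

(** * Comparison of the two cellular operads *)

Section OrientedTrees.
Variable R : realType.
Local Notation L := (lengths R).
Local Notation Y := (@OmegaBAs_cells R).
Local Notation dg := (@chain_on R L _ set0).

Section OneTree.
Variables (t : ribbon) (k : nat) (w : seq edge).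
Hypotheses (st : stable t) (lt : leaves t = k.+2) (wt : perm_eq w (edges t)) (sw : size w = k).

Lemma good_ordering : good pred0 w.
Proof. by rewrite /good (perm_uniq wt) edges_uniq//=; apply/allP. Qed.

Lemma tree_cell_sub : @closed_cell R pred0 w `<=` skel (Y k.+2) k.+1.
Proof.
rewrite -lt -sw; apply: closed_cell_Omega => // e; by rewrite (perm_mem wt).
Qed.

Lemma tree_cell_face_sub x u (b : pred edge) : perm_eq (x :: u) w ->
  (forall e, b e -> e = x) -> @closed_cell R b u `<=` skel (Y k.+2) k.
Proof.
move=> xu bx; have su : (size u).+1 = k by rewrite -sw -(perm_size xu).
have mu e : e \in x :: u -> e \in edges t by rewrite (perm_mem xu) (perm_mem wt).
rewrite -lt -[X in skel _ X]su.
apply: closed_cell_Omega => // e; last by move=> eu; rewrite mu// inE eu orbT.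
by move=> /bx ->; rewrite mu// mem_head.
Qed.

(** In the finer decomposition collapsed faces are lower cells too, so one tree at a time
    suffices. *)
Lemma tree_cell_delta_on j (G : pred edge -> seq edge -> chains R L j) :
  (forall b u, G b u \in chain_on (closed_cell b u)) ->
  delta G pred0 w \in chain_on (skel (Y k.+2) k).
Proof.
move=> GS; apply: dsum_in => x u xu; rewrite rpredB//.
  by apply: chain_on_sub (GS _ _); apply: tree_cell_face_sub xu _ => e /orP[/eqP|].
exact: chain_on_sub (tree_cell_face_sub xu _) (GS _ _).
Qed.

Lemma tree_cell_cycle (G : forall k, pred edge -> seq edge -> chains R L k) :
  (forall k b u, G k b u \in chain_on (closed_cell b u)) ->
  (forall k b w, size w = k.+1 -> good b w -> bd (G k.+1 b w) - delta (G k) b w \in dg) ->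
  G k pred0 w \in @cell_cycle R L (Y k.+2) k.
Proof.
move=> GS bdG; apply/rel_cycleP; split; first exact: chain_on_sub tree_cell_sub (GS _ _ _).
(* [k] is fixed by the hypotheses on [w]; a fresh [j] allows the case analysis on the degree. *)
suff h j : j = k -> bd (G j pred0 w) \in chain_on (skel (Y k.+2) k) by exact: h.
case: j => [|j] jk; first by rewrite bd_dim0 rpred0.
rewrite -[X in X \in _](subrK (delta (G j) pred0 w)) rpredD//; last exact: tree_cell_delta_on.
by apply/degenerate_sub/bdG; [rewrite sw | exact: good_ordering].
Qed.

Lemma tree_cell_homotopy :
  cell_class (Y k.+2) (edge_chain R k pred0 w) = cell_class (Y k.+2) (alt_chain R k pred0 w).
Proof.
apply: (@cell_class_eq _ _ _ _ _ _ (alt_homotopy R k pred0 w)).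
- exact: (tree_cell_cycle (@edge_chain_on R) (@bd_edge_chain_dg R)).
- exact: (chain_on_sub tree_cell_sub (@alt_homotopy_on R k pred0 w)).
have hd : delta_homotopy R k pred0 w \in chain_on (skel (Y k.+2) k).
  suff h j : j = k -> delta_homotopy R j pred0 w \in chain_on (skel (Y k.+2) k) by exact: h.
  by case: j => [|j] jk; [exact: rpred0 | apply: tree_cell_delta_on; exact: alt_homotopy_on].
rewrite -[X in X \in _](subrK (delta_homotopy R k pred0 w)) rpredD//.
apply: degenerate_sub.
have -> (V : zmodType) (a b c d : V) : a - b - c - d = - (c - (a - b - d)).
  by rewrite opprB addrAC.
by rewrite rpredN; exact: bd_alt_homotopy sw good_ordering.
Qed.

Lemma cell_param_edge_cube : @cell_param R t k w = edge_cube pred0 w.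
Proof.
apply: funext => x; apply: funext => e; rewrite /cell_param /edge_cube (perm_mem wt).
by case: ifP.
Qed.

End OneTree.

(** After passing to [alt_chain], the comparison of orderings is an equality of chains, given by
    [omega_can_spec]. *)
Lemma oriented_tree_canonical k t : t \in brt k.+2 ->
  oriented_tree R k.+2 k t (omega_can t) =
  cell_class (Y k.+2) (edge_chain R k pred0 (edges t)) *~ (-1) ^+ tree_sign t.
Proof.
move=> /brt_leaves[bt lt]; have st := binary_stable bt.
have [wt alt] := omega_can_spec bt ltac:(lia).
have sz : size (edges t) = k by rewrite size_edges_binary// lt !subSS subn0.
have sw : size (omega_can t).2 = k by rewrite (perm_size wt).
have KZ := @tree_cell_cycle t k _ st lt _ _ (alt_chain R) (@alt_chain_on R) (@bd_alt_chain R).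
rewrite /oriented_tree (cell_param_edge_cube _ wt).
rewrite -[hclass _ _ _]/(cell_class (Y k.+2) (edge_chain R k pred0 (omega_can t).2)).
rewrite (tree_cell_homotopy st lt wt sw) (tree_cell_homotopy st lt (perm_refl _) sz).
rewrite /cell_class -hclassMz; last exact: KZ.
rewrite -hclassMz; last exact: KZ.
congr hclass; apply: alt; rewrite lt !subSS subn0; exact: alt_chain_alt.
Qed.

Lemma sum_oriented_trees k :
  \sum_(t \in BRT k.+2) oriented_tree R k.+2 k t (omega_can t) =
  cell_map (Y k.+2) id (cell_class (Ainf_cells R k.+2) (tree_sum (edge_chain R k pred0) k.+2)).
Proof.
rewrite cell_map_class; last first.
- exact: (tree_sum_cycle (@edge_chain_on R) (@bd_edge_chain_dg R)).
- by move=> j x; exact: skel_Ainf_Omega.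
- by apply: continuous_subspaceT => x; exact: cvg_id.
rewrite push_id.
have -> : BRT k.+2 = [set` brt k.+2]%classic.
  apply/seteqP; split=> t; last by move=> /brt_leaves.
  by move=> [bt lt]; suff : t \in brt k.+2 by []; rewrite mem_brt bt lt eqxx.
rewrite -fsbig_seq; last exact: uniq_brt_upto.
rewrite /cell_class /tree_sum big_seq [in RHS]big_seq hclass_sum; last first.
  move=> t /brt_leaves[bt lt]; rewrite rpredMz//; have st := binary_stable bt.
  apply: (@tree_cell_cycle t k _ st lt _ _ (edge_chain R) (@edge_chain_on R) (@bd_edge_chain_dg R)) => //.
  by rewrite size_edges_binary// lt !subSS subn0.
apply: eq_bigr => t tn; rewrite oriented_tree_canonical// hclassMz//.
have [bt lt] := brt_leaves tn; have st := binary_stable bt.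
apply: (@tree_cell_cycle t k _ st lt _ _ (edge_chain R) (@edge_chain_on R) (@bd_edge_chain_dg R)) => //.
by rewrite size_edges_binary// lt !subSS subn0.
Qed.

End OrientedTrees.

Section IdentityMorphism.
Variable R : realType.
Local Notation L := (lengths R).
Local Notation X := (@Ainf_cells R).
Local Notation Y := (@OmegaBAs_cells R).

Lemma cell_cross_graft (Z : nat -> cells L) : graft_cellular Z ->
  forall M n p q i (c : chains R L p) (d : chains R L q), (i < M)%N ->
  c \in @cell_cycle R L (Z M) p -> d \in @cell_cycle R L (Z n) q ->
  cell_cross (Z (M + n).-1) (graft M n i) (cell_class (Z M) c) (cell_class (Z n) d) =
  cell_class (Z (M + n).-1) (cross_chain (graft M n i) c d).
Proof.
move=> gZ M n p q i c d iM cZ dZ.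
apply: (@cell_cross_class _ _ _ _ (Z M) (Z n)) => //; first exact: graft_continuous.
by move=> a b x y; exact: gZ.
Qed.

Lemma cross_graft_cycle (Z : nat -> cells L) : graft_cellular Z ->
  forall M n p q i (c : chains R L p) (d : chains R L q), (i < M)%N ->
  c \in @cell_cycle R L (Z M) p -> d \in @cell_cycle R L (Z n) q ->
  cross_chain (graft M n i) c d \in @cell_cycle R L (Z (M + n).-1) (p + q).
Proof.
move=> gZ M n p q i c d iM cZ dZ.
apply: (@cross_cell_cycle _ _ _ _ (Z M) (Z n)) => //; first exact: graft_continuous.
by move=> a b x y; exact: gZ.
Qed.

Lemma sub_cell_cycle n k (c : chains R L k) :
  c \in @cell_cycle R L (X n) k -> c \in @cell_cycle R L (Y n) k.
Proof.
move=> /rel_cycleP[c1 c2]; apply/rel_cycleP.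
by split; [apply: chain_on_sub c1|apply: chain_on_sub c2]; exact: skel_Ainf_Omega.
Qed.

Lemma cell_map_id n k (c : chains R L k) : c \in @cell_cycle R L (X n) k ->
  cell_map (Y n) id (cell_class (X n) c) = cell_class (Y n) c.
Proof.
move=> cZ; rewrite cell_map_class ?push_id//.
  by apply: continuous_subspaceT => x; exact: cvg_id.
by move=> j x; exact: skel_Ainf_Omega.
Qed.

Lemma constant_cycle (Z : cells L) (l : L) : skel Z 1 l ->
  scube (fun=> l) \in @cell_cycle R L Z 0.
Proof.
move=> Zl; apply/rel_cycleP; rewrite bd_dim0 rpred0; split=> //.
by apply: scube_on; right; split; [exact: (@cst_continuous (cube R 0) L l) | move=> x].
Qed.

Lemma cell_map_id_morphism :
  is_dg_operad_mor (fun n k (x : op (cell_operad X) n k) => cell_map (Y n) id x : op (OmegaBAs R) n k).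
Proof.
split; first split.
- move=> n k x y; have [c cZ ->] := cell_class_rep x; have [d dZ ->] := cell_class_rep y.
  have -> : cell_class (X n) c - cell_class (X n) d = cell_class (X n) (c - d).
    by rewrite /cell_class hclassB.
  rewrite !cell_map_id ?rpredB//; rewrite /cell_class hclassB//; exact: sub_cell_cycle.
- rewrite /= -[hclass _ _ _ in LHS]/(cell_class (X 1) _) cell_map_id//.
  apply: constant_cycle; apply/skel_AinfP; exists Leaf => //.
- move=> M n p q i x y iM; have [c cZ ->] := cell_class_rep x.
  have [d dZ ->] := cell_class_rep y.
  have gA := @graft_cellular_Ainf R; have gO := @graft_cellular_Omega R.
  transitivity (cell_class (Y (M + n).-1) (cross_chain (graft M n i) c d)).
    rewrite -[ocomp _ _ _]/(cell_cross (X (M + n).-1) (graft M n i)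
      (cell_class (X M) c) (cell_class (X n) d)) (cell_cross_graft gA iM cZ dZ).
    exact: (cell_map_id (cross_graft_cycle gA iM cZ dZ)).
  rewrite (cell_map_id cZ) (cell_map_id dZ).
  exact/esym/(cell_cross_graft gO iM (sub_cell_cycle cZ) (sub_cell_cycle dZ)).
move=> n k x; have [c cZ ->] := cell_class_rep x.
rewrite (cell_map_id cZ) -[odiff _]/(cell_bd (cell_class (X n) c)).
rewrite -[odiff _]/(cell_bd (cell_class (Y n) c)) (cell_bd_class cZ).
rewrite (cell_bd_class (sub_cell_cycle cZ)); exact: (cell_map_id (bd_cell_cycle cZ)).
Qed.

End IdentityMorphism.

(** * The case of two leaves *)

Section TwoLeaves.
Variable R : realType.
Local Notation L := (lengths R).

Lemma lodayE2 : @loday R 2 = [set const_mx 1].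
Proof.
apply/seteqP; split=> x /=.
  move=> [+ _]; rewrite big_ord1 binn => x1; apply/rowP => j.
  by rewrite mxE ord1.
move=> ->; split; first by rewrite big_ord1 mxE binn.
by move=> i1 i2 /andP[h1 h2]; move: (leq_trans h1 h2).
Qed.

Lemma loday_boundaryE2 : @loday_boundary R 2 = set0.
Proof.
apply/seteqP; split=> x //= [i1 [i2 [/andP[h1 h2] _ _]]].
by move: (leq_trans h1 h2).
Qed.

(** A 0-dimensional parallelepiped is its center, and [K] minus that point is empty, like the
    boundary. The defining property thus says that the class is that of the point, which determines
    the choice made by [xget]. *)
Lemma loday_class2 : loday_class R 2 =
  hclass (@loday R 2) (@loday_boundary R 2) (scube (fun=> const_mx 1)).
Proof.
set q : 'rV[R]_(2.-1) := const_mx 1.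
have par (eps : R) p (x : cube R 0) : parallelepiped p (fun j : 'I_(2 - 2) => eps *: loday_basis R j) x = p.
  by rewrite /parallelepiped big_ord0 addr0.
have Kq (eps : R) p : p = q -> @loday R 2 `\ (p + \sum_(j : 'I_(2 - 2)) (eps / 2) *: loday_basis R j) =
    @loday_boundary R 2.
  move=> ->; rewrite big_ord0 addr0 lodayE2 loday_boundaryE2.
  by apply/seteqP; split=> x //= [-> /(_ erefl)].
have hid (c : relH R (2 - 2) (@loday R 2) (@loday_boundary R 2)) :
    hmap id (@loday R 2) (@loday_boundary R 2) c = c.
  by rewrite /hmap push_id hrepK.
have fund c : is_fundamental_class (@loday_basis R 2) c <->
    c = hclass (@loday R 2) (@loday_boundary R 2) (scube (fun=> q)).
  have parE (eps : R) : parallelepiped q (fun j : 'I_(2 - 2) => eps *: loday_basis R j) = fun=> q.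
    by apply: funext => x; rewrite par.
  split=> [h|-> p eps eps0 hK].
    have := h q 1 ltr01; rewrite /= Kq// hid parE; apply.
    by move=> x; rewrite lodayE2.
  have pq : p = q.
    by have := hK (fun=> unitI_bool R true); rewrite par lodayE2.
  by rewrite /= Kq// hid pq parE.
apply/fund; apply: xgetPex; exists (hclass (@loday R 2) (@loday_boundary R 2) (scube (fun=> q))).
exact/fund.
Qed.

Lemma Tbar2 (l : L) : Tbar 2 l -> l = fun=> 0%E.
Proof.
move=> [t [st lt] [_ l0]]; apply: funext => e; apply: l0.
by have := size_edges st; rewrite lt leqn0 size_eq0 => /eqP ->.
Qed.

Lemma top_cell2 phi : is_loday_iso phi -> @top_cell R 2 phi =
  cell_class (Ainf_cells R 2) (tree_sum (edge_chain R 0 pred0) 2).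
Proof.
move=> [phi_cont _ phi_in _]; rewrite /top_cell loday_class2.
have phi0 x : loday x -> phi x = fun=> 0%E by move=> /phi_in/Tbar2.
have K1 : @loday R 2 (const_mx 1) by rewrite lodayE2.
have sk1 : skel (Ainf_cells R 2) 1 (fun=> 0%E : \bar R).
  apply/skel_AinfP; exists (Node [:: Leaf; Leaf]) => //; split=> //.
rewrite hmap_hclass//.
- rewrite push_scube /tree_sum /= big_seq1 mulr1z /cell_class; congr (hclass _ _ (scube _)).
  by apply: funext => x; rewrite /= phi0// /edge_cube.
- by move=> x /phi0 ->.
- by rewrite loday_boundaryE2.
- by move=> x; rewrite loday_boundaryE2.
apply/rel_cycleP; rewrite bd_dim0 rpred0; split=> //.
apply: scube_on; right; split=> //; exact: (@cst_continuous (cube R 0)).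
Qed.

End TwoLeaves.

(** * Images of the generators *)

Section TopCells.
Variable R : realType.
Local Notation L := (lengths R).
Local Notation X := (@Ainf_cells R).
Variables (phi : forall n, 'rV[R]_(n.-1) -> L) (A : dg_operad_data).
Variables (m : forall n, op A n (n - 2)).
Variable Theta : forall n k, op A n k -> op (cell_operad X) n k.
Hypothesis phi_iso : forall n, (2 <= n)%N -> is_loday_iso (@phi n).
Hypothesis A_inf : is_Ainf m.
Hypothesis Theta_iso : is_dg_operad_iso (@Theta).
Hypothesis Theta_m : forall n, (2 <= n)%N -> Theta (m n) = top_cell (@phi n).

(** Beyond two leaves, the orientation of the top cell is forced by the compatibility of [Theta]
    with composites and differentials. *)
Lemma Theta_generator n : (2 <= n)%N ->
  Theta (m n) = cell_class (X n) (tree_sum (edge_chain R (n - 2) pred0) n).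
Proof.
have [[ Theta_mor Theta_d] Theta_bij] := Theta_iso.
have [A_dg A_free A_bd] := A_inf; have [A_op odiffB _ _ _] := A_dg.
elim/ltn_ind: n => n IH n2.
case: n IH n2 => [|[|[|N]]] IH n2 //; first by rewrite Theta_m// top_cell2//; exact: phi_iso.
pose c := cell_class (X N.+3) (tree_sum (edge_chain R N.+1 pred0) N.+3).
(* Both factors of each term, of arities [N + 4 - i2] and [i2], have between 2 and [N + 2] inputs,
   so the induction hypothesis applies to them. *)
have dc : cell_bd c = Theta (odiff (m N.+3)).
  rewrite /c cell_bd_binary_trees A_bd//.
  rewrite (operad_morN Theta_mor) (operad_mor_sum Theta_mor); congr (- _).
  apply: eq_bigr => i1 _; rewrite (operad_mor_sum Theta_mor).
  apply: eq_bigr => i2 /andP[i20 i12]; have i2n := ltn_ord i2.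
  rewrite (operad_morMz Theta_mor) (operad_mor_transport Theta_mor); congr (_ *~ _).
  have [_ _ Theta_comp] := Theta_mor.
  set a := (i1 + 1 + (N.+3 - i1 - i2))%N.
  have aE : a = (N + 4 - i2)%N by rewrite /a; lia.
  rewrite Theta_comp; last by lia.
  rewrite (IH a) ?(IH i2)//; [|lia..].
  have cyc k : (2 <= k)%N ->
      tree_sum (edge_chain R (k - 2) pred0) k \in @cell_cycle R L (X k) (k - 2).
    move=> k2; have -> : k = (k - 2).+2 by lia.
    have -> : ((k - 2).+2 - 2 = k - 2)%N by lia.
    exact: (tree_sum_cycle (@edge_chain_on R) (@bd_edge_chain_dg R)).
  have cp := cell_cross_graft (@graft_cellular_Ainf R) (i := i1) (M := a) (n := i2) _ (cyc a _) (cyc i2 i20).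
  rewrite -[ocomp _ _ _]/(cell_cross (X (a + i2).-1) (graft a i2 i1)
     (cell_class (X a) _) (cell_class (X i2) _)) cp; [|lia..].
  rewrite transport_class; [|lia..].
  by rewrite cross_tree_sum.
(* Surjectivity of [Theta] enters here; its injectivity is used below, one degree lower. *)
have [z cz] : exists z : int, c = Theta (m N.+3) *~ z.
  have [g gK Kg] := Theta_bij N.+3 N.+1.
  have [z gz] := free_top_span A_op A_free (g c) isT.
  by exists z; rewrite -(operad_morMz Theta_mor) -gz Kg.
suff z1 : z = 1 by rewrite -[LHS]mulr1z -z1.
apply/eqP; rewrite -subr_eq0; apply/eqP.
apply: (@Ainf_bd_torsion_free A m N.+3) => //.
rewrite mulrzBr mulr1z; apply/eqP; rewrite subr_eq0; apply/eqP.
apply: (bij_inj (Theta_bij N.+3 N.+1.-1)); rewrite -[in RHS]dc cz.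
pose dM := GRing.isZmodMorphism.Build _ _ (@odiff A N.+3 N.+1) (odiffB N.+3 N.+1).
pose d : {additive op A N.+3 N.+1 -> op A N.+3 N} := HB.pack (@odiff A N.+3 N.+1) dM.
rewrite -(operad_morMz Theta_mor).
have dMz : odiff (m N.+3 *~ z) = odiff (m N.+3) *~ z := raddfMz d z (m N.+3).
by have := Theta_d N.+3 N.+1 (m N.+3 *~ z); rewrite dMz.
Qed.

End TopCells.

Theorem proposition7 (R : realType)
  (phi : forall n, 'rV[R]_(n.-1) -> lengths R)
  (phi_iso : forall n, (2 <= n)%N -> is_loday_iso (phi n))
  (A : dg_operad_data) (m : forall n, op A n (n - 2)) (A_inf : is_Ainf m)
  (Theta : forall n k, op A n k -> op (cell_operad (@Ainf_cells R)) n k)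
  (Theta_iso : is_dg_operad_iso Theta)
  (Theta_m : forall n, (2 <= n)%N -> Theta n (n - 2)%N (m n) = top_cell (phi n)) :
  [/\ forall n, cellular (@Ainf_cells R n) (@OmegaBAs_cells R n) id,
      @is_dg_operad_mor A (OmegaBAs R)
        (fun n k x => cell_map (@OmegaBAs_cells R n) id (Theta n k x)) &
      forall n, (2 <= n)%N ->
        cell_map (@OmegaBAs_cells R n) id (Theta n (n - 2)%N (m n)) =
        \sum_(t \in BRT n) oriented_tree R n (n - 2) t (omega_can t)].
Proof.
split; first exact: Ainf_Omega_cellular.
- have [[[ Theta_B Theta_1 Theta_comp] Theta_d] _] := Theta_iso.
  have [[idB id1 id_comp] id_d] := @cell_map_id_morphism R.
  split; first split.
  + by move=> n k x y; rewrite Theta_B idB.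
  + by rewrite Theta_1 id1.
  + by move=> M n p q i x y iM; rewrite Theta_comp// id_comp.
  + by move=> n k x; rewrite Theta_d id_d.
move=> n n2; rewrite (Theta_generator phi_iso A_inf Theta_iso Theta_m n2).
(* The sum over trees was computed for arity [k.+2] and degree [k]. *)
have -> : n = (n - 2).+2 by lia.
have -> : ((n - 2).+2 - 2 = n - 2)%N by lia.
exact/esym/sum_oriented_trees.
Qed.
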